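(* Let $(E,\phi)$ be an abelian $t$-module of dimension $d$ over $K$, let $D\in\mathrm{Mat}_{d\times d}(K\{\tau\})$ represent $\phi_t$ with respect to a fixed coordinate system, and let $\mathsf{M}=\mathsf{M}(E)$ be its $t$-motive. Then $\mathsf{M}$ is pure if and only if the Newton polygon of the last invariant factor $\lambda_d\in K(\!(\sigma)\!)[t]$ of $D$ consists of exactly one edge. In this case the weight $w(\mathsf{M})$ equals the reciprocal $1/s$ of the slope $s$ of this edge.
   Context: Let $\mathbb{F}_q$ be the finite field with $q$ elements, $K$ a perfect field containing $\mathbb{F}_q$, and $\ell:\mathbb{F}_q[t]\to K$ an $\mathbb{F}_q$-algebra homomorphism. $K\{\tau\}$ is the skew polynomial ring $\{\sum\alpha_i\tau^i:\alpha_i\in K\}$ with $\tau\alpha=\alpha^q\tau$, identified with $\mathbb{F}_q$-linear endomorphisms of $\mathbb{G}_a$ over $K$. $K(\!(\sigma)\!)$ is the skew Laurent series field in $\sigma$ with $\sigma\alpha=\alpha^{1/q}\sigma$, valuation $v$ = order in $\sigma$, and $K\{\tau\}\subseteq K(\!(\sigma)\!)$ via $\tau\mapsto\sigma^{-1}$. A $t$-module $(E,\phi)$ of dimension $d$: an $\mathbb{F}_q$-vector space scheme $E\cong\mathbb{G}_a^d$ over $K$ with an $\mathbb{F}_q$-algebra homomorphism $\phi:\mathbb{F}_q[t]\to\mathrm{End}_{\mathrm{grp},\mathbb{F}_q}(E)$ such that $d\phi_a-\ell(a)$ is nilpotent on $\mathrm{Lie}(E)$ for all $a$. Its $t$-motive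 $\mathsf{M}(E)=\mathrm{Hom}_{\mathrm{grp},\mathbb{F}_q}(E,\mathbb{G}_a)$ is a left $K\{\tau\}$-module (post-composition), free of rank $d=\dim E$, and a $K[t]$-module ($t$ acts by pre-composition with $\phi_t$); $E$ is abelian if $\mathsf{M}(E)$ is finitely generated over $K[t]$ (then it is free over $K[t]$ of some rank $\mathrm{rk}(E)$). Purity: $K(\!(1/t)\!)\otimes_{K[t]}\mathsf{M}$ carries the semilinear operator $\tau(f\otimes m)=f^{(1)}\otimes\tau m$, where for $f=\sum\alpha_it^{-i}$ one puts $f^{(1)}=\sum\alpha_i^qt^{-i}$. $\mathsf{M}$ (and $E$) is pure if there exist a $K[\![1/t]\!]$-lattice $\tilde\Lambda$ (finitely generated $K[\![1/t]\!]$-submodule containing a $K(\!(1/t)\!)$-basis) in $K(\!(1/t)\!)\otimes_{K[t]}\mathsf{M}$ and positive integers $u,v$ with $t^u\tilde\Lambda=\tau^v\tilde\Lambda$. The weight of $\mathsf{M}$ is $w(\mathsf{M})=\dim(E)/\mathrm{rk}(E)$. Invariant factors: elementary row and column operations over $K(\!(\sigma)\!)[t]$ ($t$ central) bring $t\mathbf{1}_d-D$ into diagonal form $\mathrm{diag}(\lambda_1,\dots,\lambda_d)$, $\lambda_i$ monic, each $\lambda_i$ a left and right divisor of $\lambda_{i+1}$; the Newton polygons of the $\lambda_i$ are independent of choices. Newton polygon of $f=\sum a_it^i$: lower convex hull of the points $(i,v(a_i))$ with $a_i\ne0$; slope of an edge from $(i,w_i)$ to $(j,w_j)$ is $(w_j-w_i)/(j-i)$.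 *)

(* Defs.v *)
From HB Require Import structures.
From mathcomp Require Import all_boot all_order all_algebra.
From Stdlib Require Import ClassicalEpsilon Relations.
Set Implicit Arguments. Unset Strict Implicit. Unset Printing Implicit Defensive.
Import Order.TTheory GRing.Theory Num.Theory.
Local Open Scope ring_scope.

Section Defs.
Variables (K : fieldType) (q : nat) (qroot : K -> K).
(* qroot is the inverse of the q-Frobenius x |-> x^q (K perfect). *)

Definition isum (lo hi : int) (F : int -> K) : K :=
  if lo <= hi then \sum_(i < (absz (hi - lo)).+1) F (lo + (i : nat)%:Z) else 0.

Definition frob_int (a : int) (x : K) : K :=
  match a with Posz n => x ^+ (q ^ n) | Negz n => iter n.+1 qroot x end.

(* ---------- skew Laurent series K((sigma)) : coefficient of sigma^k ---------- *)
Definition LS := int -> K.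
Definition ls0 : LS := fun _ => 0.
Definition ls1 : LS := fun k => (k == 0)%:R.
Definition lbounded (f : LS) : Prop := exists N : int, forall k, k < N -> f k = 0.
Definition lbound (f : LS) : int :=
  match excluded_middle_informative (lbounded f) with
  | left H => proj1_sig (constructive_indefinite_description _ H)
  | right _ => 0 end.
(* product with  sigma * alpha = alpha^(1/q) * sigma,
   i.e.  sigma^a beta = beta^(q^(-a)) sigma^a *)
Definition ls_mul (f g : LS) : LS := fun k =>
  isum (lbound f) (k - lbound g) (fun a => f a * frob_int (- a) (g (k - a))).
Definition ls_val (f : LS) (w : int) : Prop :=
  f w <> 0 /\ forall k, k < w -> f k = 0.

(* ---------- K((sigma))[t] (t central): coefficient of t^n ---------- *)
Definition LP := nat -> LS.
Definition lp0 : LP := fun _ => ls0.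
Definition lp1 : LP := fun n => if n == 0%N then ls1 else ls0.
Definition isLP (f : LP) : Prop :=
  (exists N, forall n, (N <= n)%N -> f n = ls0) /\ forall n, lbounded (f n).
Definition lp_add (f g : LP) : LP := fun n k => f n k + g n k.
Definition lp_mul (f g : LP) : LP := fun n k =>
  \sum_(i < n.+1) ls_mul (f i) (g (n - i)%N) k.
Definition lp_unit (u : LP) : Prop :=
  isLP u /\ exists w, isLP w /\ lp_mul u w = lp1 /\ lp_mul w u = lp1.
Definition lp_monic (f : LP) : Prop :=
  isLP f /\ exists n, f n = ls1 /\ forall m, (n < m)%N -> f m = ls0.

Definition LPmx (d : nat) := 'I_d -> 'I_d -> LP.
Definition elem_step (d : nat) (A B : LPmx d) : Prop :=
  (exists i j : 'I_d, B = fun a b => A (if a == i then j else if a == j then i else a) b)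
  \/ (exists i j : 'I_d, B = fun a b => A a (if b == i then j else if b == j then i else b))
  \/ (exists (i : 'I_d) u, lp_unit u /\
        B = fun a b => if a == i then lp_mul u (A a b) else A a b)
  \/ (exists (j : 'I_d) u, lp_unit u /\
        B = fun a b => if b == j then lp_mul (A a b) u else A a b)
  \/ (exists (i j : 'I_d) r, i != j /\ isLP r /\
        B = fun a b => if a == i then lp_add (A i b) (lp_mul r (A j b)) else A a b)
  \/ (exists (i j : 'I_d) r, i != j /\ isLP r /\
        B = fun a b => if b == i then lp_add (A a i) (lp_mul (A a j) r) else A a b).
Definition elem_equiv (d : nat) : relation (LPmx d) :=
  clos_refl_trans _ (@elem_step d).

(* K{tau} is represented by coefficient sequences: p`_i is the coefficient of tau^i.
   Embedding K{tau} -> K((sigma)), tau |-> sigma^-1. *)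
Definition tau_to_ls (p : {poly K}) : LS := fun k => if k <= 0 then p`_(absz k) else 0.

Definition charmx (d : nat) (D : 'I_d -> 'I_d -> {poly K}) : LPmx d :=
  fun i j n k => ((n == 1%N) && (i == j) && (k == 0))%:R
                 - (if n == 0%N then tau_to_ls (D i j) k else 0).
Definition diagmx (d : nat) (lam : nat -> LP) : LPmx d :=
  fun i j => if i == j then lam (i : nat) else lp0.

Definition invariant_factors (d : nat) (D : 'I_d -> 'I_d -> {poly K}) (lam : nat -> LP) :=
  elem_equiv (charmx D) (@diagmx d lam)
  /\ (forall i, (i < d)%N -> lp_monic (lam i))
  /\ (forall i, (i.+1 < d)%N ->
        (exists c, isLP c /\ lam i.+1 = lp_mul (lam i) c)
        /\ (exists c, isLP c /\ lam i.+1 = lp_mul c (lam i))).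

(* The Newton polygon of f (lower convex hull of the points (i, v(f_i)), f_i <> 0)
   consists of exactly one edge, of slope s: there are at least two points and
   all points lie on or above the segment joining the leftmost point (i0,v0) to
   the rightmost point (n,vn). *)
Definition np_one_edge (f : LP) (s : rat) : Prop :=
  exists (i0 n : nat) (v0 vn : int),
    (i0 < n)%N /\ ls_val (f i0) v0 /\ ls_val (f n) vn
    /\ (forall i, (i < i0)%N -> f i = ls0) /\ (forall i, (n < i)%N -> f i = ls0)
    /\ s = (vn - v0)%:~R / ((n - i0)%N)%:R
    /\ (forall (i : nat) (w : int), ls_val (f i) w ->
          v0%:~R + s * (i%:R - i0%:R) <= (w%:~R : rat)).

(* ---------- the t-motive M(E) = K{tau}^(1 x d) (row vectors) ---------- *)
Definition skmul (a b : {poly K}) : {poly K} :=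
  \poly_(n < size a + size b) \sum_(i < n.+1) a`_i * (b`_(n - i)) ^+ (q ^ i).
Definition Mot (d : nat) := 'I_d -> {poly K}.
(* t . m = m o phi_t = m * D *)
Definition mot_t (d : nat) (D : 'I_d -> 'I_d -> {poly K}) (m : Mot d) : Mot d :=
  fun j => \sum_(k < d) skmul (m k) (D k j).
Definition mot_scal (d : nat) (D : 'I_d -> 'I_d -> {poly K}) (f : {poly K}) (m : Mot d) : Mot d :=
  fun j => \sum_(i < size f) f`_i *: (iter i (mot_t D) m j).
Definition mot_lin (d r : nat) (D : 'I_d -> 'I_d -> {poly K})
    (fs : 'I_r -> {poly K}) (e : 'I_r -> Mot d) : Mot d :=
  fun j => \sum_(l < r) mot_scal D (fs l) (e l) j.
Definition mot_tau (d : nat) (m : Mot d) : Mot d := fun j => skmul 'X (m j).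
Definition mot_fingen (d : nat) (D : 'I_d -> 'I_d -> {poly K}) : Prop :=
  exists (r : nat) (e : 'I_r -> Mot d), forall m, exists fs, m = mot_lin D fs e.
Definition mot_basis (d r : nat) (D : 'I_d -> 'I_d -> {poly K}) (e : 'I_r -> Mot d) : Prop :=
  forall m, exists! fs, m = mot_lin D fs e.

(* ---------- K((1/t)) : coefficient of t^k, support bounded above ---------- *)
Definition LT := int -> K.
Definition ubounded (f : LT) : Prop := exists N : int, forall k, N < k -> f k = 0.
Definition ubound (f : LT) : int :=
  match excluded_middle_informative (ubounded f) with
  | left H => proj1_sig (constructive_indefinite_description _ H)
  | right _ => 0 end.
Definition lt_mul (f g : LT) : LT := fun k =>
  isum (k - ubound g) (ubound f) (fun a => f a * g (k - a)).
Definition is_pow_series (f : LT) : Prop := forall k, 0 < k -> f k = 0.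
Definition poly_to_lt (p : {poly K}) : LT := fun k => if 0 <= k then p`_(absz k) else 0.
Definition lt_frob (f : LT) : LT := fun k => f k ^+ q.

(* coordinates w.r.t. a K[t]-basis e_0..e_(r-1) of M:
   K((1/t)) (x)_{K[t]} M  ~=  K((1/t))^r *)
Definition LTvec (r : nat) := 'I_r -> LT.
Definition valid_vec (r : nat) (x : LTvec r) : Prop := forall j, ubounded (x j).
Definition lin_comb (r m : nat) (c : 'I_m -> LT) (g : 'I_m -> LTvec r) : LTvec r :=
  fun j k => \sum_(l < m) lt_mul (c l) (g l j) k.
(* semilinear tau, where  tau e_j = sum_k C j k . e_k *)
Definition vec_tau (r : nat) (C : 'I_r -> 'I_r -> {poly K}) (x : LTvec r) : LTvec r :=
  fun k => fun n => \sum_(j < r) lt_mul (lt_frob (x j)) (poly_to_lt (C j k)) n.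
Definition vec_tpow (r : nat) (u : nat) (x : LTvec r) : LTvec r :=
  fun j k => x j (k - u%:Z).
Definition in_span (r m : nat) (g : 'I_m -> LTvec r) (x : LTvec r) : Prop :=
  exists c : 'I_m -> LT, (forall l, is_pow_series (c l)) /\ x = lin_comb c g.
Definition lt_basis (r : nat) (b : 'I_r -> LTvec r) : Prop :=
  (forall j, valid_vec (b j))
  /\ (forall x, valid_vec x -> exists c, (forall l, ubounded (c l)) /\ x = lin_comb c b)
  /\ (forall c, (forall l, ubounded (c l)) -> lin_comb c b = (fun _ _ => 0) ->
        forall l, c l = (fun _ => 0)).
Definition is_lattice (r m : nat) (g : 'I_m -> LTvec r) : Prop :=
  (forall l, valid_vec (g l)) /\ exists b, (forall j, in_span g (b j)) /\ lt_basis b.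

Definition pure (d : nat) (D : 'I_d -> 'I_d -> {poly K}) : Prop :=
  exists (r : nat) (e : 'I_r -> Mot d) (C : 'I_r -> 'I_r -> {poly K}),
    mot_basis D e /\ (forall j, mot_tau (e j) = mot_lin D (C j) e)
    /\ exists (m : nat) (g : 'I_m -> LTvec r) (u v : nat),
         is_lattice g /\ (0 < u)%N /\ (0 < v)%N
         /\ forall x, (exists y, in_span g y /\ x = vec_tpow u y)
                      <-> (exists y, in_span g y /\ x = iter v (vec_tau C) y).

End Defs.

(* Main.v *)
(* Put L = K((sigma)), and let M = K{tau}^d sit inside V = L^d, on which t acts as
   right multiplication by D. Then V is the direct sum of the L[t] / L[t] lam_i, and
   each summand embeds into and is a quotient of W = L[t] / L[t] lam_d.

   If M is pure, the lattice with t^u Lambda = tau^v Lambda forces deg_tau (t^k m) to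
   be deg_tau m + (v/u) k up to a bounded error, first on M and then, by truncation,
   for the valuation of V. A division argument in the complete field L turns this
   growth of t and t^-1 on a generator of W into bounds for all coefficients of
   lam_d, which say that its Newton polygon is a single edge of slope v/u.

   Conversely, if lam_d has one slope h/n, then min_i (n v(g_i) - h i) is a norm on W
   which t shifts by exactly -h; the quotient norm on V is shifted by -n by tau.
   The sublevel sets M_k of M are finite dimensional and satisfy
   M_(k+nh) = t^n M_k + M_k1 = tau^h M_k + M_k1 for large k, so K[[1/t]] M_k is a
   lattice witnessing purity. Counting dimensions of M_k over K[t] and over K{tau}
   gives n rk = h d. *)
Require Import Defs.
From HB Require Import structures.
From mathcomp Require Import all_boot all_order all_algebra.
From mathcomp Require Import perm boolp zify ring.
From Stdlib Require Import ClassicalEpsilon Relations.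
Set Implicit Arguments. Unset Strict Implicit. Unset Printing Implicit Defensive.
Import Order.TTheory GRing.Theory Num.Theory.
Local Open Scope ring_scope.

(** * Finitely supported sums over the integers *)

(** Purity is a statement over K((1/t)), the Newton polygon one over K((sigma)), and the two
    completions meet only in M. Every passage between them is a truncation: V = M + (sigma
    K[[sigma]])^d on one side, K((1/t))^r = K[t]^r + (t^-1 K[[1/t]])^r on the other. Estimates
    therefore transfer only up to additive constants. The constants must be uniform in the exponent
    of t; exact slopes and weights are then recovered because a bounded error is negligible against
    all powers of t. Finite generation over K[t] makes M / tM finite dimensional over K. This forces
    t to be bijective on V, so lam_d has a nonzero constant coefficient and its polygon starts at
    index 0; it also forces the slope of a single edge to be positive. As t is invertible on V, one
    lower bound for Newton polygons suffices: applied to t it puts the polygon above a line, applied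
    to t^-1 it fixes the height of the left end. *)

Section FiniteSupportSums.
Variable V : zmodType.
Implicit Types (F : int -> V) (s : seq int).

Definition fsupp F s := uniq s /\ forall a, a \notin s -> F a = 0.
Definition fsum F : V :=
  match pselect (exists s, fsupp F s) with
  | left H => \sum_(a <- projT1 (cid H)) F a
  | right _ => 0
  end.

Lemma fsupp_eq F s s' : fsupp F s -> fsupp F s' ->
  \sum_(a <- s) F a = \sum_(a <- s') F a.
Proof.
have aux t : \sum_(a <- t) F a = \sum_(a <- [seq a <- t | F a != 0]) F a.
  rewrite big_filter [LHS](bigID (fun a => F a != 0)) /= [X in _ + X]big1 ?addr0 //.
  by move=> i /negbNE/eqP.
move=> [us hs] [us' hs']; rewrite aux [RHS]aux; apply: perm_big.
apply: uniq_perm; rewrite ?filter_uniq // => a; rewrite !mem_filter.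
case: (eqVneq (F a) 0) => //= nz.
have -> : a \in s by apply/negPn/negP => /hs /eqP; rewrite (negPf nz).
by have -> : a \in s' by apply/negPn/negP => /hs' /eqP; rewrite (negPf nz).
Qed.

Lemma fsumE F s : fsupp F s -> fsum F = \sum_(a <- s) F a.
Proof.
rewrite /fsum => hs; case: pselect => [H|]; last by case; exists s.
by apply: fsupp_eq => //; exact: (projT2 (cid H)).
Qed.

Definition zwin (lo : int) (n : nat) : seq int := [seq lo + i%:Z | i <- iota 0 n].

Lemma zwin_uniq lo n : uniq (zwin lo n).
Proof. by rewrite map_inj_uniq ?iota_uniq // => i j /addrI []. Qed.

Lemma mem_zwin lo n a : (a \in zwin lo n) = (lo <= a) && (a < lo + n%:Z).
Proof.
apply/mapP/andP => [[i]|[h1 h2]].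
  by rewrite mem_iota => hi ->; split; lia.
by exists `|a - lo|%N; [rewrite mem_iota; lia | lia].
Qed.

Lemma fsum_win F lo n : (forall a, F a != 0 -> lo <= a < lo + n%:Z) ->
  fsum F = \sum_(i < n) F (lo + i%:Z).
Proof.
move=> h; rewrite (@fsumE F (zwin lo n)); first last.
  split=> [|a]; first exact: zwin_uniq.
  by rewrite mem_zwin => /negP ha; apply/eqP/negPn/negP => /h.
by rewrite /zwin big_map -[in LHS](subn0 n) -/(index_iota 0 n) big_mkord.
Qed.

End FiniteSupportSums.

(** The bounds inside [ls_mul] and [lt_mul] are chosen arbitrarily; summing over the whole finite
    support removes the dependence on them. When [lo > hi] the hypothesis forces [F] to vanish, in
    agreement with the default value 0 of [isum]. *)
Lemma isumE (K : fieldType) (F : int -> K) lo hi :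
  (forall a, F a != 0 -> lo <= a <= hi) -> isum lo hi F = fsum F.
Proof.
rewrite /isum; case: ifP => hle h.
  rewrite (@fsum_win _ F lo (absz (hi - lo)).+1) //.
  by move=> a /h; lia.
rewrite (@fsum_win _ F lo 0) ?big_ord0 // => a /h; lia.
Qed.

(** * Skew Laurent series *)

(** An action of Z on K by ring endomorphisms. Powers of Frobenius give K((sigma)) and the trivial
    action gives K((1/t)), so one construction serves both. *)
Record twist (K : fieldType) := Twist {
  tw :> int -> K -> K;
  twD : forall a x y, tw a (x + y) = tw a x + tw a y;
  twM : forall a x y, tw a (x * y) = tw a x * tw a y;
  tw1 : forall a, tw a 1 = 1;
  tw0id : forall x, tw 0 x = x;
  twA : forall a b x, tw (a + b) x = tw a (tw b x) }.

Section Laurent.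
Variables (K : fieldType) (phi : twist K).

Lemma tw_0 a : phi a 0 = 0.
Proof. by apply: (addrI (phi a 0)); rewrite -twD !addr0. Qed.
Lemma tw_sum I r (P : pred I) a (F : I -> K) :
  phi a (\sum_(i <- r | P i) F i) = \sum_(i <- r | P i) phi a (F i).
Proof. by apply: (big_morph (phi a) (twD phi a) (tw_0 a)). Qed.
Lemma tw_eq0 a x : (phi a x == 0) = (x == 0).
Proof.
apply/eqP/eqP => [h|->]; last exact: tw_0.
by rewrite -[x](tw0id phi) -(addNr a) twA h tw_0.
Qed.

(* The element [f] of [lser phi] is the series [\sum_k (f k) x^k] with
   multiplication rule [x^a c = phi a c x^a]. *)
Record lser (p : twist K) := Lser { coefz :> int -> K; lserP : `[< lbounded coefz >] }.
Local Notation L := (lser phi).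
HB.instance Definition _ := [isSub for @coefz phi].
HB.instance Definition _ := [Choice of L by <:].

Lemma lserext (f g : L) : (forall k, f k = g k) -> f = g.
Proof. by move=> h; apply: val_inj; apply/funext. Qed.

(** The inequality v(f) >= k as a predicate: the zero series then needs no valuation, and bounds
    need not be sharp. *)
Definition vge (f : int -> K) (k : int) := forall a, a < k -> f a = 0.

Lemma vge_ex (f : L) : exists k, vge f k.
Proof. by have /asboolP [N hN] := lserP f; exists N. Qed.

Definition mkser f k (h : vge f k) : L :=
  Lser phi (asboolT (ex_intro _ k h : lbounded f)).

Lemma vgeW f k l : l <= k -> vge f k -> vge f l.
Proof. by move=> hl h a ha; apply: h; lia. Qed.

Lemma vge0_subproof : vge (fun _ => 0) 0. Proof. by []. Qed.
Definition lser0 := mkser vge0_subproof.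

Lemma lopp_subproof (f : L) : lbounded (fun k => - f k).
Proof. by have [k hk] := vge_ex f; exists k => a /hk ->; rewrite oppr0. Qed.
Definition lopp f := Lser phi (asboolT (lopp_subproof f)).

Lemma ladd_subproof (f g : L) : lbounded (fun k => f k + g k).
Proof.
have [k hk] := vge_ex f; have [l hl] := vge_ex g.
exists (Num.min k l) => a ha; rewrite hk ?hl ?addr0 //; lia.
Qed.
Definition ladd f g := Lser phi (asboolT (ladd_subproof f g)).

Lemma laddA : associative ladd.
Proof. by move=> f g h; apply: lserext => k /=; rewrite addrA. Qed.
Lemma laddC : commutative ladd.
Proof. by move=> f g; apply: lserext => k /=; rewrite addrC. Qed.
Lemma ladd0 : left_id lser0 ladd.
Proof. by move=> f; apply: lserext => k /=; rewrite add0r. Qed.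
Lemma laddN : left_inverse lser0 lopp ladd.
Proof. by move=> f; apply: lserext => k /=; rewrite addNr. Qed.
HB.instance Definition _ := GRing.isZmodule.Build L laddA laddC ladd0 laddN.

Lemma coefzD (f g : L) k : (f + g) k = f k + g k. Proof. by []. Qed.
Lemma coefzN (f : L) k : (- f) k = - f k. Proof. by []. Qed.
Lemma coefzB (f g : L) k : (f - g) k = f k - g k. Proof. by []. Qed.
Lemma coefz0 k : (0 : L) k = 0. Proof. by []. Qed.
Lemma coefz_sum I r (P : pred I) (F : I -> L) k :
  (\sum_(i <- r | P i) F i) k = \sum_(i <- r | P i) F i k.
Proof. exact: (big_morph (fun f : L => f k) (fun _ _ => erefl) erefl). Qed.

Definition convz (f g : int -> K) (k : int) := fsum (fun a => f a * phi a (g (k - a))).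

Lemma convzE f g A B k n : vge f A -> vge g B -> k < A + B + n%:Z ->
  convz f g k = \sum_(i < n) f (A + i%:Z) * phi (A + i%:Z) (g (k - (A + i%:Z))).
Proof.
move=> hf hg hn; apply: fsum_win => a.
rewrite mulf_eq0 negb_or tw_eq0 => /andP [nf ng].
have h1 : A <= a by case: (leP A a) => // h; rewrite hf ?eqxx in nf.
have h2 : B <= k - a by case: (leP B (k - a)) => // h; rewrite hg ?eqxx in ng.
lia.
Qed.

Lemma vge_convz f g A B : vge f A -> vge g B -> vge (convz f g) (A + B).
Proof.
by move=> hf hg k hk; rewrite (@convzE f g A B k 0) ?big_ord0 //; lia.
Qed.

Lemma lmul_subproof (f g : L) : lbounded (convz f g).
Proof.
have [A hA] := vge_ex f; have [B hB] := vge_ex g.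
by exists (A + B); apply: vge_convz.
Qed.
Definition lmul f g := Lser phi (asboolT (lmul_subproof f g)).

(** Counting indices from the lower bounds [A] and [B] turns coefficients into Cauchy products over
    natural numbers, to which the ring axioms reduce. *)
Lemma lmulE (f g : L) A B (k : nat) : vge f A -> vge g B ->
  lmul f g (A + B + k%:Z) =
  \sum_(i < k.+1) f (A + i%:Z) * phi (A + i%:Z) (g (B + (k - i)%:Z)).
Proof.
move=> hA hB; rewrite /= (@convzE f g A B _ k.+1) //; last lia.
apply: eq_bigr => i _; congr (_ * phi _ (g _)).
by have := ltn_ord i; lia.
Qed.

Lemma vge_lmul (f g : L) A B : vge f A -> vge g B -> vge (lmul f g) (A + B).
Proof. exact: vge_convz. Qed.

Lemma lser_win (f g : L) A : vge f A -> vge g A ->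
  (forall k : nat, f (A + k%:Z) = g (A + k%:Z)) -> f = g.
Proof.
move=> hf hg h; apply: lserext => k; case: (ltP k A) => hk; first by rewrite hf ?hg.
by have := h `|k - A|%N; have -> : A + `|k - A|%N%:Z = k by lia.
Qed.

(** Both sides run over the triples (i, j, m) with i + j + m = k; this is the reindexing behind
    associativity. *)
Lemma triangular_sum (V : zmodType) (F : nat -> nat -> nat -> V) k :
  \sum_(l < k.+1) \sum_(i < l.+1) F i (l - i)%N (k - l)%N =
  \sum_(i < k.+1) \sum_(j < (k - i).+1) F i j (k - i - j)%N.
Proof.
transitivity (\sum_(0 <= l < k.+1) \sum_(0 <= i < k.+1 | (i <= l)%N)
   F i (l - i)%N (k - l)%N).
  rewrite big_mkord; apply: eq_bigr => l _.
  rewrite -(big_mkord xpredT (fun i => F i (l - i)%N (k - l)%N)).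
  rewrite (big_nat_widen _ _ k.+1) /=; last by have := ltn_ord l; lia.
  by apply: eq_bigl => i; rewrite ltnS.
rewrite (exchange_big_dep xpredT) //= big_mkord; apply: eq_bigr => i _.
rewrite -(big_mkord xpredT (fun j => F i j (k - i - j)%N)).
rewrite (big_cat_nat (n := i)) //=; last by have := ltn_ord i; lia.
rewrite big1_seq ?add0r; last by move=> l; rewrite mem_index_iota; lia.
rewrite -[X in \sum_(X <= _ < _ | _) _]add0n big_addn.
rewrite (_ : (k.+1 - i = (k - i).+1)%N); last by have := ltn_ord i; lia.
apply: congr_big_nat => // j hj; first by rewrite leq_addl.
by rewrite addnK; congr (F _ _ _); lia.
Qed.

Lemma lmulA : associative lmul.
Proof.
move=> f g h; have [A hA] := vge_ex f; have [B hB] := vge_ex g.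
have [C hC] := vge_ex h.
have hgh := vge_lmul hB hC; have hfg := vge_lmul hA hB.
apply: (@lser_win _ _ (A + B + C)).
- by rewrite -addrA; apply: vge_lmul.
- exact: vge_lmul.
move=> k; rewrite (lmulE k hfg hC) -[A + B + C]addrA (lmulE k hA hgh).
under eq_bigr => i _ do rewrite (lmulE _ hB hC) tw_sum mulr_sumr.
under [in RHS]eq_bigr => l _ do rewrite (lmulE _ hA hB) mulr_suml.
pose F i j m := f (A + i%:Z) * phi (A + i%:Z) (g (B + j%:Z)) *
  phi (A + B + (i + j)%:Z) (h (C + m%:Z)).
symmetry; transitivity (\sum_(l < k.+1) \sum_(i < l.+1) F i (l - i)%N (k - l)%N).
  apply: eq_bigr => l _; apply: eq_bigr => i _; rewrite /F.
  by rewrite subnKC //; have := ltn_ord i; lia.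
rewrite triangular_sum; apply: eq_bigr => i _; apply: eq_bigr => j _.
rewrite /F twM mulrA -twA; congr (_ * phi _ _); lia.
Qed.

Lemma vgeD (f g : L) A : vge f A -> vge g A -> vge (f + g) A.
Proof. by move=> hf hg a ha; rewrite coefzD hf ?hg ?addr0. Qed.
Lemma vgeN (f : L) A : vge f A -> vge (- f) A.
Proof. by move=> hf a ha; rewrite coefzN hf ?oppr0. Qed.
Lemma vgeB (f g : L) A : vge f A -> vge g A -> vge (f - g) A.
Proof. by move=> hf hg; apply/vgeD/vgeN. Qed.
Lemma vge_sum I r (P : pred I) (F : I -> L) A :
  (forall i, P i -> vge (F i) A) -> vge (\sum_(i <- r | P i) F i) A.
Proof. by move=> h a ha; rewrite coefz_sum big1 // => i Pi; apply: h. Qed.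
Lemma vge_ex2 (f g : L) : exists A, vge f A /\ vge g A.
Proof.
have [A hA] := vge_ex f; have [B hB] := vge_ex g.
by exists (Num.min A B); split; [apply: vgeW hA|apply: vgeW hB]; lia.
Qed.

Lemma lmulDl : left_distributive lmul +%R.
Proof.
move=> f g h; have [A [hf hg]] := vge_ex2 f g; have [C hC] := vge_ex h.
have hfg := vgeD hf hg.
apply: (@lser_win _ _ (A + C)); [exact: vge_lmul|by apply: vgeD; apply: vge_lmul|].
move=> k; rewrite coefzD !(@lmulE _ _ A C) // -big_split; apply: eq_bigr => i _ /=.
by rewrite mulrDl.
Qed.
Lemma lmulDr : right_distributive lmul +%R.
Proof.
move=> h f g; have [A [hf hg]] := vge_ex2 f g; have [C hC] := vge_ex h.
have hfg := vgeD hf hg.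
apply: (@lser_win _ _ (C + A)); [exact: vge_lmul|by apply: vgeD; apply: vge_lmul|].
move=> k; rewrite coefzD !(@lmulE _ _ C A) // -big_split; apply: eq_bigr => i _ /=.
by rewrite twD mulrDr.
Qed.

Lemma mono_subproof (c : K) (a : int) : vge (fun k => if k == a then c else 0) a.
Proof. by move=> k hk; rewrite lt_eqF. Qed.
Definition mono c a : L := mkser (@mono_subproof c a).
Lemma coef_mono c a k : mono c a k = if k == a then c else 0. Proof. by []. Qed.
Lemma vge_mono c a : vge (mono c a) a. Proof. exact: mono_subproof. Qed.

Lemma lmono_mul c a (f : L) k : lmul (mono c a) f k = c * phi a (f (k - a)).
Proof.
rewrite /= /convz (@fsumE _ _ [:: a]).
  by rewrite big_seq1 eqxx.
by split=> // b; rewrite inE => /negPf ->; rewrite mul0r.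
Qed.
Lemma lmul_mono c a (f : L) k : lmul f (mono c a) k = f (k - a) * phi (k - a) c.
Proof.
rewrite /= /convz (@fsumE _ _ [:: k - a]).
  by rewrite big_seq1 (_ : k - (k - a) == a) //; lia.
split=> // b; rewrite inE => hb; case: eqP => [hk|]; last by rewrite tw_0 mulr0.
by case/eqP: hb; lia.
Qed.

Definition lone := mono 1 0.
Lemma lmul1 : left_id lone lmul.
Proof. by move=> f; apply: lserext => k; rewrite lmono_mul mul1r tw0id subr0. Qed.
Lemma lmulr1 : right_id lone lmul.
Proof. by move=> f; apply: lserext => k; rewrite lmul_mono tw1 mulr1 subr0. Qed.
Lemma lone_neq0 : lone != 0.
Proof.
apply/eqP => /(congr1 (fun f : L => f 0)) /eqP.
by rewrite coefz0 coef_mono eqxx oner_eq0.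
Qed.
HB.instance Definition _ := GRing.Zmodule_isNzRing.Build L
  lmulA lmul1 lmulr1 lmulDl lmulDr lone_neq0.

Lemma coefzM (f g : L) k : (f * g) k = convz f g k. Proof. by []. Qed.
Lemma coefz1 k : (1 : L) k = (k == 0)%:R.
Proof. by rewrite [LHS]coef_mono; case: eqP. Qed.
Lemma mono_mul c a (f : L) k : (mono c a * f) k = c * phi a (f (k - a)).
Proof. exact: lmono_mul. Qed.
Lemma mul_mono c a (f : L) k : (f * mono c a) k = f (k - a) * phi (k - a) c.
Proof. exact: lmul_mono. Qed.
Lemma monoM c a c' a' : mono c a * mono c' a' = mono (c * phi a c') (a + a').
Proof.
apply: lserext => k; rewrite mono_mul !coef_mono.
have -> : (k - a == a') = (k == a + a') by lia.
by case: eqP => // _; rewrite tw_0 mulr0.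
Qed.
Lemma mono11 : mono 1 0 = 1. Proof. by []. Qed.
Lemma mono1M a b : mono 1 a * mono 1 b = mono 1 (a + b).
Proof. by rewrite monoM tw1 mulr1. Qed.

Lemma vgeM (f g : L) A B : vge f A -> vge g B -> vge (f * g) (A + B).
Proof. exact: vge_lmul. Qed.
Lemma vge1 : vge (1 : L) 0. Proof. exact: vge_mono. Qed.
Lemma vgeX (f : L) A n : vge f A -> vge (f ^+ n) (A *+ n).
Proof.
move=> h; elim: n => [|n IH]; first by rewrite expr0 mulr0n; apply: vge1.
by rewrite exprS mulrS; apply: vgeM.
Qed.

Lemma vge_eq0 (f : L) : (forall k, vge f k) -> f = 0.
Proof. by move=> h; apply: lserext => k; rewrite (h (k + 1)) //; lia. Qed.

Lemma lead_ex (f : L) : f <> 0 -> exists w, f w != 0 /\ vge f w.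
Proof.
move=> nz; have [A hA] := vge_ex f.
have [k hk] : exists k, f k != 0.
  apply: contrapT => h; apply: nz; apply: lserext => k; apply/eqP/negPn/negP.
  by move=> hk; apply: h; exists k.
have hAk : A <= k by case: (leP A k) => // /hA /eqP; rewrite (negPf hk).
have ex : exists n : nat, f (A + n%:Z) != 0.
  by exists `|k - A|%N; have -> : A + `|k - A|%N%:Z = k by lia.
case: (ex_minnP ex) => n hn hmin; exists (A + n%:Z); split=> // a ha.
case: (ltP a A) => [/hA//|ha']; apply/eqP/negPn/negP => nza.
have : (n <= `|a - A|)%N.
  by apply: hmin; have -> : A + `|a - A|%N%:Z = a by lia.
lia.
Qed.

(** Completeness of the series field: from [K0 (a + 1)] on, all terms vanish at index [a], so the
    coefficient of the limit is read off from that partial sum. *)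
Lemma lser_series (y : nat -> L) (B : int) :
  (forall N : int, exists k0 : nat, forall k, (k0 <= k)%N -> vge (y k) N) ->
  (forall i, vge (y i) B) ->
  exists Y : L, vge Y B /\
    forall N : int, exists k0 : nat, forall k, (k0 <= k)%N ->
      vge (Y - \sum_(i < k) y i) N.
Proof.
move=> hy hB; pose K0 N := projT1 (cid (hy N)).
have hK N k : (K0 N <= k)%N -> vge (y k) N by apply: (projT2 (cid (hy N))).
have stab N a k : a < N -> (K0 N <= k)%N ->
    \sum_(i < k) y i a = \sum_(i < K0 N) y i a.
  move=> ha hk; rewrite -!(big_mkord xpredT (fun i => y i a)).
  rewrite (big_cat_nat (n := K0 N)) //= [X in _ + X]big1_seq ?addr0 //.
  by move=> i /=; rewrite mem_index_iota => /andP [hi _]; apply: (hK N i hi).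
have bY : vge (fun a => \sum_(i < K0 (a + 1)) y i a) B.
  by move=> a ha; rewrite big1 // => i _; apply: hB.
exists (mkser bY); split=> // N; exists (K0 N) => k hk a ha.
rewrite coefzB coefz_sum /=.
(* [K0] need not be monotone, so the two partial sums are compared through a common longer one. *)
pose m := maxn k (K0 (a + 1)).
have e1 : \sum_(i < K0 (a + 1)) y i a = \sum_(i < m) y i a.
  by rewrite -(@stab (a + 1) a m) ?leq_maxr //; lia.
have e2 : \sum_(i < k) y i a = \sum_(i < m) y i a.
  rewrite (@stab N a k) // (@stab N a m) //; by rewrite (leq_trans hk) ?leq_maxl.
by rewrite e1 e2 subrr.
Qed.

Lemma lser_geom (x : L) : vge x 1 ->
  exists y : L, vge y 0 /\ y * (1 - x) = 1.
Proof.
move=> hx.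
have hX k : vge (x ^+ k) k%:Z by have := vgeX (n := k) hx; rewrite natz.
have [N|i|Y [Y0 hY]] := @lser_series (fun i => x ^+ i) 0.
- exists `|N|%N => k hk; apply: vgeW (hX k); lia.
- by apply: vgeW (hX i); lia.
exists Y; split=> //; apply/eqP; rewrite -subr_eq0; apply/eqP; apply: vge_eq0 => N.
have [k0 hk0] := hY N; pose k := maxn k0 `|N|%N.
have tel m : (\sum_(i < m) x ^+ i) * (1 - x) = 1 - x ^+ m.
  elim: m => [|m IH]; first by rewrite big_ord0 mul0r expr0 subrr.
  by rewrite big_ord_recr /= mulrDl IH mulrBr mulr1 -exprSr addrA subrK.
have -> : Y * (1 - x) - 1 = (Y - \sum_(i < k) x ^+ i) * (1 - x) - x ^+ k.
  by rewrite mulrBl tel opprB addrA addrAC addrK.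
apply: vgeB; last by apply: vgeW (hX k); rewrite /k; lia.
rewrite -[N]addr0; apply: vgeM; first by apply: hk0; rewrite leq_maxl.
by apply: vgeB; [exact: vge1|apply: vgeW hx].
Qed.

(** Dividing by the leading monomial leaves 1 - x with v(x) >= 1, inverted by the geometric series.
    This yields a left inverse; a left inverse of that one shows that it is two-sided. *)
Lemma lser_inv (f : L) w : f w != 0 -> vge f w ->
  exists g : L, [/\ vge g (- w), g * f = 1 & f * g = 1].
Proof.
have left_inv (h : L) v : h v != 0 -> vge h v -> exists g : L, vge g (- v) /\ g * h = 1.
  move=> nz hv.
  (* The coefficient is twisted since moving x^(-v) past h_v applies [phi (- v)]; the constant
     coefficient of [u * h] is then 1. *)
  pose u := mono (phi (- v) (h v)^-1) (- v).
  have hu : vge (1 - u * h) 1.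
    have h0 : vge (u * h) 0 by rewrite -(addNr v); apply: vgeM hv; apply: vge_mono.
    move=> a ha; rewrite coefzB coefz1; case: eqP => [->|na].
      rewrite mono_mul -twM opprK add0r mulVf // tw1; exact: subrr.
    by rewrite h0 ?subr0 //; lia.
  have [y [hy y1]] := lser_geom hu.
  exists (y * u); split; first by rewrite -[- v]add0r; apply: vgeM; last apply: vge_mono.
  by rewrite -mulrA -[RHS]y1 subKr.
move=> nz hw; have [g [hg g1]] := left_inv f w nz hw.
have gn0 : g <> 0 by move=> g0; move/eqP: g1; rewrite g0 mul0r eq_sym oner_eq0.
have [v [nv hv]] := lead_ex gn0.
have [h [_ h1]] := left_inv g v nv hv.
have hf : h = f by rewrite -[h]mulr1 -g1 mulrA h1 mul1r.
by exists g; split=> //; rewrite -hf.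
Qed.

End Laurent.
Arguments coefz : simpl never.
Arguments ladd : simpl never.
Arguments lopp : simpl never.
Arguments lmul : simpl never.
Arguments mono : simpl never.

(** * Scaled valuations and Newton polygons *)

Section ScaledValuation.
Variables (K : fieldType) (phi : twist K) (u : nat).
Hypothesis u0 : (0 < u)%N.
Local Notation L := (lser phi).

(* [qge f A] says that [u * v(f) >= A]; the scaling avoids rational slopes. *)
Definition qge (f : int -> K) (A : int) := forall a, u%:Z * a < A -> f a = 0.

(** [c] is the ceiling of A / u, so every scaled bound is an ordinary bound [vge] at an integer. *)
Lemma ceil_ex (A : int) : exists c : int, forall a, (u%:Z * a < A) = (a < c).
Proof.
exists (- (((- A) %/ u%:Z)%Z)) => a.
have e := divz_eq (- A) u%:Z.
have h1 : ((- A) %% u%:Z)%Z < u%:Z by apply: ltz_pmod; lia.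
have h2 : 0 <= ((- A) %% u%:Z)%Z by apply: modz_ge0; lia.
set c := ((- A) %/ u%:Z)%Z in e *; set r := ((- A) %% u%:Z)%Z in e h1 h2 *.
apply/idP/idP => h; nia.
Qed.

Lemma qgeE A : exists c : int, forall f, qge f A <-> vge f c.
Proof.
have [c hc] := ceil_ex A; exists c => f.
by split=> h a; [rewrite -hc|rewrite hc]; apply: h.
Qed.
Lemma vge_qge f k : vge f k <-> qge f (u%:Z * k).
Proof. by split=> h a ha; apply: h; nia. Qed.

Lemma qgeW f A B : B <= A -> qge f A -> qge f B.
Proof. by move=> hBA h a ha; apply: h; apply: lt_le_trans ha hBA. Qed.
Lemma qgeD (f g : L) A : qge f A -> qge g A -> qge (f + g) A.
Proof. by move=> hf hg a ha; rewrite coefzD hf ?hg ?addr0. Qed.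
Lemma qgeN (f : L) A : qge f A -> qge (- f) A.
Proof. by move=> hf a ha; rewrite coefzN hf ?oppr0. Qed.
Lemma qgeB (f g : L) A : qge f A -> qge g A -> qge (f - g) A.
Proof. by move=> hf hg; apply/qgeD/qgeN. Qed.
Lemma qge_sum I r (P : pred I) (F : I -> L) A :
  (forall i, P i -> qge (F i) A) -> qge (\sum_(i <- r | P i) F i) A.
Proof. by move=> h a ha; rewrite coefz_sum big1 // => i Pi; apply: h. Qed.
Lemma qge0 A : qge (0 : L) A. Proof. by []. Qed.
Lemma qge1 : qge (1 : L) 0. Proof. by have := @vge1 K phi; rewrite vge_qge mulr0. Qed.
Lemma qgeM (f g : L) A B : qge f A -> qge g B -> qge (f * g) (A + B).
Proof.
have [c hc] := ceil_ex A; have [e he] := ceil_ex B.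
move=> hf hg a ha; have := @vgeM _ _ f g c e; apply.
- by move=> b; rewrite -hc; apply: hf.
- by move=> b; rewrite -he; apply: hg.
have := hc c; have := he e; rewrite !ltxx; nia.
Qed.
Lemma qge_ex (f : L) : exists A, qge f A.
Proof. by have [k] := vge_ex f; rewrite vge_qge; exists (u%:Z * k). Qed.
Lemma qge_eq0 (f : L) : (forall A, qge f A) -> f = 0.
Proof. by move=> h; apply: vge_eq0 => k; rewrite vge_qge. Qed.

Variable d : nat.
Implicit Types x y : 'rV[L]_d.
Definition vqge x A := forall j, qge (x 0 j) A.
Lemma vqgeW x A B : B <= A -> vqge x A -> vqge x B.
Proof. by move=> hBA h j; apply: qgeW (h j). Qed.
Lemma vqgeD x y A : vqge x A -> vqge y A -> vqge (x + y) A.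
Proof. by move=> hx hy j; rewrite mxE; apply: qgeD. Qed.
Lemma vqgeN x A : vqge x A -> vqge (- x) A.
Proof. by move=> hx j; rewrite mxE; apply: qgeN. Qed.
Lemma vqgeB x y A : vqge x A -> vqge y A -> vqge (x - y) A.
Proof. by move=> hx hy; apply/vqgeD/vqgeN. Qed.
Lemma vqge_sum I r (P : pred I) (F : I -> 'rV[L]_d) A :
  (forall i, P i -> vqge (F i) A) -> vqge (\sum_(i <- r | P i) F i) A.
Proof. by move=> h j; rewrite summxE; apply: qge_sum => i Pi; apply: h. Qed.
Lemma vqge0 A : vqge 0 A. Proof. by move=> j; rewrite mxE. Qed.
Lemma vqgeZ (c : L) x A B : qge c A -> vqge x B -> vqge (c *: x) (A + B).
Proof. by move=> hc hx j; rewrite mxE; apply: qgeM. Qed.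
Lemma vqge_eq0 x : (forall A, vqge x A) -> x = 0.
Proof. by move=> h; apply/rowP => j; rewrite mxE; apply: qge_eq0 => A; apply: h. Qed.
Lemma vqge_ex_fin (I : finType) (F : I -> 'rV[L]_d) : exists A, forall i, vqge (F i) A.
Proof.
pose B (p : I * 'I_d) := projT1 (cid (qge_ex (F p.1 0 p.2))).
have hB p : qge (F p.1 0 p.2) (B p) by apply: (projT2 (cid (qge_ex _))).
(* Minus the sum of the absolute values replaces the minimum of finitely many integers; the same
   device recurs below. *)
exists (- \sum_p `|B p|) => i j; apply: qgeW (hB (i, j)).
rewrite (bigD1 (i, j)) //=.
have : 0 <= \sum_(p | p != (i, j)) `|B p| by apply: sumr_ge0.
by move: (\sum_(p | _) _) => S; lia.
Qed.
Lemma vqge_ex x : exists A, vqge x A.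
Proof. by have [A hA] := vqge_ex_fin (fun _ : 'I_1 => x); exists A; apply: (hA ord0). Qed.


End ScaledValuation.

(** * Polynomials acting on row vectors through a matrix *)

Section Action.
Variables (R : nzRingType) (d : nat) (T : 'M[R]_d).
Implicit Types (f g : {poly R}) (x : 'rV[R]_d).

(** Scalars act on the left and t by right multiplication by [T]. The two commute although [R] is
    not commutative, so this is a module over R[t] with t central. *)
Definition act (f : {poly R}) (x : 'rV[R]_d) : 'rV[R]_d :=
  \sum_(i < size f) f`_i *: (x *m T ^+ i).

Lemma actE n f x : (size f <= n)%N -> act f x = \sum_(i < n) f`_i *: (x *m T ^+ i).
Proof.
move=> h; rewrite /act.
rewrite -!(big_mkord xpredT (fun i => f`_i *: (x *m T ^+ i))).
rewrite [RHS](big_cat_nat (n := size f)) //= [X in _ + X]big1_seq ?addr0 //.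
move=> i /=; rewrite mem_index_iota => /andP [hi _].
by rewrite nth_default ?scale0r.
Qed.

Lemma actD f g x : act (f + g) x = act f x + act g x.
Proof.
pose n := maxn (size f) (size g).
rewrite !(@actE n) ?leq_maxl ?leq_maxr ?size_polyD // -big_split.
by apply: eq_bigr => i _ /=; rewrite coefD scalerDl.
Qed.
Lemma act0 x : act 0 x = 0. Proof. by rewrite /act size_poly0 big_ord0. Qed.
Lemma actN f x : act (- f) x = - act f x.
Proof. by apply: (addrI (act f x)); rewrite -actD !subrr act0. Qed.
Lemma actB f g x : act (f - g) x = act f x - act g x.
Proof. by rewrite actD actN. Qed.
Lemma act_sum I r (P : pred I) (F : I -> {poly R}) x :
  act (\sum_(i <- r | P i) F i) x = \sum_(i <- r | P i) act (F i) x.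
Proof. by apply: (big_morph (fun f => act f x) (fun f g => actD f g x) (act0 x)). Qed.
Lemma actZ c f x : act (c *: f) x = c *: act f x.
Proof.
rewrite (@actE (size f)); last exact: size_scale_leq.
by rewrite /act scaler_sumr; apply: eq_bigr => i _; rewrite coefZ scalerA.
Qed.
Lemma actXnM e f x : act ('X^e * f) x = act f x *m T ^+ e.
Proof.
have h : (size ('X^e * f)%R <= e + size f)%N.
  by apply: leq_trans (size_polyMleq _ _) _; rewrite size_polyXn addSn.
rewrite (actE _ h) big_split_ord /= big1 ?add0r => [|i _]; last first.
  by rewrite coefXnM ltn_ord scale0r.
rewrite /act mulmx_suml; apply: eq_bigr => i _.
rewrite coefXnM ltnNge leq_addr /= addKn -scalemxAl; congr (_ *: _).
by rewrite -mulmxA; congr (_ *m _); rewrite mulmxE -exprD addnC.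
Qed.
Lemma actXn e x : act 'X^e x = x *m T ^+ e.
Proof.
rewrite -[X in act X]mulr1 actXnM; congr (_ *m _).
by rewrite /act size_poly1 big_ord1 coef1 expr0 scale1r mulmx1.
Qed.
Lemma actDr f x y : act f (x + y) = act f x + act f y.
Proof.
by rewrite /act -big_split; apply: eq_bigr => i _; rewrite /= mulmxDl scalerDr.
Qed.
Lemma actM f g x : act (f * g) x = act f (act g x).
Proof.
rewrite -{1}[f]coefK poly_def mulr_suml act_sum; apply: eq_bigr => i _.
by rewrite -scalerAl actZ actXnM.
Qed.
Lemma act1 x : act 1 x = x.
Proof. by have := actXn 0 x; rewrite !expr0 mulmx1. Qed.

End Action.

(** * Convergent division and a lower bound for Newton polygons *)

Section Newton.
Variables (K : fieldType) (phi : twist K) (u : nat) (v : int).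
Hypothesis u0 : (0 < u)%N.
Local Notation L := (lser phi).
Local Notation qge := (qge u).
Local Notation vqge := (@vqge _ _ u _).

(* The Newton polygon of [f] lies above a line of slope [v / u]. *)
Definition wge (f : {poly L}) (k : int) := forall i, qge f`_i (k + v * i%:Z).

Lemma wgeB f g k : wge f k -> wge g k -> wge (f - g) k.
Proof. by move=> hf hg i; rewrite coefB; apply: qgeB. Qed.

Variables (d : nat) (T : 'M[L]_d) (C : int).
Hypothesis hT : forall x j A, vqge x A -> vqge (x *m T ^+ j) (A - v * j%:Z - C).

(** The constant [C] is uniform in the exponent of [T], so substituting [T] is continuous: it loses
    at most [C], whatever the degree of [f]. *)
Lemma vqge_act f k x A : wge f k -> vqge x A -> vqge (act T f x) (k + A - C).
Proof.
move=> hf hx; apply: vqge_sum => i _.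
have -> : k + A - C = (k + v * i%:Z) + (A - v * i%:Z - C) by lia.
by apply: vqgeZ => //; apply: hT.
Qed.

Section Reduction.
Variables (x0 : 'rV[L]_d) (lam : {poly L}) (m : nat).
Hypothesis lam0 : act T lam x0 = 0.
Hypothesis lamm : lam`_m = 1.
Hypothesis lamw : wge lam (- (v * m%:Z)).
Hypothesis lams : forall i, (m < i)%N -> qge lam`_i (- (v * m%:Z) + 1 + v * i%:Z).

(** Call u v(a_i) - v i the weight of a coefficient a_i. Coefficients of weight [k] in degrees at
    least [m] are cancelled from the top down by multiples of t^(J-m) lam. Since [lam] has
    coefficient 1 at [m] and larger weights above [m], no coefficient of weight [k] reappears above
    [J]. *)
Lemma reduction_step k f : wge f k ->
  exists rf : {poly L} * {poly L}, [/\ (size rf.1 <= m)%N, wge rf.1 k, wge rf.2 (k + 1)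
    & act T f x0 = act T rf.1 x0 + act T rf.2 x0].
Proof.
suff main J : forall f, wge f k ->
    (forall i, (J <= i)%N -> qge f`_i (k + 1 + v * i%:Z)) ->
    exists rf : {poly L} * {poly L}, [/\ (size rf.1 <= m)%N, wge rf.1 k, wge rf.2 (k + 1)
    & act T f x0 = act T rf.1 x0 + act T rf.2 x0].
  by move=> hf; apply: (main (size f)) => // i hi; rewrite nth_default.
elim: J => [|J IH] {}f hf hJ.
  exists (0, f); split=> //=; rewrite ?size_poly0 ?act0 ?add0r //.
    by move=> i; rewrite coef0.
  by move=> i; apply: hJ.
case: (leqP m J) => hmJ; last first.
  exists (take_poly m f, f - take_poly m f); split=> /=.
  - exact: size_take_poly.
  - by move=> i; rewrite coef_take_poly; case: ifP.
  - move=> i; rewrite coefB coef_take_poly; case: ifP => hi; first by rewrite subrr.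
    by rewrite subr0; apply: hJ; lia.
  - by rewrite -actD addrC subrK.
pose g := f`_J *: ('X^(J - m) * lam).
have hg i : (J - m <= i)%N -> forall b, qge lam`_(i - (J - m)) b ->
    qge g`_i (k + v * J%:Z + b).
  move=> hi b hb; rewrite /g coefZ coefXnM ltnNge hi /=.
  exact: qgeM.
have gw : wge g k.
  move=> i; case: (leqP (J - m) i) => hi.
    have := hg i hi _ (@lamw (i - (J - m))%N); apply: qgeW.
    have -> : ((i - (J - m))%N%:Z) = i%:Z - J%:Z + m%:Z by lia.
    by rewrite !mulrDr mulrN; lia.
  by rewrite /g coefZ coefXnM hi mulr0.
have [|i hi|rf [h1 h2 h3 h4]] := IH (f - g).
- exact: wgeB.
- rewrite coefB; case: (ltngtP J i) hi => // [hi _|<- _].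
    apply: qgeB; first exact: hJ.
    have him : (J - m <= i)%N by lia.
    have hm' : (m < i - (J - m))%N by lia.
    have := hg i him _ (@lams _ hm'); apply: qgeW.
    have -> : ((i - (J - m))%N%:Z) = i%:Z - J%:Z + m%:Z by lia.
    by rewrite !mulrDr mulrN; lia.
  rewrite /g coefZ coefXnM ltnNge leq_subr /= subKn // lamm mulr1 subrr.
  exact: qge0.
exists rf; split=> //; rewrite -h4 actB.
by rewrite /g actZ actXnM lam0 mul0mx scaler0 subr0.
Qed.

(** Each step raises the weight of the rest by 1, so the rests [F i] tend to 0, while the low parts
    [Rr i] keep degree below [m]; their sum converges coefficient by coefficient to [r]. *)
Lemma reduction_limit : exists r : {poly L}, (size r <= m)%N /\
  act T ('X^m - r) x0 = 0.
Proof.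
pose G k f := if pselect (wge f k) is left H then projT1 (cid (reduction_step H))
              else (0, 0).
have GP k f : wge f k -> [/\ (size (G k f).1 <= m)%N, wge (G k f).1 k,
    wge (G k f).2 (k + 1) & act T f x0 = act T (G k f).1 x0 + act T (G k f).2 x0].
  by rewrite /G => h; case: pselect => // H; apply: (projT2 (cid (reduction_step H))).
pose k0 := - (v * m%:Z).
pose F := fix F i := if i is i'.+1 then (G (k0 + i'%:Z) (F i')).2 else 'X^m.
pose Rr i := (G (k0 + i%:Z) (F i)).1.
have hF i : wge (F i) (k0 + i%:Z).
  elim: i => [|i IH] /=.
    move=> j; rewrite coefXn /k0; case: eqP => [->|_]; last exact: qge0.
    by rewrite addr0 addNr; apply: qge1.
  by have [_ _ h _] := GP _ _ IH; rewrite (_ : k0 + i.+1%:Z = k0 + i%:Z + 1) //; lia.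
have hRs i : (size (Rr i) <= m)%N by have [] := GP _ _ (hF i).
have hR i : wge (Rr i) (k0 + i%:Z) by have [] := GP _ _ (hF i).
have tel i : act T 'X^m x0 = act T (\sum_(j < i) Rr j) x0 + act T (F i) x0.
  elim: i => [|i IH]; first by rewrite big_ord0 act0 add0r.
  rewrite IH big_ord_recr /= actD -addrA; congr (_ + _).
  by have [_ _ _] := GP _ _ (hF i).
have /choice [Y hY] : forall j : 'I_m, exists Y : L, forall N : int,
    exists k0 : nat, forall k, (k0 <= k)%N -> vge (Y - \sum_(i < k) (Rr i)`_j) N.
  move=> j; have [c hc] := @qgeE K u u0 (k0 + v * j%:Z).
  have [N|i|Y [_ hY]] := @lser_series _ phi (fun i => (Rr i)`_j) c.
  - exists (absz (u%:Z * N - k0 - v * j%:Z)%R) => k hk.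
    by apply/(@vge_qge K u u0 _ _); apply: qgeW (hR k j); lia.
  - by apply/hc; apply: qgeW (hR i j); lia.
  - by exists Y.
pose r := \poly_(j < m) (if insub j is Some j' then Y j' else 0).
have rj (j : 'I_m) : r`_j = Y j by rewrite coef_poly ltn_ord valK.
exists r; split; first exact: size_poly.
have [A hA] := vqge_ex u0 x0.
apply: (vqge_eq0 u0) => B.
(* Valuation at least [N] gives weight at least [B - A + C] in every degree below [m]; combined with
   the bound [A] on [x0] and the loss [C], this yields [B]. *)
pose N := `|B - A + C| + \sum_(j < m) `|v * j%:Z|.
have hN (j : 'I_m) : `|B - A + C| + `|v * j%:Z| <= N.
  rewrite /N (bigD1 j) //=.
  have : 0 <= \sum_(i < m | i != j) `|v * i%:Z| by apply: sumr_ge0.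
  by move: (\sum_(i < m | _) _) => S; lia.
have /choice [K0 hK0] : forall j : 'I_m, exists n : nat, forall k, (n <= k)%N ->
    vge (Y j - \sum_(i < k) (Rr i)`_j) N by move=> j; apply: hY.
pose k := (\max_j K0 j + absz (B - A + C - k0)%R)%N.
have -> : act T ('X^m - r) x0 = act T (F k) x0 - act T (r - \sum_(j < k) Rr j) x0.
  by rewrite !actB (tel k) opprB [RHS]addrA [act T (F k) x0 + _]addrC.
apply: vqgeB.
  have := vqge_act (hF k) hA; apply: vqgeW; rewrite /k; lia.
have : wge (r - \sum_(j < k) Rr j) (B - A + C).
  move=> j; case: (ltnP j m) => hj; last first.
    rewrite nth_default //; apply: leq_trans hj; apply: leq_trans (size_polyD _ _) _.
    rewrite size_polyN geq_max size_poly; apply: (leq_trans (size_sum _ _ _)).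
    by apply/bigmax_leqP => i _.
  pose jo := Ordinal hj; rewrite coefB coef_sum -[j]/(nat_of_ord jo) rj.
  have hk : (K0 jo <= k)%N by apply: leq_trans (leq_addr _ _); apply: (leq_bigmax jo).
  move=> a ha; apply: (hK0 jo k hk); have /= hNj := hN jo.
  rewrite ltNge; apply/negP => hNa; have : a <= u%:Z * a by nia.
  by move: ha; rewrite /=; lia.
move=> /vqge_act /(_ hA); apply: vqgeW; lia.
Qed.

End Reduction.

Lemma wge_ex f : exists A, wge f A.
Proof.
have /choice [B hB] : forall i : 'I_(size f), exists A, qge f`_i (A + v * i%:Z).
  by move=> i; have [A hA] := qge_ex u0 f`_i; exists (A - v * i%:Z); rewrite subrK.
exists (- \sum_i `|B i|) => i; case: (ltnP i (size f)) => hi; last first.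
  by rewrite nth_default //; apply: qge0.
apply: qgeW (hB (Ordinal hi)); rewrite lerD2r (bigD1 (Ordinal hi)) //=.
have : 0 <= \sum_(j < size f | j != Ordinal hi) `|B j| by apply: sumr_ge0.
by move: (\sum_(j < _ | _) _) => S; lia.
Qed.

(* Let [m] be the last index minimizing [u v(a_i) - v i]. If [m < n], repeated
   division by [a] converges, since [K((sigma))] is complete, and expresses
   [x0 T^m] through lower powers of [T], against independence. *)
Theorem newton_bound (a : {poly L}) (n : nat) (wn : int) (x0 : 'rV[L]_d) :
  size a = n.+1 -> vge a`_n wn -> act T a x0 = 0 ->
  (forall f : {poly L}, (size f <= n)%N -> act T f x0 = 0 -> f = 0) ->
  wge a (u%:Z * wn - v * n%:Z).
Proof.
move=> sza anv ax0 indep; apply: contrapT => bad.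
set k1 := u%:Z * wn - v * n%:Z in bad.
have wgeW k l : l <= k -> wge a k -> wge a l.
  by move=> hl h i; apply: qgeW (h i); rewrite lerD2r.
have [A0 hA0] := wge_ex a.
have ltA : A0 < k1 by rewrite ltNge; apply/negP => hle; apply: bad; apply: wgeW hA0.
have exj : exists j : nat, ~~ `[< wge a (A0 + j%:Z) >].
  exists (absz (k1 - A0)%R); apply/asboolPn.
  by have -> : A0 + (absz (k1 - A0)%R)%:Z = k1 by lia.
case: (ex_minnP exj) => j /asboolPn hj hmin.
have jn : (j <= absz (k1 - A0)%R)%N.
  apply: hmin; apply/asboolPn.
  by have -> : A0 + (absz (k1 - A0)%R)%:Z = k1 by lia.
case: j hj hmin jn => [|j] hj hmin jn; first by case: hj; rewrite addr0.
(* [k0] is the least weight of a coefficient of [a]: the bound holds at [k0] and fails at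
   [k0 + 1]. *)
pose k0 := A0 + j%:Z.
have hk0 : wge a k0.
  apply/asboolP; apply: contraT => h; have := hmin j h; lia.
have top i b : u%:Z * b < k0 + 1 + v * i%:Z -> a`_i b != 0 -> u%:Z * b = k0 + v * i%:Z.
  move=> hb nz; have : ~ (u%:Z * b < k0 + v * i%:Z) by move/hk0/eqP; rewrite (negPf nz).
  by move/negP; rewrite -leNgt; lia.
pose Q i := `[< exists b, u%:Z * b = k0 + v * i%:Z /\ a`_i b != 0 >].
have exQ : exists i, Q i.
  apply: contrapT => hQ; apply: hj => i b hb; apply: contrapT => /eqP nz.
  apply: hQ; exists i; apply/asboolP; exists b; split=> //.
  by apply: top => //; move: hb; rewrite /k0; lia.
have bQ i : Q i -> (i <= n)%N.
  move=> /asboolP [b [_ nz]]; rewrite -ltnS -sza ltnNge; apply/negP => hi.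
  by rewrite nth_default // coefz0 eqxx in nz.
case: (ex_maxnP exQ bQ) => m /asboolP [b [hb nz]] hmax.
(* At index [n] the weight is at least [k1], which exceeds [k0]. *)
have ltmn : (m < n)%N.
  rewrite ltn_neqAle bQ ?andbT; last by apply/asboolP; exists b.
  apply/negP => /eqP emn; rewrite emn in hb.
  have wb : wn <= b by rewrite leNgt; apply/negP => /anv /eqP; rewrite -emn (negPf nz).
  have : u%:Z * wn <= u%:Z * b by nia.
  by rewrite /k1 in jn; rewrite hb /k0; lia.
have vb : vge a`_m b by move=> b' hb'; apply: hk0; nia.
have [c [hc c1 _]] := lser_inv nz vb.
have hcq : qge c (- (k0 + v * m%:Z)).
  by rewrite -hb -mulrN; apply/(@vge_qge K u u0 _ _).
(* Once divided by its coefficient at [m], [a] fits the reduction: maximality of [m] makes all later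
   weights strictly larger. *)
have [r [szr hr]] : exists r : {poly L}, (size r <= m)%N /\ act T ('X^m - r) x0 = 0.
  apply: (@reduction_limit x0 (c *: a) m).
  - by rewrite actZ ax0 scaler0.
  - by rewrite coefZ.
  - move=> i; rewrite coefZ.
    have -> : - (v * m%:Z) + v * i%:Z = - (k0 + v * m%:Z) + (k0 + v * i%:Z) by lia.
    exact: qgeM.
  move=> i hi; rewrite coefZ.
  have -> : - (v * m%:Z) + 1 + v * i%:Z = - (k0 + v * m%:Z) + (k0 + 1 + v * i%:Z) by lia.
  apply: qgeM => // b' hb'; apply: contrapT => /eqP nz'.
  have : Q i by apply/asboolP; exists b'; split=> //; apply: top.
  by move/hmax; lia.
have : 'X^m - r = 0.
  apply: indep => //; apply: leq_trans (size_polyD _ _) _.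
  by rewrite size_polyN size_polyXn geq_max ltmn (leq_trans szr (ltnW ltmn)).
move/(congr1 (fun p : {poly L} => p`_m)); rewrite coefB coefXn eqxx coef0.
by rewrite nth_default // subr0 => /eqP; rewrite oner_eq0.
Qed.

End Newton.

(** * The Frobenius twist *)

Section Frobenius.
Variables (K : fieldType) (p e q : nat) (qroot : K -> K).
Hypotheses (pp : prime p) (pK : p \in [pchar K]) (qE : q = (p ^ e)%N).
Hypothesis qrootK : forall x, qroot x ^+ q = x.
Local Notation frob := (frob_int q qroot).

Lemma frobD_nat n (x y : K) : (x + y) ^+ (q ^ n) = x ^+ (q ^ n) + y ^+ (q ^ n).
Proof.
apply: exprDn_pchar; rewrite qE -expnM pnatX; apply/orP; left.
by rewrite (eq_pnat _ (pcharf_eq pK)) pnat_id.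
Qed.
Lemma frobD1 (x y : K) : (x + y) ^+ q = x ^+ q + y ^+ q.
Proof. by have := frobD_nat 1 x y; rewrite expn1. Qed.

Lemma expq_inj : injective (fun x : K => x ^+ q).
Proof.
move=> x y /= h; apply/eqP; rewrite -subr_eq0.
have : (x - y) ^+ q = 0.
  apply: (addIr (y ^+ q)); rewrite -frobD1 subrK add0r h //.
by move/eqP; rewrite expf_eq0 => /andP [].
Qed.
(** [qroot] inherits the ring operations from the q-th power map, an injective endomorphism of which
    it is a right inverse. *)
Lemma qrootD (x y : K) : qroot (x + y) = qroot x + qroot y.
Proof. by apply: expq_inj; rewrite /= frobD1 !qrootK. Qed.
Lemma qrootM (x y : K) : qroot (x * y) = qroot x * qroot y.
Proof. by apply: expq_inj; rewrite /= exprMn !qrootK. Qed.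
Lemma qroot1 : qroot 1 = 1.
Proof. by apply: expq_inj; rewrite /= qrootK expr1n. Qed.

Lemma frob_succ a x : frob (a + 1) x = frob a x ^+ q.
Proof.
case: a => n; first by rewrite -PoszD addn1 /= expnSr exprM.
case: n => [|n]; first by rewrite /= expr1 qrootK.
have -> : Negz n.+1 + 1 = Negz n by lia.
by rewrite /= qrootK.
Qed.
Lemma frob_pred a x : frob (a - 1) x = qroot (frob a x).
Proof. by apply: expq_inj; rewrite /= -frob_succ subrK qrootK. Qed.
Lemma frobA a b x : frob (a + b) x = frob a (frob b x).
Proof.
elim/int_rect: a => [|n IH|n IH]; first by rewrite add0r [RHS]expr1.
  by rewrite (_ : n.+1%:Z = n%:Z + 1) ?frob_succ -?IH -?frob_succ; [congr frob|]; lia.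
rewrite (_ : - n.+1%:Z = - n%:Z - 1) ?frob_pred -?IH -?frob_pred; [congr frob|]; lia.
Qed.

(** The sign reflects sigma^a c = c^(q^(-a)) sigma^a. *)
Lemma frob_twist : exists phi : twist K, forall a x, phi a x = frob (- a) x.
Proof.
have fD a x y : frob a (x + y) = frob a x + frob a y.
  case: a => n; first exact: frobD_nat.
  rewrite /frob_int; elim: n.+1 => //= m ->; exact: qrootD.
have fM a x y : frob a (x * y) = frob a x * frob a y.
  case: a => n; first exact: exprMn.
  rewrite /frob_int; elim: n.+1 => //= m ->; exact: qrootM.
have f1 a : frob a 1 = 1.
  case: a => n; first exact: expr1n.
  rewrite /frob_int; elim: n.+1 => //= m ->; exact: qroot1.
have f0 x : frob 0 x = x by exact: expr1.
unshelve eexists (@Twist K (fun a => frob (- a)) _ _ _ _ _) => //.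
by move=> a b x; rewrite /= opprD frobA.
Qed.

End Frobenius.

(** * From coefficient functions to matrices over K((sigma))[t] *)

Section Conversion.
Variables (K : fieldType) (q : nat) (qroot : K -> K) (phi : twist K).
Hypothesis phiE : forall a x, phi a x = frob_int q qroot (- a) x.
Local Notation L := (lser phi).

Lemma lboundP (f : LS K) : lbounded f -> vge f (lbound f).
Proof.
rewrite /lbound => hf; case: excluded_middle_informative => // H.
exact: (proj2_sig (constructive_indefinite_description _ H)).
Qed.

Lemma ls_mulE (f g : L) : ls_mul q qroot f g = (f * g : L).
Proof.
apply/funext => k; rewrite /ls_mul coefzM /convz isumE.
  by congr fsum; apply/funext => a; rewrite phiE.
move=> a; rewrite -phiE mulf_eq0 negb_or tw_eq0 => /andP [nf ng].
have hf : vge f (lbound f) by apply: lboundP; have [k0 h] := vge_ex f; exists k0.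
have hg : vge g (lbound g) by apply: lboundP; have [k0 h] := vge_ex g; exists k0.
rewrite leNgt; apply/andP; split; first by apply/negP => /hf /eqP; rewrite (negPf nf).
rewrite leNgt; apply/negP => h.
by move: ng; rewrite hg ?eqxx //; lia.
Qed.

Definition lp_of (p : {poly L}) : LP K := fun n => p`_n.

Lemma lp_of_inj : injective lp_of.
Proof.
move=> f g h; apply/polyP => i; apply: lserext => k.
by have := congr1 (fun F : LP K => F i k) h.
Qed.
Lemma lp_of_isLP f : isLP f -> exists p, f = lp_of p.
Proof.
move=> [[N hN] hb].
pose p : {poly L} := \poly_(i < N) Lser phi (asboolT (hb i)).
exists p; apply/funext => n; rewrite /lp_of coef_poly.
by case: ltnP => // /hN ->.
Qed.
Lemma lp_ofM f g : lp_mul q qroot (lp_of f) (lp_of g) = lp_of (f * g).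
Proof.
apply/funext => n; apply/funext => k; rewrite /lp_mul /lp_of coefM coefz_sum.
by apply: eq_bigr => i _; rewrite ls_mulE.
Qed.
Lemma lp_ofD f g : lp_add (lp_of f) (lp_of g) = lp_of (f + g).
Proof. by apply/funext => n; apply/funext => k; rewrite /lp_add /lp_of coefD. Qed.
Lemma lp_of1 : lp_of 1 = lp1 K.
Proof.
apply/funext => n; rewrite /lp_of /lp1 coef1; case: eqP => // _.
by apply/funext => k; rewrite coefz1.
Qed.
Lemma lp_of0 : lp_of 0 = lp0 K.
Proof. by apply/funext => n; rewrite /lp_of coef0. Qed.

Lemma lp_unit_of f : lp_unit q qroot f ->
  exists u w : {poly L}, [/\ f = lp_of u, u * w = 1 & w * u = 1].
Proof.
move=> [/lp_of_isLP [u ->] [_ [/lp_of_isLP [w ->] []]]].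
by rewrite !lp_ofM -lp_of1 => /lp_of_inj h1 /lp_of_inj h2; exists u, w.
Qed.

Lemma lp_monic_of f : lp_monic f -> exists p : {poly L}, f = lp_of p /\ p \is monic.
Proof.
move=> [/lp_of_isLP [p ->] [n [h1 h2]]]; exists p; split=> //.
have pn : p`_n = 1.
  by apply: lserext => k; rewrite coefz1; have := congr1 (fun F => F k) h1.
have sz : size p = n.+1.
  apply/eqP; rewrite eqn_leq; apply/andP; split.
    apply/leq_sizeP => j hj; apply: lserext => k.
    by have := congr1 (fun F => F k) (h2 j hj).
  by rewrite ltnNge; apply/negP => /leq_sizeP /(_ n (leqnn n)) /eqP; rewrite pn oner_eq0.
by rewrite monicE /lead_coef sz pn.
Qed.

Variable d : nat.
Definition lpmx (A : 'M[{poly L}]_d) : LPmx K d := fun i j => lp_of (A i j).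
Lemma lpmx_inj : injective lpmx.
Proof.
move=> A B h; apply/matrixP => i j; apply: lp_of_inj.
exact: (congr1 (fun F : LPmx K d => F i j) h).
Qed.

(** What is kept of a chain of elementary operations. Over a noncommutative ring no determinant
    detects invertibility, so the inverses are part of the data. *)
Definition mx_equiv (A B : 'M[{poly L}]_d) := exists P P' Q Q' : 'M[{poly L}]_d,
  [/\ B = P *m A *m Q, P *m P' = 1%:M, P' *m P = 1%:M, Q *m Q' = 1%:M & Q' *m Q = 1%:M].

Lemma mx_equiv_refl A : mx_equiv A A.
Proof. by exists 1%:M, 1%:M, 1%:M, 1%:M; rewrite !mul1mx !mulmx1. Qed.
Lemma mx_equiv_trans A B C : mx_equiv A B -> mx_equiv B C -> mx_equiv A C.
Proof.
move=> [P [P' [Q [Q' [-> h1 h2 h3 h4]]]]] [R [R' [S [S' [-> g1 g2 g3 g4]]]]].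
exists (R *m P), (P' *m R'), (Q *m S), (S' *m Q'); split; rewrite ?mulmxA //.
- by rewrite -(mulmxA R P P') h1 mulmx1.
- by rewrite -(mulmxA P' R' R) g2 mulmx1.
- by rewrite -(mulmxA Q S S') g3 mulmx1.
- by rewrite -(mulmxA S' Q' Q) h4 mulmx1.
Qed.
Lemma mx_equivl A P P' : P *m P' = 1%:M -> P' *m P = 1%:M -> mx_equiv A (P *m A).
Proof. by move=> h1 h2; exists P, P', 1%:M, 1%:M; rewrite !mulmx1. Qed.
Lemma mx_equivr A Q Q' : Q *m Q' = 1%:M -> Q' *m Q = 1%:M -> mx_equiv A (A *m Q).
Proof. by move=> h1 h2; exists 1%:M, 1%:M, Q, Q'; rewrite !mul1mx. Qed.

Definition elem_mx (i j : 'I_d) (r : {poly L}) : 'M[{poly L}]_d :=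
  \matrix_(a, b) if (a == i) && (b == j) then r else 0.
Lemma elem_mxl i j r (A : 'M_d) a b : (elem_mx i j r *m A) a b = if a == i then r * A j b else 0.
Proof.
rewrite mxE (bigD1 j) //= big1 ?addr0 ?mxE ?eqxx ?andbT.
  by case: ifP; rewrite ?mul0r.
by move=> k /negPf hk; rewrite mxE hk andbF mul0r.
Qed.
Lemma elem_mxr i j r (A : 'M_d) a b : (A *m elem_mx i j r) a b = if b == j then A a i * r else 0.
Proof.
rewrite mxE (bigD1 i) //= big1 ?addr0 ?mxE ?eqxx ?andbT.
  by rewrite /=; case: ifP; rewrite ?mulr0.
by move=> k /negPf hk; rewrite mxE hk mulr0.
Qed.
(** For distinct i and j the matrix r E_ij has square zero. *)
Lemma elem_mx_inv i j r : i != j ->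
  (1%:M + elem_mx i j r) *m (1%:M - elem_mx i j r) = 1%:M /\
  (1%:M - elem_mx i j r) *m (1%:M + elem_mx i j r) = 1%:M.
Proof.
move=> /negPf nij; have nil : elem_mx i j r *m elem_mx i j r = 0.
  apply/matrixP => a b; rewrite elem_mxl !mxE [j == i]eq_sym nij /= mulr0.
  by case: ifP.
split.
  by rewrite mulmxDl !mulmxBr !mul1mx mulmx1 nil subr0 subrK.
by rewrite mulmxBl !mulmxDr !mul1mx mulmx1 nil addr0 addrK.
Qed.

Lemma swap_tperm (i j a : 'I_d) :
  (if a == i then j else if a == j then i else a) = tperm i j a.
Proof.
case: tpermP => [->|->|]; rewrite ?eqxx //; first by case: eqP.
by do 2 case: eqP => //.
Qed.

Lemma tperm_mxK (i j : 'I_d) :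
  tperm_mx i j *m tperm_mx i j = 1%:M :> 'M[{poly L}]_d.
Proof. by rewrite /tperm_mx -perm_mxM tperm2 perm_mx1. Qed.

Lemma unit_diag_mx (u w : {poly L}) (i : 'I_d) : u * w = 1 ->
  diag_mx (\row_j (if j == i then u else 1)) *m
  diag_mx (\row_j (if j == i then w else 1)) = 1%:M.
Proof.
move=> h; rewrite mulmx_diag; apply/matrixP => a b; rewrite !mxE.
by case: (a =P b) => // _; rewrite !mulr1n; case: eqP => _; rewrite ?h ?mulr1.
Qed.

Lemma elem_step_mx A B : elem_step q qroot (lpmx A) B ->
  exists2 B', B = lpmx B' & mx_equiv A B'.
Proof.
case=> [[i [j ->]]|[[i [j ->]]|[[i [f [/lp_unit_of [u [w [-> h1 h2]]] ->]]]|
  [[j [f [/lp_unit_of [u [w [-> h1 h2]]] ->]]]|[[i [j [f [nij [/lp_of_isLP [r ->] ->]]]]]|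
  [i [j [f [nij [/lp_of_isLP [r ->] ->]]]]]]]]]].
- exists (tperm_mx i j *m A); last by apply: mx_equivl; apply: tperm_mxK.
  apply/funext => a; apply/funext => b.
  by rewrite /lpmx -row_permE mxE swap_tperm.
- exists (A *m tperm_mx i j); last by apply: mx_equivr; apply: tperm_mxK.
  apply/funext => a; apply/funext => b.
  by rewrite /lpmx /tperm_mx -tpermV -col_permE mxE swap_tperm.
- exists (diag_mx (\row_k (if k == i then u else 1)) *m A); last first.
    exact: mx_equivl (unit_diag_mx i h1) (unit_diag_mx i h2).
  apply/funext => a; apply/funext => b; rewrite /lpmx mul_diag_mx !mxE.
  by case: eqP => _; rewrite ?lp_ofM ?mul1r.
- exists (A *m diag_mx (\row_k (if k == j then u else 1))); last first.
    exact: mx_equivr (unit_diag_mx j h1) (unit_diag_mx j h2).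
  apply/funext => a; apply/funext => b; rewrite /lpmx mul_mx_diag !mxE.
  by case: eqP => _; rewrite ?lp_ofM ?mulr1.
- have [e1 e2] := elem_mx_inv r nij.
  exists ((1%:M + elem_mx i j r) *m A); last exact: mx_equivl e1 e2.
  apply/funext => a; apply/funext => b; rewrite /lpmx mulmxDl mul1mx mxE elem_mxl.
  by case: eqP => [->|_]; rewrite ?lp_ofM ?lp_ofD ?addr0.
rewrite eq_sym in nij; have [e1 e2] := elem_mx_inv r nij.
exists (A *m (1%:M + elem_mx j i r)); last exact: mx_equivr e1 e2.
apply/funext => a; apply/funext => b; rewrite /lpmx mulmxDr mulmx1 mxE elem_mxr.
by case: eqP => [->|_]; rewrite ?lp_ofM ?lp_ofD ?addr0.
Qed.

Lemma elem_equiv_mx A B : elem_equiv q qroot (lpmx A) B ->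
  exists2 B', B = lpmx B' & mx_equiv A B'.
Proof.
move eX: (lpmx A) => X h.
elim: h A eX => {X B} [x y h A eA|x A <-|x y z _ IH1 _ IH2 A eA].
- by apply: elem_step_mx; rewrite eA.
- by exists A => //; apply: mx_equiv_refl.
have [Y eY hY] := IH1 A eA; have [Z eZ hZ] := IH2 Y (esym eY).
by exists Z => //; apply: mx_equiv_trans hZ.
Qed.

Lemma tau_ls_subproof (p : {poly K}) : vge (tau_to_ls p) (- (size p)%:Z).
Proof.
move=> k hk; rewrite /tau_to_ls; case: ifP => // hk0.
by rewrite nth_default //; move: hk (hk0); move: (size _) => n; lia.
Qed.
Definition tau_ls (p : {poly K}) : L := mkser phi (@tau_ls_subproof p).

Definition skew_mx (D : 'I_d -> 'I_d -> {poly K}) : 'M[L]_d :=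
  \matrix_(i, j) tau_ls (D i j).

Lemma charmx_lpmx D : charmx D = lpmx ('X%:M - map_mx polyC (skew_mx D)).
Proof.
apply/funext => i; apply/funext => j; apply/funext => n; apply/funext => k.
rewrite /charmx /lpmx /lp_of !mxE coefB coefC coefMn coefX coefzB.
case: (eqVneq i j) => _; rewrite ?mulr1n ?mulr0n ?andbT ?andbF;
  by case: n => [|[|n]]; rewrite /= ?coefz1 ?coefz0 ?subr0 ?sub0r.
Qed.

(** The form [l j = c * l i] says that L[t] l_j lies in L[t] l_i, which makes L[t] / L[t] l_i a
    quotient of L[t] / L[t] l_j. *)
Lemma invariant_factors_mx (D : 'I_d -> 'I_d -> {poly K}) lam : (0 < d)%N ->
  invariant_factors q qroot D lam ->
  exists l : 'I_d -> {poly L},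
  [/\ forall i : 'I_d, lam i = lp_of (l i),
      mx_equiv ('X%:M - map_mx polyC (skew_mx D)) (diag_mx (\row_i l i)),
      forall i, l i \is monic &
      forall i j : 'I_d, (i <= j)%N -> exists c, l j = c * l i].
Proof.
move=> d0 [h [hm hdiv]].
have /choice [l hl] : forall i : 'I_d, exists p : {poly L},
  lam i = lp_of p /\ p \is monic by move=> i; apply: lp_monic_of; apply: hm.
have [B eB hB] : exists2 B', diagmx lam = lpmx B' &
    mx_equiv ('X%:M - map_mx polyC (skew_mx D)) B'.
  by apply: elem_equiv_mx; rewrite -charmx_lpmx.
exists l; split.
- by move=> i; have [] := hl i.
- suff -> : diag_mx (\row_i l i) = B by [].
  apply: lpmx_inj; rewrite -eB; apply/funext => i; apply/funext => j.
  rewrite /diagmx /lpmx !mxE; case: eqP => [->|_]; rewrite ?mulr1n ?mulr0n ?lp_of0 //.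
  by have [] := hl j.
- by move=> i; have [] := hl i.
move=> i j hij.
have [n] : exists n, j = (i + n)%N :> nat by exists (j - i)%N; rewrite subnKC.
elim: n j {hij} => [|n IH] j hj.
  by exists 1; rewrite mul1r; congr l; apply: val_inj; rewrite /= hj addn0.
have hj' : (i + n < d)%N by have := ltn_ord j; lia.
have [c hc] := IH (Ordinal hj') erefl.
have hd1 : ((i + n).+1 < d)%N by have := ltn_ord j; lia.
have [_ [c' [/lp_of_isLP [c2 ->]]]] := hdiv _ hd1.
have ej : (i + n).+1 = j by lia.
have [e1 _] := hl j; have [e2 _] := hl (Ordinal hj').
rewrite ej e1 -[(i + n)%N]/(nat_of_ord (Ordinal hj')) e2 lp_ofM => /lp_of_inj ->.
by exists (c2 * c); rewrite hc mulrA.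
Qed.

End Conversion.

(** * Row vectors as a module over K((sigma))[t] *)

Section Evaluation.
Variables (R : nzRingType) (d : nat) (D : 'M[R]_d).
Local Notation A := ('X%:M - map_mx polyC D).
Implicit Types (f g b : 'rV[{poly R}]_d) (x y : 'rV[R]_d).
Local Notation pc := (map_mx polyC).

Lemma mul_X_mx m n (b : 'M[{poly R}]_(m, n)) : b *m 'X%:M = 'X *: b.
Proof.
rewrite -diag_const_mx mul_mx_diag; apply/matrixP => i j; rewrite !mxE.
exact: commr_polyX.
Qed.

Lemma pc_inj x : pc x = 0 -> x = 0.
Proof.
move=> h; apply/rowP => j; have := congr1 (fun M : 'rV[{poly R}]_d => M 0 j) h.
by rewrite !mxE => /eqP; rewrite polyC_eq0 => /eqP.
Qed.

(** Vanishing of the coefficient of t^(k+1) in b (t - D) reads b_k = b_(k+1) D; as the degree of [b]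
    is bounded, descending induction gives b = 0. *)
Lemma charmx_const x b : pc x = b *m A -> x = 0.
Proof.
move=> h; pose cf k := map_mx (coefp k) b.
have rec k : cf k = cf k.+1 *m D.
  have := congr1 (map_mx (coefp k.+1)) h; rewrite mulmxBr mul_X_mx => e.
  apply/rowP => j; move/rowP: e => /(_ j); rewrite !mxE /= coefB coefC coefXM /=.
  move/eqP; rewrite eq_sym subr_eq0 => /eqP ->.
  by rewrite coef_sum; apply: eq_bigr => i _; rewrite !mxE coefMC.
have [N hN] : exists N, forall j, (size (b 0%R j) <= N)%N.
  by exists (\max_j size (b 0%R j))%N => j; apply: (leq_bigmax j).
have z k : cf (N - k)%N = 0.
  elim: k => [|k IH].
    by apply/rowP => j; rewrite !mxE /= nth_default // subn0.
  case: (leqP N k) => hk.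
    have -> : (N - k.+1 = N - k)%N by lia.
    exact: IH.
  by rewrite rec (_ : (N - k.+1).+1 = (N - k)%N) ?IH ?mul0mx //; lia.
suff b0 : b = 0 by apply: pc_inj; rewrite h b0 mul0mx.
apply/rowP => j; apply/polyP => k; rewrite mxE coef0.
case: (leqP N k) => hk; first by rewrite nth_default // (leq_trans (hN j)).
have := z (N - k)%N; rewrite subKn ?(ltnW hk) // => /rowP /(_ j).
by rewrite !mxE.
Qed.

(** Congruence to a constant row modulo the row module of t - D. Each row has exactly one such
    remainder, which identifies R[t]^d / R[t]^d (t - D) with R^d. *)
Definition reduces f x := exists b, pc x = f + b *m A.

Lemma reducesD f g x y : reduces f x -> reduces g y -> reduces (f + g) (x + y).
Proof.
move=> [b hb] [c hc]; exists (b + c); rewrite mulmxDl addrACA -hb -hc.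
by apply/rowP => j; rewrite !mxE polyCD.
Qed.
Lemma pcZ (c : R) x : pc (c *: x) = c%:P *: pc x.
Proof. by apply/rowP => j; rewrite !mxE polyCM. Qed.
Lemma reducesZ (c : R) f x : reduces f x -> reduces (c%:P *: f) (c *: x).
Proof.
by move=> [b hb]; exists (c%:P *: b); rewrite pcZ hb scalerDr scalemxAl.
Qed.
Lemma pcM x (B : 'M[R]_d) : pc (x *m B) = pc x *m pc B.
Proof.
apply/rowP => j; rewrite !mxE raddf_sum; apply: eq_bigr => i _.
by rewrite !mxE; apply: polyCM.
Qed.
Lemma reducesX f x : reduces f x -> reduces ('X *: f) (x *m D).
Proof.
(* The correction [pc x] comes from t x - x (t - D) = x D. *)
move=> [b hb]; exists ('X *: b - pc x); rewrite pcM mulmxBl.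
rewrite [X in _ - X]mulmxBr mul_X_mx -scalemxAl.
have -> : 'X *: pc x = 'X *: f + 'X *: (b *m A) by rewrite hb scalerDr.
by rewrite opprB addrA addrC subrK.
Qed.
Lemma reduces_total f : exists x, reduces f x.
Proof.
suff H j (p : {poly R}) : exists x, reduces (p *: delta_mx 0 j) x.
  rewrite (row_sum_delta f); apply: (big_ind (fun f => exists x, reduces f x)) => //.
    by exists 0, 0; rewrite mul0mx addr0; apply/rowP => j; rewrite !mxE.
  by move=> ? ? [x hx] [y hy]; exists (x + y); apply: reducesD.
elim/poly_ind: p => [|p c [x hx]].
  by exists 0, 0; rewrite mul0mx addr0 scale0r; apply/rowP => k; rewrite !mxE.
exists (x *m D + c *: delta_mx 0 j); rewrite scalerDl; apply: reducesD.
  have -> : p * 'X = 'X * p by exact: commr_polyX.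
  by rewrite -scalerA; exact: reducesX hx.
exists 0; rewrite mul0mx addr0 pcZ; congr (_ *: _).
by apply/rowP => k; rewrite !mxE; case: (_ && _).
Qed.
Lemma reduces_uniq f x y : reduces f x -> reduces f y -> x = y.
Proof.
move=> [b hb] [c hc]; apply/eqP; rewrite -subr_eq0; apply/eqP.
apply: (@charmx_const _ (b - c)); rewrite map_mxB hb hc mulmxBl.
by rewrite opprD addrACA subrr add0r.
Qed.

(* [ev f] is the value at [t = D] of the polynomial row [f], coefficients on the left. *)
Definition ev f := projT1 (cid (reduces_total f)).
Lemma evP f : reduces f (ev f). Proof. exact: (projT2 (cid (reduces_total f))). Qed.
Lemma ev_eq f x : reduces f x -> ev f = x. Proof. exact: reduces_uniq (evP f). Qed.

Lemma evD f g : ev (f + g) = ev f + ev g.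
Proof. by apply: ev_eq; apply: reducesD; apply: evP. Qed.
Lemma evCZ (c : R) f : ev (c%:P *: f) = c *: ev f.
Proof. by apply: ev_eq; apply: reducesZ; apply: evP. Qed.
Lemma evX f : ev ('X *: f) = ev f *m D.
Proof. by apply: ev_eq; apply: reducesX; apply: evP. Qed.
Lemma ev_pc x : ev (pc x) = x.
Proof. by apply: ev_eq; exists 0; rewrite mul0mx addr0. Qed.
Lemma ev0 : ev 0 = 0.
Proof. by rewrite -[RHS]ev_pc; congr ev; apply/rowP => j; rewrite !mxE. Qed.
Lemma evN f : ev (- f) = - ev f.
Proof. by apply: (addrI (ev f)); rewrite -evD !subrr ev0. Qed.
Lemma evB f g : ev (f - g) = ev f - ev g. Proof. by rewrite evD evN. Qed.
Lemma ev_sum I r (P : pred I) (F : I -> 'rV[{poly R}]_d) :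
  ev (\sum_(i <- r | P i) F i) = \sum_(i <- r | P i) ev (F i).
Proof. exact: (big_morph ev evD ev0). Qed.
Lemma ev_A b : ev (b *m A) = 0.
Proof.
apply: ev_eq; exists (- b); rewrite mulNmx subrr.
by apply/rowP => j; rewrite !mxE.
Qed.
Lemma ev_eq0 f : ev f = 0 -> exists b, f = b *m A.
Proof.
move=> h; have [b] := evP f; rewrite h => e; exists (- b); apply/eqP.
rewrite mulNmx -addr_eq0 -e; apply/eqP/rowP => j; by rewrite !mxE.
Qed.
Lemma ev_Xn n f : ev ('X^n *: f) = ev f *m D ^+ n.
Proof.
elim: n => [|n IH]; first by rewrite !expr0 scale1r mulmx1.
by rewrite exprS -scalerA evX IH exprSr -mulmxE mulmxA.
Qed.
Lemma ev_act (p : {poly R}) f : ev (p *: f) = act D p (ev f).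
Proof.
rewrite -[p in LHS]coefK poly_def scaler_suml ev_sum; apply: eq_bigr => i _.
by rewrite -mul_polyC -scalerA evCZ ev_Xn.
Qed.

End Evaluation.

(** * Decomposition by invariant factors, the quotient norm, and the edge from growth *)

Section Structure.
Variables (K : fieldType) (phi : twist K).
Local Notation L := (lser phi).
Variables (d : nat) (D X : 'M[L]_d) (l : 'I_d -> {poly L}) (z : 'I_d).
Variables (P P' Q Q' : 'M[{poly L}]_d) (c : 'I_d -> {poly L}).
Local Notation A := ('X%:M - map_mx polyC D).
Local Notation Lam := (diag_mx (\row_i l i)).
Local Notation lam := (l z).
Hypotheses (equiv : Lam = P *m A *m Q) (PP' : P' *m P = 1%:M).
Hypotheses (QQ : Q *m Q' = 1%:M) (QQ' : Q' *m Q = 1%:M).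
Hypotheses (monic_l : forall i, l i \is monic) (lamE : forall i, lam = c i * l i).
Hypothesis XD : X *m D = 1%:M.
Local Notation ev := (ev D).
Local Notation dact := (act D).
Implicit Types (f g y : 'rV[{poly L}]_d) (x : 'rV[L]_d).

(** Right multiplication by [Q'] carries the rows of diag(l_j) to relations of t - D, so [psi]
    presents V as the direct sum of the L[t] / L[t] l_j. *)
Definition psi g := ev (g *m Q').

Lemma psiD g g' : psi (g + g') = psi g + psi g'.
Proof. by rewrite /psi mulmxDl evD. Qed.
Lemma psiB g g' : psi (g - g') = psi g - psi g'.
Proof. by rewrite /psi mulmxBl evB. Qed.
Lemma psiZ p g : psi (p *: g) = dact p (psi g).
Proof. by rewrite /psi -scalemxAl ev_act. Qed.
Lemma psi_surj x : x = psi (map_mx polyC x *m Q).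
Proof. by rewrite /psi -mulmxA QQ mulmx1 ev_pc. Qed.
Lemma psi_eq0 g : psi g = 0 <-> exists y, forall j, g 0 j = y 0 j * l j.
Proof.
split=> [/ev_eq0 [b hb]|[y hy]].
  exists (b *m P') => j.
  have -> : g = b *m P' *m Lam.
    rewrite equiv !mulmxA -(mulmxA b) PP' mulmx1 -hb -mulmxA QQ'.
    by rewrite mulmx1.
  by rewrite mul_mx_diag !mxE.
have -> : g = y *m Lam by apply/rowP => j; rewrite mul_mx_diag !mxE.
by rewrite /psi equiv -!mulmxA QQ mulmx1 mulmxA ev_A.
Qed.
(** Since lam = c_j l_j, the map [psi] factors through W^d. *)
Lemma psi_lam y : psi (\row_j (y 0 j * lam)) = 0.
Proof.
by apply/psi_eq0; exists (\row_j (y 0 j * c j)) => j; rewrite !mxE -mulrA -lamE.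
Qed.

(** It generates a copy of W inside V. *)
Definition gen := psi (delta_mx 0 z).
Lemma act_gen p : dact p gen = 0 <-> exists y : {poly L}, p = y * lam.
Proof.
rewrite -psiZ psi_eq0; split=> [[y hy]|[y ->]].
  by exists (y 0 z); rewrite -hy !mxE !eqxx mulr1.
exists (y *: delta_mx 0 z) => j; rewrite !mxE eqxx /=.
by case: eqP => [->|_]; rewrite ?mulr1 ?mulr0 ?mul0r.
Qed.
Lemma act_gen_lam : dact lam gen = 0.
Proof. by apply/act_gen; exists 1; rewrite mul1r. Qed.
Lemma gen_indep (p : {poly L}) : (size p < size lam)%N -> dact p gen = 0 -> p = 0.
Proof.
move=> hs /act_gen [y hy]; case: (eqVneq y 0) => [y0|ny]; first by rewrite hy y0 mul0r.
move: hs; rewrite hy size_Mmonic //.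
have : (0 < size y)%N by rewrite lt0n size_poly_eq0.
by case: (size y) => // m _; rewrite addSn /= ltnNge leq_addl.
Qed.

(** As t is surjective, [gen] is t times a vector, so some 1 - t g lies in L[t] lam; its constant
    coefficient 1 is then a left multiple of lam_0. *)
Lemma lam0_neq0 : lam`_0 <> 0.
Proof.
move=> a0; have : gen - psi ('X *: (map_mx polyC (gen *m X) *m Q)) = 0.
  rewrite psiZ -psi_surj -[X in dact X]expr1 actXn expr1 -mulmxA XD mulmx1.
  exact: subrr.
rewrite -psiB psi_eq0 => -[y /(_ z)] /(congr1 (fun p : {poly L} => p`_0)).
rewrite coef0M a0 mulr0 !mxE !eqxx coefB coefXM coef1 subr0 => /eqP.
by rewrite oner_eq0.
Qed.

Lemma lser_mulIf (a b : L) : b <> 0 -> a * b = 0 -> a = 0.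
Proof.
move=> /lead_ex [w [nw hw]] h; have [g [_ _ bg]] := lser_inv nw hw.
by rewrite -[a]mulr1 -bg mulrA h mul0r.
Qed.

(** If t g = y l_j, where l_j has a nonzero constant coefficient, then t divides y and cancels.
    Injectivity turns the left inverse [X] of [D] into a two-sided one. *)
Lemma D_inj x : x *m D = 0 -> x = 0.
Proof.
move=> h; have : psi ('X *: (map_mx polyC x *m Q)) = 0.
  by rewrite psiZ -psi_surj -[X in dact X]expr1 actXn expr1.
rewrite psi_eq0 => -[y hy]; set g := map_mx polyC x *m Q in hy *.
rewrite (psi_surj x) -/g; apply/psi_eq0.
exists (\row_j drop_poly 1 (y 0 j)) => j; rewrite mxE.
have y0 : (y 0 j)`_0 = 0.
  apply: (@lser_mulIf _ (l j)`_0); last first.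
    by rewrite -coef0M -hy mxE coefXM.
  by move=> lj0; apply: lam0_neq0; rewrite (lamE j) coef0M lj0 mulr0.
have yE : y 0 j = drop_poly 1 (y 0 j) * 'X.
  apply/polyP => i; rewrite coefMX coef_drop_poly; case: i => [|i] //=.
  by rewrite addn1.
set t := drop_poly 1 (y 0 j) in yE *.
have Xc (p : {poly L}) : 'X * p = p * 'X by symmetry; exact: commr_polyX.
move: (hy j); rewrite mxE yE -mulrA !Xc mulrA.
by move/(monic_rreg (monicX _)).
Qed.

Lemma DX : D *m X = 1%:M.
Proof.
apply/row_matrixP => i; apply/eqP; rewrite -subr_eq0; apply/eqP; apply: D_inj.
by rewrite mulmxBl -!row_mul -mulmxA XD mulmx1 mul1mx subrr.
Qed.

Lemma psi_all0 x : lam = 1 -> x = 0.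
Proof.
move=> l1; rewrite (psi_surj x); set g := _ *m Q.
have -> : g = \row_j (g 0 j * lam) by apply/rowP => j; rewrite !mxE l1 mulr1.
exact: psi_lam.
Qed.

Lemma mulmxXn_D x n : x *m X ^+ n *m D ^+ n = x.
Proof.
elim: n => [|n IH]; first by rewrite !expr0 !mulmx1.
rewrite exprSr exprS -!mulmxE !mulmxA -(mulmxA (x *m X ^+ n)) XD mulmx1.
exact: IH.
Qed.
Lemma mulmxDn_X x n : x *m D ^+ n *m X ^+ n = x.
Proof.
elim: n => [|n IH]; first by rewrite !expr0 !mulmx1.
rewrite exprSr exprS -!mulmxE !mulmxA -(mulmxA (x *m D ^+ n)) DX mulmx1.
exact: IH.
Qed.


(** The polygon begins at index 0 because lam_0 is nonzero and ends at (n, 0) because [lam] is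
    monic; hence h = - v(lam_0). *)
Lemma edge_data s : np_one_edge (lp_of lam) s -> exists (n : nat) (h : int),
  [/\ (0 < n)%N /\ size lam = n.+1, s = h%:~R / n%:R,
      lam`_0 (- h) != 0, vge lam`_0 (- h) &
      forall i, qge n lam`_i (h * i%:Z - h * n%:Z)].
Proof.
move=> [i0 [n [v0 [vn [hin [[l0 hv0] [[lnn hvn] [hlow [hup [hs hnp]]]]]]]]]].
have i00 : i0 = 0%N.
  case: i0 hin l0 hv0 hlow hs hnp => // i0 _ _ _ /(_ 0%N isT) h _ _.
  case: lam0_neq0; apply: lserext => k; exact: (congr1 (fun F : LS K => F k) h).
move: hin l0 hv0 hs hnp; rewrite {}i00 => n0 l0 hv0 hs hnp.
have szl : size lam = n.+1.
  apply/eqP; rewrite eqn_leq; apply/andP; split.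
    apply/leq_sizeP => j hj; apply: lserext => k.
    exact: (congr1 (fun F : LS K => F k) (hup j hj)).
  rewrite ltnNge; apply/negP => /leq_sizeP /(_ n (leqnn n)) e.
  by apply: lnn; rewrite /lp_of e.
have ln : lam`_n = 1 by have := monic_l z; rewrite monicE /lead_coef szl => /eqP.
have vn0 : vn = 0.
  move: lnn hvn; rewrite /lp_of ln coefz1 => nz h.
  have : ~ 0 < vn by move=> hv; have := h 0 hv; rewrite coefz1 eqxx => /eqP; rewrite oner_eq0.
  by move: nz; case: eqP.
have nQ : (n%:R : rat) != 0 by rewrite pnatr_eq0 -lt0n.
exists n, (- v0); split=> //.
- by rewrite hs vn0 sub0r subn0.
- by rewrite opprK; apply/eqP.
- by rewrite opprK.
move=> i a ha; apply: contrapT => na.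
have [w [nw hw]] : exists w, lam`_i w != 0 /\ vge lam`_i w.
  by apply: lead_ex => li0; apply: na; rewrite li0.
have haw : w <= a by rewrite leNgt; apply/negP => /hw; exact: na.
have lw : ls_val (lp_of lam i) w by split=> //; apply/eqP.
have := hnp i w lw; rewrite hs vn0 sub0r subn0 subr0 => hle.
have {}hle : ((n%:Z * v0 - v0 * i%:Z)%:~R : rat) <= (n%:Z * w)%:~R.
  rewrite rmorphB !rmorphM /= -!pmulrn.
  have n0Q : (0 : rat) < n%:R by rewrite ltr0n.
  rewrite -(ler_pM2l n0Q) in hle; apply: le_trans hle; rewrite le_eqVlt.
  by apply/orP; left; apply/eqP; rewrite rmorphN /=; field.
move: hle; rewrite ler_int => hle; nia.
Qed.

Section Lattices.
Variables (n : nat) (h : int).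
Hypothesis n0 : (0 < n)%N.

(* Elements of [V] of norm at least [k], for the quotient of the norm
   [min_i (n v(g_i) - h i)] on [(L[t] / L[t] lam)^d]. *)
Definition lat (k : int) x := exists g, [/\ x = psi g,
  forall j, (size (g 0%R j) <= n)%N & forall j i, qge n (g 0 j)`_i (k + h * i%:Z)].

Lemma latW k k' x : k' <= k -> lat k x -> lat k' x.
Proof.
move=> hk [g [e s b]]; exists g; split=> // j i; apply: qgeW (b j i).
by rewrite lerD2r.
Qed.
Lemma lat0 k : lat k 0.
Proof.
exists 0; split=> [|j|j i]; rewrite ?mxE ?size_poly0 ?coef0 //.
by rewrite /psi mul0mx ev0.
Qed.
Lemma latD k x x' : lat k x -> lat k x' -> lat k (x + x').
Proof.
move=> [g [-> s b]] [g' [-> s' b']]; exists (g + g'); split=> [|j|j i].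
- by rewrite psiD.
- by rewrite mxE (leq_trans (size_polyD _ _)) // geq_max s s'.
by rewrite mxE coefD; apply: qgeD.
Qed.
Lemma lat_sum I r (P0 : pred I) (F : I -> 'rV[L]_d) k :
  (forall i, P0 i -> lat k (F i)) -> lat k (\sum_(i <- r | P0 i) F i).
Proof. by move=> H; apply: big_ind => //; [exact: lat0|exact: latD]. Qed.
Lemma latZ (a : L) B k x : qge n a B -> lat k x -> lat (k + B) (a *: x).
Proof.
move=> ha [g [-> s b]]; exists (a%:P *: g); split=> [|j|j i].
- by rewrite /psi -scalemxAl evCZ.
- rewrite mxE mul_polyC; exact: leq_trans (size_scale_leq _ _) (s j).
rewrite mxE coefCM (_ : k + B + h * i%:Z = B + (k + h * i%:Z)); last lia.
by apply: qgeM.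
Qed.
Lemma latN k x : lat k x -> lat k (- x).
Proof.
move=> hx; rewrite -scaleN1r -[k]addr0; apply: latZ => //.
by apply: qgeN; apply: qge1.
Qed.
Lemma latB k x x' : lat k x -> lat k x' -> lat k (x - x').
Proof. by move=> hx hx'; apply/latD/latN. Qed.

(** With [lat_lower], this makes the quotient norm equivalent to the coordinatewise valuation.
    Representatives have degree below n, so only finitely many vectors psi(e_j) D^i occur. *)
Lemma lat_upper : exists c, forall k x, lat k x -> vqge n x (k - c).
Proof.
have [B hB] := vqge_ex_fin n0
  (fun p : 'I_d * 'I_n => psi (delta_mx 0 p.1) *m D ^+ p.2).
exists (`|B| + `|h| * n%:Z) => k x [g [-> s b]].
rewrite (row_sum_delta g) /psi mulmx_suml ev_sum; apply: vqge_sum => j _.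
rewrite -/(psi _) psiZ (actE _ _ (s j)); apply: vqge_sum => i _.
have := vqgeZ n0 (b j i) (hB (j, i)); apply: vqgeW.
have := ltn_ord i; nia.
Qed.

Hypothesis szl : size lam = n.+1.

(** Division by the monic [lam], with quotient on the left, provides a representative of degree
    below n. *)
Lemma lat_ex x : exists k, lat k x.
Proof.
pose g := map_mx polyC x *m Q.
pose qd (j : 'I_d) := Pdiv.CommonRing.rdivp (g 0 j) lam.
pose rd (j : 'I_d) := Pdiv.CommonRing.rmodp (g 0 j) lam.
have gE : g = \row_j ((\row_i qd i : 'rV[{poly L}]_d) 0 j * lam) + \row_j rd j.
  apply/rowP => j; rewrite [RHS]mxE [X in X + _]mxE [X in _ + X]mxE [X in X * _]mxE.
    exact: (Pdiv.RingMonic.rdivp_eq (monic_l z)).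
have [B hB] := vqge_ex_fin n0 (fun i : 'I_n => \row_j (rd j)`_i).
exists (B - `|h| * n%:Z), (\row_j rd j); split=> [|j|j i].
- by rewrite (psi_surj x) -/g gE psiD psi_lam add0r.
- rewrite mxE -ltnS -szl; apply: Pdiv.CommonRing.ltn_rmodpN0.
  exact: monic_neq0.
rewrite mxE; case: (ltnP i n) => hi; last first.
  rewrite nth_default; first exact: qge0.
  by apply: leq_trans hi; rewrite -ltnS -szl; apply: Pdiv.CommonRing.ltn_rmodpN0; apply: monic_neq0.
by have := hB (Ordinal hi) j; rewrite mxE; apply: qgeW; nia.
Qed.

Lemma lat_lower : exists c, forall x A, vqge n x A -> lat (A - c) x.
Proof.
have /choice [k hk] : forall i : 'I_d, exists k, lat k (delta_mx 0 i) by move=> i; apply: lat_ex.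
exists (\sum_i `|k i|) => x A hx; rewrite (row_sum_delta x); apply: lat_sum => i _.
have := latZ (hx i) (hk i); apply: latW.
rewrite (bigD1 i) //=; have : 0 <= \sum_(j < d | j != i) `|k j| by apply: sumr_ge0.
by move: (\sum_(j < d | _) _) => S; lia.
Qed.

Hypothesis lamq : forall i, qge n lam`_i (h * i%:Z - h * n%:Z).

(** Subtracting g_(n-1) lam brings t g back to degree below n; the edge bound on the coefficients of
    [lam] gives this term the norm bound k - h as well. *)
Lemma latX k x : lat k x -> lat (k - h) (x *m D).
Proof.
move=> [g [-> s b]].
pose y : 'rV[{poly L}]_d := \row_j ((g 0 j)`_n.-1)%:P.
pose g' := 'X *: g - \row_j (y 0 j * lam).
have gE j i : (g' 0 j)`_i = (if i == 0%N then 0 else (g 0 j)`_i.-1) - (g 0 j)`_n.-1 * lam`_i.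
  by rewrite !mxE coefB coefXM coefCM.
exists g'; split=> [|j|j i].
- by rewrite psiB psi_lam subr0 psiZ -[X in dact X]expr1 actXn expr1.
- apply/leq_sizeP => i hi; rewrite gE.
  have i0 : i != 0%N by lia.
  rewrite (negPf i0); case: (ltngtP n i) hi => // [hi _|<- _].
    have -> : lam`_i = 0 by rewrite nth_default ?szl.
    have -> : (g 0 j)`_i.-1 = 0.
      by rewrite nth_default // (leq_trans (s j)) // -ltnS (ltn_predK hi).
    by rewrite mulr0 subr0.
  have := monic_l z; rewrite monicE /lead_coef szl => /eqP -> .
  by rewrite mulr1 subrr.
rewrite gE; apply: qgeB.
  case: eqP => [->|hi]; first exact: qge0.
  apply: qgeW (b j i.-1); have -> : i.-1%:Z = i%:Z - 1 by lia.
  by rewrite mulrBr mulr1; lia.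
have := qgeM n0 (b j n.-1) (@lamq i); apply: qgeW.
have -> : n.-1%:Z = n%:Z - 1 by lia.
by rewrite mulrBr mulr1; lia.
Qed.

Hypotheses (l0h : lam`_0 (- h) != 0) (vl0 : vge lam`_0 (- h)).

(** Subtracting g_0 lam_0^-1 lam makes [g] divisible by t without changing its class or its norm
    bound; here v(lam_0) has to be exactly - h. *)
Lemma latXV k x : lat k x -> exists x', lat (k + h) x' /\ x = x' *m D.
Proof.
move=> [g [-> s b]].
have [a0 [va0 a01 _]] := lser_inv l0h vl0.
pose y : 'rV[{poly L}]_d := \row_j ((g 0 j)`_0 * a0)%:P.
pose g1 := g - \row_j (y 0 j * lam).
pose g' : 'rV[{poly L}]_d := \row_j drop_poly 1 (g1 0 j).
have g1E j i : (g1 0 j)`_i = (g 0 j)`_i - (g 0 j)`_0 * a0 * lam`_i.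
  by rewrite !mxE coefB coefCM.
have g1X : g1 = 'X *: g'.
  apply/rowP => j; apply/polyP => i; rewrite [in RHS]mxE coefXM [in RHS]mxE coef_drop_poly.
  case: eqP => [->|hi]; first by rewrite g1E -mulrA a01 mulr1 subrr.
  by congr (_`_ _); lia.
exists (psi g'); split; last first.
  have -> : psi g' *m D = psi ('X *: g').
    by rewrite psiZ -[X in dact X]expr1 actXn expr1.
  by rewrite -g1X psiB psi_lam subr0.
exists g'; split=> // [j|j i]; rewrite mxE.
  apply/leq_sizeP => i hi; rewrite coef_drop_poly g1E.
  have -> : lam`_(i + 1) = 0 by rewrite nth_default ?szl ?addn1.
  have -> : (g 0 j)`_(i + 1) = 0.
    by rewrite nth_default // (leq_trans (s j)) // (leq_trans hi) ?leq_addr.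
  by rewrite mulr0 subr0.
rewrite coef_drop_poly g1E addn1; apply: qgeB.
  by apply: qgeW (b j i.+1); rewrite (_ : i.+1%:Z = i%:Z + 1) ?mulrDr ?mulr1; lia.
have qa0 : qge n a0 (n%:Z * h) by apply/(@vge_qge K n n0); rewrite -[h]opprK.
have := qgeM n0 (qgeM n0 (b j 0%N) qa0) (@lamq i.+1); apply: qgeW.
rewrite (_ : i.+1%:Z = i%:Z + 1) ?mulrDr ?mulr1 ?mulr0; nia.
Qed.

End Lattices.

Hypothesis d0 : (0 < d)%N.

(** Degree 0 would mean lam = 1, hence V = 0. *)
Lemma size_lam : exists n, size lam = n.+2.
Proof.
have mz := monic_l z.
have : (0 < size lam)%N by rewrite lt0n size_poly_eq0 monic_neq0.
case e : (size lam) => [//|[|n]] _; last by exists n.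
have l1 : lam = 1.
  rewrite (size1_polyC (eq_leq e)); move: mz; rewrite monicE /lead_coef e.
  by move/eqP => ->.
have /(congr1 (fun M : 'rV[L]_d => M 0 (Ordinal d0))) /eqP :=
  psi_all0 (delta_mx 0 (Ordinal d0)) l1.
by rewrite !mxE !eqxx oner_eq0.
Qed.

(* Applying [newton_bound] to [D] and to its inverse bounds all coefficients of
   [lam] by the segment from [(0, v(lam_0))] to [(n, 0)]. *)
Lemma one_edge_of_growth (u v : nat) : (0 < u)%N ->
  (exists C, forall x j A, vqge u x A -> vqge u (x *m D ^+ j) (A - v%:Z * j%:Z - C)) ->
  (exists C, forall x j A, vqge u (x *m D ^+ j) A -> vqge u x (A + v%:Z * j%:Z - C)) ->
  np_one_edge (lp_of lam) (v%:R / u%:R).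
Proof.
move=> u0 [C1 B1] [C2 B2]; have [n0 szl] := size_lam; set n := n0.+1 in szl.
have ln : lam`_n = 1 by have := monic_l z; rewrite monicE /lead_coef szl => /eqP.
have [w [w0 vw]] := lead_ex lam0_neq0.
have low : wge u v lam (- (v%:Z * n%:Z)).
  have := @newton_bound _ _ u v u0 _ D C1 B1 lam n 0 gen szl.
  rewrite mulr0 sub0r; apply; first by rewrite ln; exact: vge1.
    exact: act_gen_lam.
  by move=> f hf; apply: gen_indep; rewrite szl.
have B2' x j A : vqge u x A -> vqge u (x *m X ^+ j) (A - (- v%:Z) * j%:Z - C2).
  by move=> hx; rewrite mulNr opprK; apply: (B2 _ j); rewrite mulmxXn_D.
(* Up to a power of t, the reversed polynomial is [lam] with t replaced by its inverse; it
   annihilates [gen] when t acts as [X]. *)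
pose rl : {poly L} := \poly_(i < n.+1) lam`_(n - i).
have srl : size rl = n.+1.
  by apply: size_poly_eq; rewrite subnn; apply/eqP; apply: lam0_neq0.
have actX (f : {poly L}) m : (size f <= m.+1)%N ->
    act X f gen *m D ^+ m = dact (\poly_(i < m.+1) f`_(m - i)) gen.
  move=> hf; rewrite (actE _ _ hf) (@actE _ _ _ m.+1) ?size_poly //.
  rewrite mulmx_suml (reindex_inj rev_ord_inj) /=; apply: eq_bigr => i _.
  have hi : (i <= m)%N by rewrite -ltnS.
  rewrite coef_poly ltn_ord subSS -scalemxAl; congr (_ *: _).
  rewrite -[in D ^+ m](subnK hi) exprD -mulmxE mulmxA; congr (_ *m _).
  exact: mulmxXn_D.
have up : wge u (- v%:Z) rl (u%:Z * w + v%:Z * n%:Z).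
  have := @newton_bound _ _ u (- v%:Z) u0 _ X C2 B2' rl n w gen srl.
  rewrite mulNr opprK; apply.
  - by rewrite coef_poly ltnSn subnn.
  - rewrite -(mulmxDn_X (act X rl gen) n) actX ?srl //.
    rewrite (_ : \poly_(i < n.+1) rl`_(n - i) = lam) ?act_gen_lam ?mul0mx //.
    apply/polyP => i; rewrite coef_poly; case: ltnP => hi.
      rewrite coef_poly ifT; last by rewrite ltnS leq_subr.
      by rewrite subKn.
    by rewrite nth_default ?szl.
  move=> f hf f0; have hf' : (size f <= n0.+1)%N by [].
  have := actX f n0 hf'; rewrite f0 mul0mx => /esym /gen_indep h.
  have {h} h : \poly_(i < n0.+1) f`_(n0 - i) = 0.
    by apply: h; rewrite szl ltnS size_poly.
  apply/polyP => i; rewrite coef0; case: (leqP n0.+1 i) => hi.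
    by rewrite nth_default // (leq_trans hf').
  have := congr1 (fun p : {poly L} => p`_(n0 - i)) h; rewrite coef_poly coef0.
  rewrite ifT; last by rewrite ltnS leq_subr.
  by rewrite subKn.
(* [low] at index 0, and [up] at the constant coefficient lam_n = 1 of [rl], are opposite
   inequalities for w = v(lam_0). *)
have wE : u%:Z * w = - (v%:Z * n%:Z).
  apply/eqP; rewrite eq_le; apply/andP; split.
    rewrite leNgt; apply/negP => h; have := up 0%N 0.
    rewrite coef_poly subn0 ln !mulr0 addr0 => e.
    have /eqP : (1 : L) 0 = 0 by apply: e; lia.
    by rewrite coefz1 eqxx oner_eq0.
  rewrite leNgt; apply/negP => h; have := low 0%N w; rewrite mulr0 addr0 => e.
  by move: w0; rewrite e ?eqxx //; lia.
exists 0%N, n, w, 0; split=> //; split; first by split=> //; apply/eqP.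
split.
  by rewrite /lp_of ln; split; [apply/eqP; rewrite coefz1 eqxx oner_eq0|exact: vge1].
split=> //; split.
  by move=> i hi; rewrite /lp_of nth_default ?szl //.
have uQ : (u%:R : rat) != 0 by rewrite pnatr_eq0 -lt0n.
have nQ : (n%:R : rat) != 0 by rewrite pnatr_eq0.
have wQ : (w%:~R : rat) = - (v%:R * n%:R / u%:R).
  have := congr1 (fun a : int => a%:~R : rat) wE.
  rewrite !rmorphN !rmorphM /= -!pmulrn => e.
  by apply: (mulfI uQ); rewrite e mulrN mulrCA divff // mulr1.
split.
  by rewrite subn0 sub0r rmorphN /= wQ opprK; field; rewrite uQ nQ.
move=> i b [nb hb]; have := low i b; rewrite subr0 => e.
have hlow : - (v%:Z * n%:Z) + v%:Z * i%:Z <= u%:Z * b.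
  by rewrite leNgt; apply/negP => /e; apply: nb.
rewrite wQ; have : ((- (v%:Z * n%:Z) + v%:Z * i%:Z)%:~R : rat) <= (u%:Z * b)%:~R.
  by rewrite ler_int.
rewrite rmorphD rmorphN !rmorphM /= -!pmulrn => h.
have u0Q : (0 : rat) < u%:R by rewrite ltr0n.
rewrite -(ler_pM2l u0Q); apply: le_trans h; rewrite le_eqVlt; apply/orP; left.
by apply/eqP; field.
Qed.


End Structure.

(** * The t-motive inside K((sigma))^d *)

Section Constants.
Variables (K : fieldType) (phi : twist K).
Local Notation L := (lser phi).

Definition cst (c : K) : L := mono phi c 0.
Lemma cst_is_zmod_morphism : zmod_morphism cst.
Proof.
move=> a b; apply: lserext => k; rewrite coefzB !coef_mono.
by case: eqP; rewrite ?subr0.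
Qed.
Lemma cst_is_monoid_morphism : monoid_morphism cst.
Proof. by split=> // a b; rewrite monoM addr0 tw0id. Qed.
HB.instance Definition _ := GRing.isZmodMorphism.Build K L cst cst_is_zmod_morphism.
HB.instance Definition _ := GRing.isMonoidMorphism.Build K L cst cst_is_monoid_morphism.

Lemma coef_cst c k : cst c k = if k == 0 then c else 0. Proof. by []. Qed.
Lemma cst_mul c (f : L) k : (cst c * f) k = c * f k.
Proof. by rewrite mono_mul subr0 tw0id. Qed.
Lemma cst_inj : injective cst.
Proof.
by move=> a b /(congr1 (fun f : L => f 0)); rewrite !coef_cst eqxx.
Qed.
Lemma vge_cst c : vge (cst c) 0. Proof. exact: vge_mono. Qed.
Lemma qge_cst u c : (0 < u)%N -> qge u (cst c) 0.
Proof. by move=> u0; rewrite -[0](mulr0 u%:Z); apply/(@vge_qge K u u0); exact: vge_cst. Qed.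

Definition polyL (f : {poly K}) : {poly L} := map_poly cst f.
Lemma size_polyL f : size (polyL f) = size f.
Proof. by rewrite size_map_inj_poly ?rmorph0 //; exact: cst_inj. Qed.
Lemma coef_polyL f i : (polyL f)`_i = cst f`_i.
Proof. by rewrite coef_map. Qed.

End Constants.

Section Generators.
Variables (K : fieldType) (phi : twist K) (d : nat) (T : 'M[lser phi]_d).
Local Notation L := (lser phi).
Local Notation polyL := (polyL phi).
Local Notation sg n := (mono phi 1 n).

Implicit Types (x : 'rV[L]_d).
(** K{tau} sits in K((sigma)) as the series without positive powers of sigma. *)
Definition inM x := forall j k, 0 < k -> x 0 j k = 0.

Lemma inM0 : inM 0. Proof. by move=> j k _; rewrite mxE. Qed.
Lemma inMD x y : inM x -> inM y -> inM (x + y).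
Proof. by move=> hx hy j k hk; rewrite mxE coefzD hx ?hy ?addr0. Qed.
Lemma inMN x : inM x -> inM (- x).
Proof. by move=> hx j k hk; rewrite mxE coefzN hx ?oppr0. Qed.
Lemma inMB x y : inM x -> inM y -> inM (x - y).
Proof. by move=> hx hy; apply/inMD/inMN. Qed.
Lemma inM_sum I r (P : pred I) (F : I -> 'rV[L]_d) :
  (forall i, P i -> inM (F i)) -> inM (\sum_(i <- r | P i) F i).
Proof. by move=> H; apply: big_ind => //; [exact: inM0|exact: inMD]. Qed.
Lemma inM_cst c x : inM x -> inM (cst phi c *: x).
Proof. by move=> hx j k hk; rewrite mxE cst_mul hx ?mulr0. Qed.
Lemma inM_tau x (n : nat) : inM x -> inM (mono phi 1 (- n%:Z) *: x).
Proof. by move=> hx j k hk; rewrite mxE mono_mul mul1r hx ?tw_0 //; lia. Qed.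
Lemma inM_delta i : inM (delta_mx 0 i).
Proof.
move=> j k hk; rewrite mxE; case: (_ && _); rewrite ?coefz0 // coefz1.
by have -> : (k == 0) = false by lia.
Qed.

Lemma inM_split x : exists m, inM m /\ forall j, vge ((x - m) 0 j) 1.
Proof.
have sub j : vge (fun k => if k <= 0 then x 0 j k else 0) (- `|projT1 (cid (vge_ex (x 0 j)))|).
  move=> k hk; case: ifP => // _; apply: (projT2 (cid (vge_ex (x 0 j)))).
  by move: (projT1 _) hk => A; lia.
exists (\row_j mkser phi (sub j)); split.
  by move=> j k hk; rewrite mxE /= /mkser /coefz ifF //; lia.
by move=> j k hk; rewrite !mxE coefzB /mkser /coefz /= ifT ?subrr //; lia.
Qed.

Lemma inM_expand x B : inM x -> (forall j, vge (x 0 j) (- B%:Z + 1)) ->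
  x = \sum_j \sum_(i < B) cst phi (x 0 j (- i%:Z)) *: (sg (- i%:Z) *: delta_mx 0 j).
Proof.
move=> hx hB; rewrite {1}(row_sum_delta x); apply: eq_bigr => j _.
under eq_bigr => i _ do rewrite scalerA.
rewrite -scaler_suml; congr (_ *: _); apply: lserext => k; rewrite coefz_sum.
under eq_bigr => i _ do rewrite monoM tw1 mulr1 add0r coef_mono.
case: (boolP ((- B%:Z < k) && (k <= 0))) => hk.
  have hi : (absz k < B)%N by lia.
  have kE : k = - (Ordinal hi : nat)%:Z by rewrite /=; lia.
  rewrite (bigD1 (Ordinal hi)) //= -kE eqxx big1 ?addr0 // => i ni.
  rewrite ifF //; apply/negP => /eqP e; case/eqP: ni; apply: val_inj => /=; lia.
rewrite big1.
  case: (ltP 0 k) => hk0; first exact: hx.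
  by apply: hB; lia.
by move=> i _; rewrite ifF //; have := ltn_ord i; lia.
Qed.

Definition lin r (fs : 'I_r -> {poly K}) (E : 'I_r -> 'rV[L]_d) :=
  \sum_l act T (polyL (fs l)) (E l).

Lemma linD r (fs gs : 'I_r -> {poly K}) E :
  lin (fun l => fs l + gs l) E = lin fs E + lin gs E.
Proof.
rewrite /lin -big_split; apply: eq_bigr => l _ /=.
by rewrite /polyL rmorphD actD.
Qed.
Lemma linZ r c (fs : 'I_r -> {poly K}) E :
  lin (fun l => c *: fs l) E = cst phi c *: lin fs E.
Proof.
rewrite /lin scaler_sumr; apply: eq_bigr => l _ /=.
by rewrite /polyL map_polyZ actZ.
Qed.
Lemma linXn r n (fs : 'I_r -> {poly K}) E :
  lin (fun l => 'X^n * fs l) E = lin fs E *m T ^+ n.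
Proof.
rewrite /lin mulmx_suml; apply: eq_bigr => l _ /=.
by rewrite /polyL rmorphM /= map_polyXn actXnM.
Qed.

Definition genV r (E : 'I_r -> 'rV[L]_d) :=
  (forall l, inM (E l)) /\ forall x, inM x -> exists fs, x = lin fs E.


Hypothesis inMT : forall x, inM x -> inM (x *m T).

Lemma inMTn x i : inM x -> inM (x *m T ^+ i).
Proof.
move=> hx; elim: i => [|i IH]; first by rewrite expr0 mulmx1.
by rewrite exprSr -mulmxE mulmxA; apply: inMT.
Qed.
Lemma inM_act f x : inM x -> inM (act T (polyL f) x).
Proof.
move=> hx; apply: inM_sum => i _; rewrite coef_polyL.
by apply: inM_cst; apply: inMTn.
Qed.


End Generators.

Section Motive.
Variables (K : fieldType) (q : nat) (qroot : K -> K) (phi : twist K).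
Hypothesis phiE : forall a x, phi a x = frob_int q qroot (- a) x.
Local Notation L := (lser phi).
Local Notation tau_ls := (tau_ls phi).

Lemma coef_tau_ls p k : tau_ls p k = if k <= 0 then p`_(absz k) else 0.
Proof. by []. Qed.
Lemma coef_tau_lsN p (n : nat) : tau_ls p (- n%:Z) = p`_n.
Proof. by rewrite coef_tau_ls ifT; [congr (_`_ _)|]; lia. Qed.

Lemma tau_lsD p p' : tau_ls (p + p') = tau_ls p + tau_ls p'.
Proof.
apply: lserext => k; rewrite coefzD !coef_tau_ls coefD.
by case: ifP; rewrite ?addr0.
Qed.
Lemma tau_ls0 : tau_ls 0 = 0.
Proof. by apply: lserext => k; rewrite coef_tau_ls coef0 if_same. Qed.
Lemma tau_ls_sum I r (P : pred I) (F : I -> {poly K}) :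
  tau_ls (\sum_(i <- r | P i) F i) = \sum_(i <- r | P i) tau_ls (F i).
Proof. exact: (big_morph tau_ls tau_lsD tau_ls0). Qed.
Lemma tau_lsZ c p : tau_ls (c *: p) = cst phi c * tau_ls p.
Proof.
apply: lserext => k; rewrite cst_mul !coef_tau_ls coefZ.
by case: ifP; rewrite ?mulr0.
Qed.
Lemma tau_ls_inj : injective tau_ls.
Proof.
move=> p p' h; apply/polyP => n; rewrite -!coef_tau_lsN.
by rewrite h.
Qed.
Lemma tau_ls_onto (f : L) : (forall k, 0 < k -> f k = 0) -> exists p, f = tau_ls p.
Proof.
move=> h; have [A hA] := vge_ex f; pose N := (absz A).+1.
exists (\poly_(i < N) f (- i%:Z)); apply: lserext => k; rewrite coef_tau_ls.
case: ifP => hk; last by apply: h; lia.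
rewrite coef_poly; case: ltnP => hN; first by congr (f _); lia.
by rewrite hA //; lia.
Qed.

(** The cut-off [size a + size b] loses nothing: beyond it one factor of each term vanishes. *)
Lemma coef_skmul (a b : {poly K}) n :
  (skmul q a b)`_n = \sum_(i < n.+1) a`_i * b`_(n - i) ^+ (q ^ i).
Proof.
rewrite coef_poly; case: ltnP => // hn; rewrite big1 // => i _.
case: (ltnP i (size a)) => hi; last by rewrite nth_default ?mul0r.
rewrite [b`__]nth_default; last by move: hn hi; set sa := size a; set sb := size b; lia.
by have := @tw_0 _ phi (- i%:Z); rewrite phiE opprK /= => ->; rewrite mulr0.
Qed.

Lemma tau_lsM (a b : {poly K}) : tau_ls (skmul q a b) = tau_ls a * tau_ls b.
Proof.
apply: lserext => k; rewrite coefzM coef_tau_ls /convz; case: ifP => hk; last first.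
  rewrite (@fsumE _ _ [::]) ?big_nil //; split=> // c _.
  rewrite !coef_tau_ls; case: ifP => hc; last by rewrite mul0r.
  by rewrite ifF ?tw_0 ?mulr0 //; lia.
have [n {hk}->] : exists n : nat, k = - n%:Z by exists (absz k); lia.
rewrite abszN absz_nat coef_skmul.
rewrite (@fsumE _ _ [seq - i%:Z | i <- iota 0 n.+1]).
  rewrite big_map -[n.+1 in RHS]subn0 -/(index_iota 0 n.+1) big_mkord.
  apply: eq_bigr => i _ /=; rewrite coef_tau_lsN phiE opprK.
  have -> : - n%:Z + i%:Z = - (n - i)%N%:Z by have := ltn_ord i; lia.
  by rewrite coef_tau_lsN.
split; first by rewrite map_inj_uniq ?iota_uniq // => i j /oppr_inj [].
move=> c hc; rewrite !coef_tau_ls; case: ifP => hc0; last by rewrite mul0r.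
case: ifP => hc1; last by rewrite tw_0 mulr0.
case/negP: hc; apply/mapP; exists (absz c); last by lia.
by rewrite mem_iota; lia.
Qed.

Lemma tau_lsX : tau_ls 'X = mono phi 1 (- 1).
Proof.
apply: lserext => k; rewrite coef_tau_ls coef_mono coefX.
case: ifP => hk; last by rewrite ifF //; lia.
have -> : (absz k == 1)%N = (k == -1) by lia.
by case: eqP.
Qed.

Variable d : nat.
Definition toV (m : Mot K d) : 'rV[L]_d := \row_j tau_ls (m j).
Lemma toV_inM m : inM (toV m).
Proof. by move=> j k hk; rewrite mxE coef_tau_ls ifF //; lia. Qed.
Lemma toV_inj : injective toV.
Proof.
move=> m m' h; apply/funext => j; apply: tau_ls_inj.
by move/rowP: h => /(_ j); rewrite !mxE.
Qed.
Lemma toV_onto x : inM x -> exists m, x = toV m.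
Proof.
move=> hx; have /choice [m hm] : forall j, exists p, x 0 j = tau_ls p.
  by move=> j; apply: tau_ls_onto; apply: hx.
by exists m; apply/rowP => j; rewrite mxE.
Qed.

Variable D : 'I_d -> 'I_d -> {poly K}.
Local Notation T := (skew_mx phi D).

Lemma toV_t m : toV (mot_t q D m) = toV m *m T.
Proof.
apply/rowP => j; rewrite !mxE tau_ls_sum; apply: eq_bigr => k _.
by rewrite !mxE tau_lsM.
Qed.
Lemma toV_tau m : toV (mot_tau q m) = mono phi 1 (- 1) *: toV m.
Proof. by apply/rowP => j; rewrite !mxE tau_lsM tau_lsX. Qed.
Lemma toV_iter_t i m : toV (iter i (mot_t q D) m) = toV m *m T ^+ i.
Proof.
elim: i => [|i IH] /=; first by rewrite expr0 mulmx1.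
by rewrite toV_t IH exprSr -mulmxE mulmxA.
Qed.
Lemma toV_scal f m : toV (mot_scal q D f m) = act T (polyL phi f) (toV m).
Proof.
apply/rowP => j; rewrite mxE tau_ls_sum /act size_polyL summxE.
by apply: eq_bigr => i _; rewrite coef_polyL tau_lsZ -toV_iter_t !mxE.
Qed.

Lemma toV_lin r fs (e : 'I_r -> Mot K d) :
  toV (mot_lin q D fs e) = lin T fs (fun l => toV (e l)).
Proof.
apply/rowP => j; rewrite mxE tau_ls_sum /lin summxE; apply: eq_bigr => l _.
by rewrite -toV_scal mxE.
Qed.

Lemma inM_t x : inM x -> inM (x *m T).
Proof. by move=> /toV_onto [m ->]; rewrite -toV_t; apply: toV_inM. Qed.

Lemma fingen_genV : mot_fingen q D -> exists r (E : 'I_r -> 'rV[L]_d), genV T E.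
Proof.
move=> [r [e he]]; exists r, (fun l => toV (e l)); split=> [l|x /toV_onto [m ->]].
  exact: toV_inM.
by have [fs ->] := he m; exists fs; rewrite toV_lin.
Qed.

Definition basisV r (E : 'I_r -> 'rV[L]_d) :=
  genV T E /\ forall fs fs', lin T fs E = lin T fs' E -> fs = fs'.

Lemma mot_basis_toV r (e : 'I_r -> Mot K d) :
  mot_basis q D e <-> basisV (fun l => toV (e l)).
Proof.
split=> [h|[[_ hs] hu] m].
  split; first split=> [l|x /toV_onto [m ->]]; first exact: toV_inM.
    by have [fs [-> _]] := h m; exists fs; rewrite toV_lin.
  move=> fs fs' e0; have [gs [_ hg]] := h (mot_lin q D fs e).
  rewrite -(hg fs) // -(hg fs') //; apply: toV_inj.
  by rewrite !toV_lin.
have [fs hfs] := hs _ (toV_inM m); exists fs; split.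
  by apply: toV_inj; rewrite toV_lin.
by move=> fs' e0; apply: hu; rewrite -hfs e0 toV_lin.
Qed.

Lemma actX0 f x : act T (polyL phi f) x =
  cst phi f`_0 *: x + act T (polyL phi (drop_poly 1 f)) x *m T.
Proof.
have -> : polyL phi f = cst phi f`_0 *: 'X^0 + 'X^1 * polyL phi (drop_poly 1 f).
  apply/polyP => i; rewrite coefD coefZ expr0 coef1 coefXM !coef_polyL coef_drop_poly.
  by case: i => [|i] /=; rewrite ?mulr1 ?addr0 // mulr0 add0r addn1.
by rewrite actD actZ actXn actXnM expr0 mulmx1 expr1.
Qed.

(* As [M / tM] is finite dimensional, some nonzero element of [K{tau}] sends a
   given basis vector into [tM]; it is invertible in [K((sigma))]. *)
Lemma skew_mx_left_inverse : mot_fingen q D -> exists X, X *m T = 1%:M.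
Proof.
move=> /fingen_genV [r [E [hE hspan]]].
suff /choice [X hX] : forall i : 'I_d, exists y : 'rV[L]_d, y *m T = delta_mx 0 i.
  exists (\matrix_(i, j) X i 0 j); apply/row_matrixP => i.
  rewrite row_mul row1 -hX; congr (_ *m _).
  by apply/rowP => j; rewrite !mxE.
move=> i.
have /choice [fs hfs] : forall a : 'I_r.+1, exists fs,
    mono phi 1 (- a%:Z) *: delta_mx 0 i = lin T fs E.
  by move=> a; apply: hspan; apply: inM_tau; apply: inM_delta.
(* Row [a] expresses tau^a e_i modulo tM through the r generators; r + 1 rows in K^r are
   dependent. *)
pose B : 'M[K]_(r.+1, r) := \matrix_(a, l) (fs a l)`_0.
have : kermx B != 0.
  rewrite kermx_eq0; apply/negP => /eqP hr.
  by have := rank_leq_col B; rewrite hr ltnn.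
move=> /rowV0Pn [al /sub_kermxP hal nz].
pose u : L := \sum_a mono phi (al 0 a) (- a%:Z).
pose y : 'rV[L]_d := \sum_a cst phi (al 0 a) *:
  (\sum_l act T (polyL phi (drop_poly 1 (fs a l))) (E l)).
have e1 : u *: delta_mx 0 i = y *m T.
  rewrite /u scaler_suml /y mulmx_suml.
  transitivity (\sum_a (\sum_l (cst phi (al 0 a * B a l)) *: E l +
     cst phi (al 0 a) *: (\sum_l act T (polyL phi (drop_poly 1 (fs a l))) (E l)) *m T)).
    apply: eq_bigr => a _.
    have -> : mono phi (al 0 a) (- a%:Z) = cst phi (al 0 a) * mono phi 1 (- a%:Z).
      by rewrite monoM tw1 mulr1 add0r.
    rewrite -scalerA hfs /lin -scalemxAl mulmx_suml !scaler_sumr -big_split /=.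
    apply: eq_bigr => l _; rewrite actX0 scalerDr scalerA mxE; congr (_ *: _ + _).
    by rewrite -rmorphM.
  rewrite big_split /= exchange_big /= big1 ?add0r // => l _.
  rewrite -scaler_suml -rmorph_sum; have := congr1 (fun M : 'rV[K]_r => M 0 l) hal.
  by rewrite !mxE => ->; rewrite rmorph0 scale0r.
have [w [nw hw]] : exists w, u w != 0 /\ vge u w.
  apply: lead_ex => u0; case/eqP: nz; apply/rowP => a; rewrite mxE.
  have := congr1 (fun f : L => f (- a%:Z)) u0; rewrite coefz_sum coefz0.
  rewrite (bigD1 a) //= coef_mono eqxx big1 ?addr0 // => b nb.
  rewrite coef_mono ifF //; apply/negP => /eqP /oppr_inj [] eab.
  by case/eqP: nb; apply: val_inj.
have [g [_ gu _]] := lser_inv nw hw.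
exists (g *: y); rewrite -scalemxAl -e1 scalerA gu scale1r //.
Qed.

End Motive.

(** * Linear algebra over K and K[t] *)

Section LinearAlgebra.
Variable K : fieldType.

Lemma linear_inj_dim a m b n (F : 'M[K]_(a, m) -> 'M[K]_(b, n)) :
  linear F -> (forall A, F A = 0 -> A = 0) -> (a * m <= b * n)%N.
Proof.
move=> lF injF.
pose F' : {linear 'M[K]_(a, m) -> 'M[K]_(b, n)} :=
  HB.pack F (GRing.isLinear.Build _ _ _ _ F lF).
rewrite leqNgt; apply/negP => hlt.
have : kermx (lin_mx F') != 0.
  rewrite kermx_eq0; apply/negP => /eqP hr.
  by have := rank_leq_col (lin_mx F'); rewrite hr leqNgt hlt.
move=> /rowV0Pn [v /sub_kermxP hv nz]; case/eqP: nz.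
move: hv; rewrite mul_rV_lin => /(congr1 vec_mx); rewrite mxvecK linear0.
by move/injF/(congr1 mxvec); rewrite vec_mxK linear0.
Qed.

(** Adjoining a vector of [P] outside the row space raises the rank, which cannot exceed N. *)
Lemma subspace_generators N (P : 'rV[K]_N -> Prop) :
  exists m (G : 'M[K]_(m, N)), (forall l, P (row l G)) /\
    forall x, P x -> (x <= G)%MS.
Proof.
suff H k m (G : 'M[K]_(m, N)) : (N - \rank G <= k)%N -> (forall l, P (row l G)) ->
    exists m (G : 'M[K]_(m, N)), (forall l, P (row l G)) /\
    forall x, P x -> (x <= G)%MS.
  by apply: (H N 0%N 0); [rewrite leq_subr|case].
elim: k m G => [|k IH] m G hk hG.
  exists m, G; split=> // x _; apply: submx_full.
  by rewrite /row_full eqn_leq rank_leq_col -subn_eq0 -leqn0.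
case: (pselect (forall x, P x -> (x <= G)%MS)) => [h|]; first by exists m, G.
move=> /existsNP [x /not_implyP [Px /negP nx]].
apply: (IH _ (col_mx x G)); last first.
  move=> l; case: (split_ordP l) => j ->.
    by rewrite rowKu (_ : row j x = x) // ; apply/rowP => c; rewrite mxE ord1.
  by rewrite rowKd.
have : (\rank G < \rank (col_mx x G))%N.
  rewrite ltnNge; apply/negP => hle; case/negP: nx.
  apply: submx_trans (_ : (x <= x + G)%MS) _; first exact: addsmxSl.
  have : (G == x + G)%MS by rewrite -(geq_leqif (mxrank_leqif_eq (addsmxSr x G))) addsmxE.
  by move/eqmxP => ->.
by lia.
Qed.

Section Freeness.
Variables (V : zmodType) (sc : {poly K} -> V -> V).
Hypotheses (scDr : forall f x y, sc f (x + y) = sc f x + sc f y).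
Hypotheses (scDl : forall f g x, sc (f + g) x = sc f x + sc g x).
Hypotheses (scM : forall f g x, sc (f * g) x = sc f (sc g x)).
Variable P : V -> Prop.
Hypotheses (PD : forall x y, P x -> P y -> P (x + y)).
Hypotheses (Psc : forall f x, P x -> P (sc f x)).
Hypothesis torsion_free : forall f x, P x -> sc f x = 0 -> f != 0 -> x = 0.

Definition lc r (fs : 'I_r -> {poly K}) (E : 'I_r -> V) := \sum_l sc (fs l) (E l).
Definition gens r (E : 'I_r -> V) :=
  (forall l, P (E l)) /\ forall x, P x -> exists fs, x = lc fs E.

Lemma sc0 x : sc 0 x = 0.
Proof. by apply: (addrI (sc 0 x)); rewrite -scDl !addr0. Qed.
Lemma sc0r f : sc f 0 = 0.
Proof. by apply: (addrI (sc f 0)); rewrite -scDr !addr0. Qed.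
Lemma scN f x : sc (- f) x = - sc f x.
Proof. by apply: (addrI (sc f x)); rewrite -scDl !subrr sc0. Qed.

(* Euclid's algorithm: a relation among a generating family of minimal length
   can be shortened by a change of generators. *)
Lemma minimal_gens_indep r : (forall r' (E : 'I_r' -> V), gens E -> (r <= r')%N) ->
  forall N (E : 'I_r -> V) (fs : 'I_r -> {poly K}), gens E -> (\sum_l size (fs l) <= N)%N ->
    lc fs E = 0 -> forall l, fs l = 0.
Proof.
case: r => [_ ? ? ? _ _ _ []//|r] rmin.
elim=> [|N IH] E fs gE hN rel l.
  have : (size (fs l) <= 0)%N by apply: leq_trans hN; rewrite (bigD1 l) //= leq_addr.
  by rewrite leqn0 size_poly_eq0 => /eqP.
apply/eqP/negP => /negP nl.
have [[j [nj hj]]|none] := pselect (exists j, j != l /\ fs j != 0); last first.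
  (* A relation with a single nonzero coefficient kills its generator by torsion-freeness, and that
     generator could be dropped. *)
  have El : E l = 0.
    apply: torsion_free nl; first by case: gE.
    move: rel; rewrite /lc (bigD1 l) //= big1 ?addr0 // => j nj.
    case: (eqVneq (fs j) 0) => [->|hj]; first exact: sc0.
    by case: none; exists j.
  have : gens (fun k => E (lift l k)).
    case: gE => PE sE; split=> [k|x /sE [gs ->]]; first exact: PE.
    exists (fun k => gs (lift l k)); rewrite /lc (bigD1_ord l) //= El sc0r add0r.
    by [].
  by move/rmin; rewrite ltnn.
wlog hsz : l j nl nj hj / (size (fs j) <= size (fs l))%N.
  move=> H; case: (leqP (size (fs j)) (size (fs l))) => hs; first exact: H hs.
  by apply: (H j l) => //; [rewrite eq_sym|rewrite ltnW].
(* Replacing E_j by E_j + qq E_l turns the coefficient of E_l into its remainder modulo fs_j: the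
   total size drops while fs_j stays nonzero. *)
pose qq := fs l %/ fs j.
pose E' k := if k == j then E j + sc qq (E l) else E k.
pose fs' k := if k == l then fs l %% fs j else fs k.
have lj : l != j by rewrite eq_sym.
have key (gs : 'I_r.+1 -> {poly K}) :
    lc (fun k => if k == l then gs l - gs j * qq else gs k) E' = lc gs E.
  rewrite /lc (bigD1 l) //= (bigD1 j) //= [RHS](bigD1 l) //= [in RHS](bigD1 j) //=.
  rewrite /E' eqxx (negPf lj) (negPf nj) eqxx !addrA; congr (_ + _).
    by rewrite scDl scN scDr -scM addrCA -!addrA addNr addr0 addrC.
  apply: eq_bigr => k /andP [kl kj]; by rewrite (negPf kl) (negPf kj).
have gE' : gens E'.
  case: gE => PE sE; split=> [k|x /sE [gs ->]].
    by rewrite /E'; case: eqP => // _; apply: PD => //; apply: Psc.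
  by exists (fun k => if k == l then gs l - gs j * qq else gs k); rewrite key.
have fs'E : fs' = fun k => if k == l then fs l - fs j * qq else fs k.
  apply/funext => k; rewrite /fs'; case: eqP => // _.
  by apply/esym/eqP; rewrite subr_eq addrC [fs j * _]mulrC -divp_eq.
have : fs' j = 0.
  apply: (IH E' fs' gE'); last by rewrite fs'E key.
  rewrite -ltnS; apply: leq_trans hN.
  rewrite (bigD1 l) //= [X in (_ <= X)%N](bigD1 l) //= /fs' eqxx.
  have -> : (\sum_(i < r.+1 | i != l) size (if i == l then fs l %% fs j else fs i)%R =
             \sum_(i < r.+1 | i != l) size (fs i))%N.
    by apply: eq_bigr => k /negPf ->.
  rewrite ltn_add2r; apply: leq_trans hsz; exact: ltn_modpN0.
by rewrite /fs' (negPf nj) => /eqP; rewrite (negPf hj).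
Qed.

Lemma free_of_torsion_free : (exists r (E : 'I_r -> V), gens E) ->
  exists r (E : 'I_r -> V), gens E /\ forall fs, lc fs E = 0 -> forall l, fs l = 0.
Proof.
move=> [r0 [E0 g0]].
have ex : exists r, `[< exists E : 'I_r -> V, gens E >] by exists r0; apply/asboolP; exists E0.
case: (ex_minnP ex) => r /asboolP [E gE] hmin; exists r, E; split=> // fs rel.
apply: (@minimal_gens_indep r _ _ E fs gE (leqnn _) rel) => r' E' g'.
by apply: hmin; apply/asboolP; exists E'.
Qed.

End Freeness.
End LinearAlgebra.

Lemma mulzS (h : int) (i : nat) : h * i.+1%:Z = h * i%:Z + h.
Proof. by rewrite -addn1 PoszD mulrDr mulr1. Qed.

(** * The filtration of the motive attached to an edge, and the weight *)

Section Filtration.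
Variables (K : fieldType) (phi : twist K).
Local Notation L := (lser phi).
Variables (d : nat) (T : 'M[L]_d).
Hypothesis inMT : forall x, inM x -> inM (x *m T).
Implicit Types (x y : 'rV[L]_d).
Local Notation polyL := (polyL phi).
Local Notation sg n := (mono phi 1 n).

Variables (n : nat) (h : int) (lat : int -> 'rV[L]_d -> Prop).
Hypothesis n0 : (0 < n)%N.
Hypothesis latW : forall k k' x, k' <= k -> lat k x -> lat k' x.
Hypothesis lat0 : forall k, lat k 0.
Hypothesis latD : forall k x y, lat k x -> lat k y -> lat k (x + y).
Hypothesis latZ : forall (a : L) B k x, qge n a B -> lat k x -> lat (k + B) (a *: x).
Hypothesis latX : forall k x, lat k x -> lat (k - h) (x *m T).
Hypothesis latXV : forall k x, lat k x -> exists y, lat (k + h) y /\ x = y *m T.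
Hypothesis lat_low : exists c, forall x A, vqge n x A -> lat (A - c) x.
Hypothesis lat_up : exists c, forall k x, lat k x -> vqge n x (k - c).
Hypothesis T_inj : forall x, x *m T = 0 -> x = 0.
Hypothesis fingen : exists r (E : 'I_r -> 'rV[L]_d), genV T E.

Let latN k x : lat k x -> lat k (- x).
Proof.
move=> hx; rewrite -scaleN1r -[k]addr0; apply: latZ => //.
by apply: qgeN; apply: qge1.
Qed.
Let latB k x y : lat k x -> lat k y -> lat k (x - y).
Proof. by move=> hx hy; apply/latD/latN. Qed.
Let lat_sum I r (P : pred I) (F : I -> 'rV[L]_d) k :
  (forall i, P i -> lat k (F i)) -> lat k (\sum_(i <- r | P i) F i).
Proof. by move=> H; apply: big_ind => //; apply: latD. Qed.
Let lat_cst c k x : lat k x -> lat k (cst phi c *: x).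
Proof. by move=> hx; rewrite -[k]addr0; apply: latZ => //; apply: qge_cst. Qed.
Let lat_sg a k x : lat k x -> lat (k + n%:Z * a) (sg a *: x).
Proof. by move=> hx; apply: latZ => //; apply/(@vge_qge K n n0); exact: vge_mono. Qed.
Let lat_Xn i k x : lat k x -> lat (k - h * i%:Z) (x *m T ^+ i).
Proof.
move=> hx; elim: i => [|i IH]; first by rewrite expr0 mulmx1 mulr0 subr0.
rewrite exprSr -mulmxE mulmxA mulzS opprD addrA; exact: latX IH.
Qed.
Let lat_XnV i k x : lat k x -> exists y, lat (k + h * i%:Z) y /\ x = y *m T ^+ i.
Proof.
elim: i k x => [|i IH] k x hx.
  by exists x; rewrite expr0 mulmx1 mulr0 addr0.
have [y [hy ->]] := latXV hx; have [w [hw ->]] := IH _ _ hy.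
exists w; rewrite exprSr -mulmxE mulmxA; split=> //.
by apply: latW hw; rewrite mulzS; lia.
Qed.
Let lat_ex x : exists k, lat k x.
Proof.
have [c hc] := lat_low; have [A hA] := vqge_ex n0 x.
by exists (A - c); apply: hc.
Qed.
Let lat_ex_fin (I : finType) (F : I -> 'rV[L]_d) : exists k, forall i, lat k (F i).
Proof.
have [c hc] := lat_low; have [A hA] := vqge_ex_fin n0 F.
by exists (A - c) => i; apply: hc.
Qed.
Let lat_all0 x : (forall k, lat k x) -> x = 0.
Proof.
have [c hc] := lat_up => H; apply: (vqge_eq0 n0) => A.
by rewrite -[A](addrK c); apply: hc.
Qed.

(** The sign turns the decreasing family [lat] into the increasing filtration M_k. *)
Definition Mfil (k : int) x := inM x /\ lat (- k) x.

Lemma MfilW k k' x : k <= k' -> Mfil k x -> Mfil k' x.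
Proof. by move=> hk [hx hl]; split=> //; apply: latW hl; rewrite lerN2. Qed.
Lemma Mfil_Tn i k x : Mfil k x -> Mfil (k + h * i%:Z) (x *m T ^+ i).
Proof.
move=> [hx hl]; split; first exact: (inMTn inMT).
by have := lat_Xn i hl; rewrite opprD.
Qed.
Lemma Mfil_tau (i : nat) k x : Mfil k x -> Mfil (k + n%:Z * i%:Z) (sg (- i%:Z) *: x).
Proof.
move=> [hx hl]; split; first exact: inM_tau.
by have := lat_sg (- i%:Z) hl; rewrite mulrN opprD.
Qed.
Lemma Mfil_ex x : inM x -> exists k, Mfil k x.
Proof. by move=> hx; have [k hk] := lat_ex x; exists (- k); split=> //; rewrite opprK. Qed.

(** A uniform bound for the error committed by truncating an element of V to M. *)
Lemma small_lat : exists c : int, 0 <= c /\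
  forall x, (forall j, vge (x 0 j) 1) -> lat (- c) x.
Proof.
have [c hc] := lat_low; exists `|c|; split=> // x hx.
have /hc : vqge n x n%:Z.
  by move=> j; have := hx j; rewrite (@vge_qge K n n0) mulr1.
by apply: latW; lia.
Qed.

(* Up to a fixed finite-dimensional error, [t^n] and [tau^h] both map the
   [k]-th step of the filtration onto the [(k + n h)]-th one. *)
Definition filtration_shift (k1 : int) := forall k, k1 <= k -> forall x,
  Mfil (k + n%:Z * h) x ->
  (exists2 m, Mfil k m & Mfil k1 (x - m *m T ^+ n)) /\
  (exists2 m, Mfil k m & Mfil k1 (x - sg (- h) *: m)).

(** Bounded degree in tau is what makes M_k finite dimensional over K. *)
Lemma Mfil_bounded k : exists B : nat, forall x, Mfil k x ->
  forall j, vge (x 0 j) (- B%:Z + 1).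
Proof.
have [c hc] := lat_up; exists (absz (k + c)%R).+1 => x [_ /hc hx] j.
move=> a ha; apply: hx; nia.
Qed.

Definition box B (M : 'M[K]_(d, B)) : 'rV[L]_d :=
  \sum_j \sum_(i < B) cst phi (M j i) *: (sg (- i%:Z) *: delta_mx 0 j).
Lemma box_linear B a (M N : 'M[K]_(d, B)) :
  box (a *: M + N) = cst phi a *: box M + box N.
Proof.
rewrite /box scaler_sumr -big_split; apply: eq_bigr => j _ /=.
rewrite scaler_sumr -big_split; apply: eq_bigr => i _ /=.
by rewrite !mxE rmorphD rmorphM /= scalerDl -scalerA.
Qed.
Lemma box0 B : box (0 : 'M[K]_(d, B)) = 0.
Proof.
by rewrite /box big1 // => j _; rewrite big1 // => i _; rewrite mxE rmorph0 scale0r.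
Qed.
Lemma boxD B (M N : 'M[K]_(d, B)) : box (M + N) = box M + box N.
Proof. by rewrite -{1}[M]scale1r box_linear rmorph1 scale1r. Qed.
Lemma boxZ B a (M : 'M[K]_(d, B)) : box (a *: M) = cst phi a *: box M.
Proof. by rewrite -[a *: M]addr0 box_linear box0 addr0. Qed.
Lemma inM_box B (M : 'M[K]_(d, B)) : inM (box M).
Proof.
apply: inM_sum => j _; apply: inM_sum => i _; apply: inM_cst.
by apply: inM_tau; apply: inM_delta.
Qed.
Lemma inM_boxE x B : inM x -> (forall j, vge (x 0 j) (- B%:Z + 1)) ->
  x = box (\matrix_(j < d, i < B) x 0 j (- i%:Z)).
Proof.
move=> hx hB; rewrite {1}(inM_expand hx hB); apply: eq_bigr => j _.
by apply: eq_bigr => i _; rewrite mxE.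
Qed.
Lemma box_inj B (M : 'M[K]_(d, B)) : box M = 0 -> M = 0.
Proof.
move=> e; apply/matrixP => j i; rewrite mxE.
have := congr1 (fun x : 'rV[L]_d => x 0 j (- i%:Z)) e.
rewrite /= mxE coefz0 summxE coefz_sum (bigD1 j) //= [X in _ + X]big1 ?addr0.
  rewrite summxE coefz_sum (bigD1 i) //= [X in _ + X]big1 ?addr0.
    by rewrite !mxE !eqxx mulr1 cst_mul coef_mono eqxx mulr1.
  move=> i' ni; rewrite !mxE !eqxx mulr1 cst_mul coef_mono ifF ?mulr0 //.
  by apply/negP => /eqP e'; case/eqP: ni; apply: val_inj => /=; lia.
move=> j' nj; rewrite summxE coefz_sum big1 // => i' _.
by rewrite !mxE eqxx eq_sym (negPf nj) !mulr0 coefz0.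
Qed.

Lemma Mfil_generators k : exists m (g : 'I_m -> 'rV[L]_d),
  (forall l, Mfil k (g l)) /\
  forall x, Mfil k x -> exists c : 'I_m -> K, x = \sum_l cst phi (c l) *: g l.
Proof.
have [B hB] := Mfil_bounded k.
have [m [G [hG1 hG2]]] := subspace_generators
  (fun v : 'rV[K]_(d * B) => Mfil k (box (vec_mx v))).
exists m, (fun l => box (vec_mx (row l G))); split=> // x hx.
have xE := inM_boxE (proj1 hx) (hB x hx).
set M := \matrix_(j < d, i < B) _ in xE.
have /hG2 /submxP [c hc] : Mfil k (box (vec_mx (mxvec M))) by rewrite mxvecK -xE.
exists (fun l => c 0 l); rewrite xE -(mxvecK M) hc mulmx_sum_row.
have bD : {morph (fun v : 'rV[K]_(d * B) => box (vec_mx v)) : v w / v + w}.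
  by move=> v w; rewrite linearD boxD.
rewrite (big_morph _ bD (id1 := 0)); last by rewrite linear0 box0.
by apply: eq_bigr => l _; rewrite linearZ boxZ.
Qed.

Hypothesis d0 : (0 < d)%N.

(** If h <= 0, powers of t never lower the norm, so finitely many generators bound it from below on
    all of M; but the norm of tau^a e_0 tends to minus infinity. *)
Lemma slope_gt0 : 0 < h.
Proof.
rewrite ltNge; apply/negP => hh.
have [r [E [hE gE]]] := fingen.
have [k hk] := lat_ex_fin E.
have all x : inM x -> lat k x.
  move=> /gE [fs ->]; apply: lat_sum => l _; apply: lat_sum => i _.
  rewrite coef_polyL; apply: lat_cst; apply: latW (lat_Xn i (hk l)); nia.
have [c hc] := lat_up.
pose a := (absz (k - c)%R).+1.
have /hc := all _ (inM_tau a (inM_delta phi (Ordinal d0))).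
move=> /(_ (Ordinal d0) (- a%:Z)); rewrite !mxE !eqxx mulr1 coef_mono eqxx => e.
have /eqP : (1 : K) = 0 by apply: e; rewrite /a; nia.
by rewrite oner_eq0.
Qed.

(** The equation x = y T^n, respectively x = tau^h y, is solved in V, and [y] is truncated to M. The
    error lies in lat (- c) and its image in lat (- c - n h), whence the value of [k1]. *)
Lemma filtration_shift_ex : exists k1, 0 <= k1 /\ filtration_shift k1.
Proof.
have h0 := slope_gt0; have hE : h = (absz h)%:Z by lia.
have [c [c0 hc]] := small_lat; exists (c + n%:Z * h); split; first by nia.
have ck k : c + n%:Z * h <= k -> - k <= - c by nia.
move=> k hk x [hx hl]; split.
  have [y [hy xE]] := lat_XnV n hl.
  have [m [hm hym]] := inM_split y.
  have lym := hc _ hym.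
  exists m; first split=> //.
    have -> : m = y - (y - m) by rewrite subKr.
    apply: latB; last by apply: latW lym; apply: ck.
    by apply: latW hy; lia.
  split; first by apply: inMB => //; apply: (inMTn inMT).
  rewrite xE -mulmxBl; have := lat_Xn n lym; apply: latW; lia.
pose y := sg h *: x.
have hy : lat (- k) y by apply: latW (lat_sg h hl); lia.
have xE : x = sg (- h) *: y by rewrite scalerA mono1M addNr mono11 scale1r.
have [m [hm hym]] := inM_split y.
have lym := hc _ hym.
exists m; first split=> //.
  have -> : m = y - (y - m) by rewrite subKr.
  by apply: latB hy _; apply: latW lym; apply: ck.
split; first by apply: inMB => //; rewrite hE; apply: inM_tau.
rewrite [X in X - _]xE -scalerBr; have := lat_sg (- h) lym; apply: latW; lia.
Qed.

(** If [f] has degree a, then x T^a is a combination of the lower x T^i and has norm at least k - h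
    (a - 1) rather than k - h a. As t shifts the norm exactly, [x] gains h; iterating, its norm is
    infinite. *)
Lemma inM_torsion_free f x : inM x -> act T (polyL f) x = 0 -> f != 0 -> x = 0.
Proof.
move=> hx fx0 nf; have h0 := slope_gt0.
have step k : lat k x -> lat (k + h) x.
  move=> hk; set a := (size f).-1.
  have sza : size f = a.+1 by rewrite prednK // lt0n size_poly_eq0.
  have fa : f`_a != 0 by rewrite -lead_coefE lead_coef_eq0.
  have top : lat (k - h * (a%:Z - 1)) (x *m T ^+ a).
    have -> : x *m T ^+ a = - \sum_(i < a) cst phi (f`_i / f`_a) *: (x *m T ^+ i).
      have fV : cst phi (f`_a)^-1 * cst phi f`_a = 1 by rewrite -rmorphM mulVf // rmorph1.
      move: fx0; rewrite (@actE _ _ _ a.+1) ?size_polyL ?sza // big_ord_recr /=.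
      move/(congr1 (fun y => cst phi (f`_a)^-1 *: y)); rewrite scaler0 scalerDr.
      rewrite !coef_polyL scalerA fV scale1r => /eqP.
      rewrite addrC addr_eq0 => /eqP ->; rewrite scaler_sumr; congr (- _).
      by apply: eq_bigr => i _; rewrite coef_polyL scalerA -rmorphM mulrC.
    apply: latN; apply: lat_sum => i _; apply: lat_cst; apply: latW (lat_Xn i hk).
    have := ltn_ord i; nia.
  have [y [hy e]] := lat_XnV a top.
  have : x - y = 0.
    have : (x - y) *m T ^+ a = 0 by rewrite mulmxBl e subrr.
    elim: (a) => [|i IH]; first by rewrite expr0 mulmx1.
    by rewrite exprSr -mulmxE mulmxA => /T_inj.
  by move/eqP; rewrite subr_eq0 => /eqP ->; apply: latW hy; lia.
have [k hk] := lat_ex x.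
have all i : lat (k + h * i%:Z) x.
  elim: i => [|i IH]; first by rewrite mulr0 addr0.
  by apply: latW (step _ IH); nia.
apply: lat_all0 => k'; apply: latW (all (absz (k' - k)%R)); nia.
Qed.

Lemma basis_ex : exists r (E : 'I_r -> 'rV[L]_d), genV T E /\
  forall fs, lin T fs E = 0 -> forall l, fs l = 0.
Proof.
apply: (@free_of_torsion_free K _ (fun f x => act T (polyL f) x) _ _ _ (@inM K phi d)).
- by move=> f x y; apply: actDr.
- by move=> f g x; rewrite /polyL rmorphD actD.
- by move=> f g x; rewrite /polyL rmorphM actM.
- by move=> x y; apply: inMD.
- by move=> f x; apply: (inM_act inMT).
- by move=> f x; apply: inM_torsion_free.
exact: fingen.
Qed.

Section Basis.
Variables (r : nat) (E : 'I_r -> 'rV[L]_d).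
Hypothesis gE : genV T E.
Hypothesis indE : forall fs, lin T fs E = 0 -> forall l, fs l = 0.

Lemma lin_inj fs gs : lin T fs E = lin T gs E -> forall l, fs l = gs l.
Proof.
move=> e l; have := @indE (fun l => fs l + -1 *: gs l) _ l.
rewrite linD linZ rmorphN rmorph1 scaleN1r scaleN1r e subrr => /(_ erefl) /eqP.
by rewrite subr_eq0 => /eqP.
Qed.

(** Coordinates of elements of M_k1 have bounded size, by finite dimension. Each step from M_k to
    M_(k+nh) multiplies by t^n and adds an element of M_k1, so it raises the bound by n. *)
Lemma size_bound_ex k1 : 0 <= k1 -> filtration_shift k1 -> exists C : nat,
  forall (J : nat) fs, Mfil (k1 + n%:Z * h * J%:Z) (lin T fs E) ->
    forall l, (size (fs l) <= n * J + C)%N.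
Proof.
move=> k10 fil; have h0 := slope_gt0; case: gE => inE spanE.
have [B hB] := Mfil_bounded k1.
have /choice [co hco] : forall p : 'I_d * 'I_B, exists fs,
    sg (- p.2%:Z) *: delta_mx 0 p.1 = lin T fs E.
  by move=> p; apply: spanE; apply: inM_tau; apply: inM_delta.
pose C := (\max_(p : ('I_d * 'I_B) * 'I_r) size (co p.1 p.2))%N.
have base fs : Mfil k1 (lin T fs E) -> forall l, (size (fs l) <= C)%N.
  move=> hfs l.
  have -> : fs l = \sum_j \sum_(i < B) lin T fs E 0 j (- i%:Z) *: co (j, i) l.
    apply: (@lin_inj fs (fun l => \sum_j \sum_(i < B) lin T fs E 0 j (- i%:Z) *: co (j, i) l)).
    rewrite {1}(inM_expand (proj1 hfs) (hB _ hfs)).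
    rewrite [in RHS]/lin; under [RHS]eq_bigr => l' _.
      rewrite /polyL rmorph_sum act_sum.
      under eq_bigr => j _.
        rewrite rmorph_sum act_sum.
        under eq_bigr => i _ do rewrite /= map_polyZ actZ.
        over.
      over.
    rewrite [RHS]exchange_big /=; apply: eq_bigr => j _.
    rewrite [RHS]exchange_big /=; apply: eq_bigr => i _.
    by rewrite -scaler_sumr; congr (_ *: _); apply: (hco (j, i)).
  apply: (leq_trans (size_sum _ _ _)); apply/bigmax_leqP => j _.
  apply: (leq_trans (size_sum _ _ _)); apply/bigmax_leqP => i _.
  apply: (leq_trans (size_scale_leq _ _)).
  exact: (leq_bigmax (((j, i), l) : ('I_d * 'I_B) * 'I_r)).
exists C; elim=> [|J IH] fs hfs l.
  by rewrite muln0 add0n; apply: base; move: hfs; rewrite mulr0 addr0.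
have kJ : k1 <= k1 + n%:Z * h * J%:Z by nia.
have hfs' : Mfil (k1 + n%:Z * h * J%:Z + n%:Z * h) (lin T fs E).
  by apply: MfilW hfs; nia.
have [[m hm hw] _] := fil _ kJ _ hfs'.
have [gs mE] := spanE m (proj1 hm).
have [ws wE] := spanE _ (proj1 hw).
rewrite mE in hm; rewrite wE in hw.
have -> : fs l = 'X^n * gs l + ws l.
  apply: (@lin_inj fs (fun l => 'X^n * gs l + ws l)).
  by rewrite linD linXn -mE -wE addrC subrK.
apply: (leq_trans (size_polyD _ _)); rewrite geq_max; apply/andP; split.
  apply: (leq_trans (size_polyMleq _ _)); rewrite size_polyXn addSn /=.
  by have := IH gs hm l; rewrite mulnS -addnA leq_add2l.
by apply: leq_trans (base ws hw l) _; rewrite leq_addl.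
Qed.

(** Two comparisons of dimensions over K. Elements of tau-degree below h J, of dimension d h J, have
    coordinates of degree n J + O(1); coordinates of size at most n J, of dimension r n J, give
    elements of tau-degree h J + O(1). Letting J grow removes the constants. *)
Lemma weight_eq : (d%:Z * h = r%:Z * n%:Z).
Proof.
have h0 := slope_gt0; have hE : h = (absz h)%:Z by lia.
have [k1 [k10 fil]] := filtration_shift_ex.
have [C hC] := size_bound_ex k10 fil.
case: (gE) => inE spanE.
set H := absz h in hE.
apply/eqP; rewrite eq_le; apply/andP; split.
  have [k hk] := lat_ex_fin (fun j : 'I_d => delta_mx 0 j : 'rV[L]_d).
  have bound J : (d * (H * J) <= r * (n * (J + absz k) + C))%N.
    pose B := (H * J)%N; pose A := (n * (J + absz k) + C)%N.
    have /choice [co hco] : forall M : 'M[K]_(d, B), exists fs, box M = lin T fs E.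
      by move=> M; apply: spanE; apply: inM_box.
    have sz M l : (size (co M l) <= A)%N.
      apply: hC; rewrite -hco; split; first exact: inM_box.
      apply: lat_sum => j _; apply: lat_sum => i _; apply: lat_cst.
      apply: latW (lat_sg _ (hk j)); have := ltn_ord i; rewrite /B hE PoszD; nia.
    apply: (@linear_inj_dim K d B r A (fun M => \matrix_(l, i) (co M l)`_i)).
      move=> a M N; apply/matrixP => l i; rewrite !mxE.
      have -> : co (a *: M + N) l = a *: co M l + co N l.
        apply: (@lin_inj (co (a *: M + N)) (fun l => a *: co M l + co N l)).
        by rewrite linD linZ -!hco box_linear.
      by rewrite coefD coefZ.
    move=> M e; apply: box_inj; rewrite hco /lin big1 // => l _.
    have -> : co M l = 0; last by rewrite /polyL rmorph0 act0.
    apply/polyP => i; rewrite coef0; case: (ltnP i A) => hi; last first.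
      by rewrite nth_default // (leq_trans (sz M l)).
    by have := congr1 (fun M : 'M[K]_(r, A) => M l (Ordinal hi)) e; rewrite !mxE.
  rewrite leNgt; apply/negP => hlt.
  have hlt' : (r * n + 1 <= d * H)%N by nia.
  (* This [J] exceeds the additive constant of [bound], whereas d H > r n would force J to stay
     below it. *)
  have := bound ((r * (n * absz k + C)).+1); nia.
have [k hk] := lat_ex_fin E; have [c hc] := lat_up.
pose C' := ((absz (k - c)%R).+1)%N.
have bound J : (r * (n * J) <= d * (H * J + C'))%N.
  pose A := (n * J)%N; pose B := (H * J + C')%N.
  pose fl (M : 'M[K]_(r, A)) := fun l => \poly_(i < A) oapp (M l) 0 (insub i).
  have inF M : inM (lin T (fl M) E).
    by apply: inM_sum => l _; apply: (inM_act inMT).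
  have coefl M l (i : 'I_A) : (fl M l)`_i = M l i.
    by rewrite coef_poly ltn_ord valK.
  have bd M j : vge (lin T (fl M) E 0 j) (- B%:Z + 1).
    have : lat (k - h * A%:Z) (lin T (fl M) E).
      apply: lat_sum => l _; rewrite (@actE _ _ _ A) ?size_polyL ?size_poly //.
      apply: lat_sum => i _; rewrite coef_polyL; apply: lat_cst.
      by apply: latW (lat_Xn i (hk l)); have := ltn_ord i; nia.
    move/hc => /(_ j) e a ha; apply: e; rewrite /B /A hE in ha *.
    have e1 : n%:Z * a <= - (n%:Z * (H%:Z * J%:Z + C'%:Z)) by nia.
    have e2 : C'%:Z <= n%:Z * C'%:Z by nia.
    rewrite mulrDr in e1; rewrite PoszM mulrCA; lia.
  apply: (@linear_inj_dim K r A d B (fun M => \matrix_(j, i) (lin T (fl M) E) 0 j (- i%:Z))).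
    move=> a M N; apply/matrixP => j i; rewrite !mxE.
    have -> : lin T (fl (a *: M + N)) E = cst phi a *: lin T (fl M) E + lin T (fl N) E.
      rewrite -linZ -linD; apply: eq_bigr => l _; congr (act _ (polyL _) _).
      apply/polyP => i'; rewrite coefD coefZ.
      case: (ltnP i' A) => hi; last by rewrite !nth_default ?mulr0 ?addr0 ?size_poly // (leq_trans (size_poly _ _)).
      by rewrite -[i']/(nat_of_ord (Ordinal hi)) !coefl !mxE.
    by rewrite !mxE coefzD cst_mul.
  move=> M e.
  have z : lin T (fl M) E = 0 by rewrite (inM_boxE (inF M) (bd M)) e box0.
  apply/matrixP => l i; rewrite mxE -coefl.
  by rewrite (@indE (fl M) z l) coef0.
rewrite leNgt; apply/negP => hlt.
have hlt' : (d * H + 1 <= r * n)%N by nia.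
have := bound ((d * C').+1); nia.
Qed.

End Basis.
End Filtration.

(** * The field K((1/t)) *)

Definition idtwist (K : fieldType) : twist K.
Proof. by exists (fun _ x => x). Defined.

Section LaurentInInverseT.
Variable K : fieldType.
Local Notation S := (lser (idtwist K)).
Local Notation ms a := (mono (idtwist K) 1 a).

(* [K((1/t))] is the untwisted Laurent series ring in [1/t], hence the sign. *)
Definition toLT (f : S) : LT K := fun k => f (- k).

Lemma toLT_inj : injective toLT.
Proof.
move=> f g h; apply: lserext => k.
by have := congr1 (fun F : LT K => F (- k)) h; rewrite /toLT opprK.
Qed.
Lemma toLT_ubounded f : ubounded (toLT f).
Proof. by have [A hA] := vge_ex f; exists (- A) => k hk; apply: hA; lia. Qed.
Lemma toLT_onto g : ubounded g -> exists f, g = toLT f.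
Proof.
move=> [N hN]; have h : vge (fun k => g (- k)) (- N) by move=> k hk; apply: hN; lia.
by exists (mkser (idtwist K) h); apply/funext => k; rewrite /toLT /coefz /= opprK.
Qed.
Lemma uboundP (f : LT K) : ubounded f -> forall k, ubound f < k -> f k = 0.
Proof.
rewrite /ubound => hf; case: excluded_middle_informative => // H.
exact: (proj2_sig (constructive_indefinite_description _ H)).
Qed.

Lemma lt_mulE f g : lt_mul (toLT f) (toLT g) = toLT (f * g).
Proof.
apply/funext => k; rewrite /lt_mul isumE; last first.
  move=> a; rewrite mulf_eq0 negb_or => /andP [nf ng].
  have h1 := uboundP (toLT_ubounded f); have h2 := uboundP (toLT_ubounded g).
  have : ~~ (ubound (toLT f) < a) by apply/negP => /h1 /eqP; rewrite (negPf nf).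
  have : ~~ (ubound (toLT g) < k - a) by apply/negP => /h2 /eqP; rewrite (negPf ng).
  lia.
have [A hA] := vge_ex f; have [B hB] := vge_ex g.
pose s := zwin A (absz (- k - A - B)%R).+1.
rewrite [RHS]/toLT coefzM /convz [RHS](@fsumE _ _ s); last first.
  split; first exact: zwin_uniq.
  move=> a; rewrite mem_zwin => ha /=.
  case: (ltP a A) => h1; first by rewrite hA ?mul0r.
  by rewrite [g _]hB ?mulr0 //; lia.
rewrite [LHS](@fsumE _ _ [seq - a | a <- s]); last first.
  split; first by rewrite map_inj_uniq ?zwin_uniq //; exact: oppr_inj.
  move=> a; rewrite -{1}[a]opprK mem_map; last exact: oppr_inj.
  rewrite mem_zwin /toLT => ha.
  case: (ltP (- a) A) => h1; first by rewrite hA ?mul0r.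
  by rewrite [g _]hB ?mulr0 //; lia.
rewrite big_map; apply: eq_bigr => a _; rewrite /toLT opprK /=.
by congr (_ * g _); lia.
Qed.

Lemma toLT_sum I (r : seq I) (P : pred I) (F : I -> S) k :
  toLT (\sum_(i <- r | P i) F i) k = \sum_(i <- r | P i) toLT (F i) k.
Proof. exact: coefz_sum. Qed.
Lemma toLT_pow f : is_pow_series (toLT f) <-> vge f 0.
Proof.
split=> h k hk; last by apply: h; lia.
by have := h (- k); rewrite /toLT opprK; apply; lia.
Qed.

(** Polynomials in t embed in K((1/t)) just as K{tau} embeds in K((sigma)), with t the inverse of
    the uniformizer and a trivial twist. *)
Definition pS (f : {poly K}) : S := tau_ls (idtwist K) f.
Lemma poly_to_ltE f : poly_to_lt f = toLT (pS f).
Proof.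
apply/funext => k; rewrite /poly_to_lt /toLT /pS coef_tau_ls abszN.
by have -> : (- k <= 0) = (0 <= k) by lia.
Qed.
Lemma pSM f g : pS (f * g) = pS f * pS g.
Proof.
(* The ordinary product is the skew product for q = 1. *)
rewrite /pS -(@tau_lsM _ 1 id); last first.
  move=> a x /=; case: (- a) => n /=; first by rewrite exp1n expr1.
  by elim: n => //= n ->.
congr tau_ls; apply/polyP => n.
rewrite (@coef_skmul K 1 id (idtwist K)); last first.
  move=> a x /=; case: (- a) => m /=; first by rewrite exp1n expr1.
  by elim: m => //= m ->.
by rewrite coefM; apply: eq_bigr => i _; rewrite exp1n expr1.
Qed.
Lemma pSD f g : pS (f + g) = pS f + pS g. Proof. exact: tau_lsD. Qed.
Lemma pS_sum I (r : seq I) (P : pred I) (F : I -> {poly K}) :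
  pS (\sum_(i <- r | P i) F i) = \sum_(i <- r | P i) pS (F i).
Proof. exact: tau_ls_sum. Qed.
Lemma pSZ c f : pS (c *: f) = cst (idtwist K) c * pS f.
Proof. exact: tau_lsZ. Qed.
Lemma pSXn n : pS 'X^n = ms (- n%:Z).
Proof.
apply: lserext => k; rewrite /pS coef_tau_ls coef_mono coefXn.
case: ifP => hk; last by rewrite ifF //; lia.
have -> : (absz k == n)%N = (k == - n%:Z) by lia.
by case: eqP.
Qed.
Lemma size_pS f N : vge (pS f) (- N%:Z) <-> (size f <= N.+1)%N.
Proof.
split=> h.
  apply/leq_sizeP => j hj; rewrite -(coef_tau_lsN (idtwist K)); apply: h; lia.
move=> k hk; rewrite /pS coef_tau_ls; case: ifP => // hk0.
by move/leq_sizeP: h; apply; lia.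
Qed.

Lemma ms_comm a (f : S) : ms a * f = f * ms a.
Proof. by apply: lserext => k; rewrite mono_mul mul_mono mulrC. Qed.

Variable r : nat.
Implicit Types x y : 'rV[S]_r.
Definition toLTv x : LTvec K r := fun j => toLT (x 0 j).
Lemma toLTv_inj : injective toLTv.
Proof.
move=> x y h; apply/rowP => j; apply: toLT_inj.
exact: (congr1 (fun F : LTvec K r => F j) h).
Qed.
Lemma toLTv_valid x : valid_vec (toLTv x).
Proof. by move=> j; apply: toLT_ubounded. Qed.
Lemma toLTv_onto X : valid_vec X -> exists x, X = toLTv x.
Proof.
move=> h; have /choice [x hx] := fun j => toLT_onto (h j).
by exists (\row_j x j); apply/funext => j; rewrite /toLTv mxE.
Qed.

Lemma lin_combE m (c : 'I_m -> S) (g : 'I_m -> 'rV[S]_r) :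
  lin_comb (fun l => toLT (c l)) (fun l => toLTv (g l)) = toLTv (\sum_l c l *: g l).
Proof.
apply/funext => j; apply/funext => k; rewrite /lin_comb /toLTv summxE toLT_sum.
by apply: eq_bigr => l _; rewrite lt_mulE mxE.
Qed.

Definition spanS m (g : 'I_m -> 'rV[S]_r) x :=
  exists c : 'I_m -> S, (forall l, vge (c l) 0) /\ x = \sum_l c l *: g l.

Lemma in_spanE m (g : 'I_m -> 'rV[S]_r) X :
  in_span (fun l => toLTv (g l)) X <-> exists2 x, X = toLTv x & spanS g x.
Proof.
split=> [[c [hc ->]]|[x -> [c [hc ->]]]]; last first.
  by exists (fun l => toLT (c l)); split=> [l|]; [apply/toLT_pow|rewrite lin_combE].
have /choice [c' hc'] : forall l, exists f, c l = toLT f.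
  by move=> l; apply: toLT_onto; exists 0; apply: hc.
exists (\sum_l c' l *: g l); last first.
  by exists c'; split=> // l; apply/toLT_pow; rewrite -hc'; apply: hc.
by rewrite -lin_combE; congr lin_comb; apply/funext.
Qed.

Lemma vec_tpowE u x : vec_tpow u (toLTv x) = toLTv (ms (- u%:Z) *: x).
Proof.
apply/funext => j; apply/funext => k; rewrite /vec_tpow /toLTv /toLT mxE mono_mul.
by rewrite mul1r /=; congr (x 0 j _); lia.
Qed.

Lemma spanSD m (g : 'I_m -> 'rV[S]_r) x y : spanS g x -> spanS g y -> spanS g (x + y).
Proof.
move=> [a [ha ->]] [b [hb ->]]; exists (fun l => a l + b l); split.
  by move=> l; apply: vgeD.
by rewrite -big_split; apply: eq_bigr => l _; rewrite scalerDl.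
Qed.
Lemma spanSZ m (g : 'I_m -> 'rV[S]_r) (c : S) x : vge c 0 -> spanS g x -> spanS g (c *: x).
Proof.
move=> hc [a [ha ->]]; exists (fun l => c * a l); split.
  by move=> l; rewrite -[0](addr0 0); apply: vgeM.
by rewrite scaler_sumr; apply: eq_bigr => l _; rewrite scalerA.
Qed.
Lemma spanS0 m (g : 'I_m -> 'rV[S]_r) : spanS g 0.
Proof. by exists (fun _ => 0); split=> //; rewrite big1 // => l _; rewrite scale0r. Qed.
Lemma spanS_sum m (g : 'I_m -> 'rV[S]_r) I (s : seq I) (P : pred I) (F : I -> 'rV[S]_r) :
  (forall i, P i -> spanS g (F i)) -> spanS g (\sum_(i <- s | P i) F i).
Proof. by move=> H; apply: big_ind => //; [exact: spanS0|apply: spanSD]. Qed.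
Lemma spanSN m (g : 'I_m -> 'rV[S]_r) x : spanS g x -> spanS g (- x).
Proof. by move=> hx; rewrite -scaleN1r; apply: spanSZ => //; apply/vgeN/vge1. Qed.
Lemma spanSB m (g : 'I_m -> 'rV[S]_r) x y : spanS g x -> spanS g y -> spanS g (x - y).
Proof. by move=> hx hy; apply/spanSD/spanSN. Qed.

End LaurentInInverseT.

(** * Frobenius and the semilinear tau on K((1/t))^r *)

Section FrobeniusOnSeries.
Variables (K : fieldType) (p e q : nat) (qroot : K -> K).
Hypotheses (pp : prime p) (pK : p \in [pchar K]) (qE : q = (p ^ e)%N).
Hypothesis qrootK : forall x, qroot x ^+ q = x.
Local Notation S := (lser (idtwist K)).
Local Notation ms a := (mono (idtwist K) 1 a).

Lemma expq0 : (0 : K) ^+ q = 0.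
Proof. by rewrite expr0n gtn_eqF // qE expn_gt0 prime_gt0. Qed.
Lemma frS_subproof (f : S) : lbounded (fun k => f k ^+ q).
Proof.
have [A hA] := vge_ex f; exists A => k /hA ->.
exact: expq0.
Qed.
Definition frS f : S := Lser (idtwist K) (asboolT (frS_subproof f)).
Lemma coef_frS f k : frS f k = f k ^+ q. Proof. by []. Qed.
Lemma exprq_sum I (r : seq I) (P : pred I) (F : I -> K) :
  (\sum_(i <- r | P i) F i) ^+ q = \sum_(i <- r | P i) F i ^+ q.
Proof.
apply: (big_morph (fun x => x ^+ q)); first exact: (frobD1 pp pK qE).
by rewrite expq0.
Qed.
Lemma frS_is_zmod_morphism : zmod_morphism frS.
Proof.
move=> f g; apply: lserext => k; rewrite coefzB !coef_frS coefzB.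
apply: (addIr (g k ^+ q)).
by rewrite -(frobD1 pp pK qE) !subrK.
Qed.
Lemma vge_frS (f : S) A : vge f A -> vge (frS f) A.
Proof. by move=> h k hk; rewrite coef_frS h // expq0. Qed.
Lemma frS_is_monoid_morphism : monoid_morphism frS.
Proof.
split=> [|f g].
  apply: lserext => k; rewrite coef_frS coefz1; case: eqP => _; rewrite ?expr1n //.
  by rewrite expq0.
have [A hA] := vge_ex f; have [B hB] := vge_ex g.
apply: (@lser_win _ _ _ _ (A + B)).
- by apply: vge_frS; apply: vgeM.
- by apply: vgeM; apply: vge_frS.
move=> k; rewrite coef_frS.
have := lmulE k hA hB => ->; have := lmulE k (vge_frS hA) (vge_frS hB) => ->.
by rewrite exprq_sum; apply: eq_bigr => i _; rewrite exprMn.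
Qed.
HB.instance Definition _ := GRing.isZmodMorphism.Build S S frS frS_is_zmod_morphism.
HB.instance Definition _ := GRing.isMonoidMorphism.Build S S frS frS_is_monoid_morphism.

Lemma frS_mono c a : frS (mono (idtwist K) c a) = mono (idtwist K) (c ^+ q) a.
Proof.
apply: lserext => k; rewrite coef_frS !coef_mono; case: eqP => // _.
by rewrite expq0.
Qed.
(** Coefficientwise q-th roots keep all valuation bounds. By this use of perfectness, the image
    under tau of a K[[1/t]]-module is again stable under K[[1/t]]. *)
Lemma frS_root f : exists g, f = frS g /\ forall A, vge f A -> vge g A.
Proof.
have [A hA] := vge_ex f.
have q0 : qroot 0 = 0.
  apply: (expq_inj pp pK qE); rewrite /= qrootK.
  by rewrite expq0.
have h : vge (fun k => qroot (f k)) A by move=> k hk; rewrite hA.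
exists (mkser (idtwist K) h); split.
  by apply: lserext => k; rewrite coef_frS /coefz /= qrootK.
by move=> B hB k hk; change (qroot (f k) = 0); rewrite hB.
Qed.

Lemma lt_frobE f : lt_frob q (toLT f) = toLT (frS f). Proof. by []. Qed.

Lemma frS_pS f : frS (pS f) = pS (map_poly (fun x => x ^+ q) f).
Proof.
apply: lserext => k; rewrite coef_frS /pS !coef_tau_ls; case: ifP => _.
  rewrite coef_map_id0 //.
  by rewrite expq0.
by rewrite expq0.
Qed.
Variable r : nat.
Implicit Types x y : 'rV[S]_r.
Variable C : 'I_r -> 'I_r -> {poly K}.
Definition tauS x : 'rV[S]_r := map_mx frS x *m \matrix_(j, k) pS (C j k).

Lemma vec_tauE x : vec_tau q C (toLTv x) = toLTv (tauS x).
Proof.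
apply/funext => k; apply/funext => i; rewrite /vec_tau /toLTv mxE toLT_sum.
by apply: eq_bigr => j _; rewrite !mxE lt_frobE poly_to_ltE lt_mulE.
Qed.
Lemma iter_vec_tauE n x : iter n (vec_tau q C) (toLTv x) = toLTv (iter n tauS x).
Proof. by elim: n => //= n ->; rewrite vec_tauE. Qed.
Lemma tauSD x y : tauS (x + y) = tauS x + tauS y.
Proof. by rewrite /tauS map_mxD mulmxDl. Qed.
Lemma tauSB x y : tauS (x - y) = tauS x - tauS y.
Proof. by rewrite /tauS map_mxB mulmxBl. Qed.
Lemma tauSZ c x : tauS (c *: x) = frS c *: tauS x.
Proof. by rewrite /tauS map_mxZ scalemxAl. Qed.
Lemma tauS0 : tauS 0 = 0. Proof. by rewrite -[0](subrr 0) tauSB !subrr. Qed.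
Lemma tauS_ms a x : tauS (ms a *: x) = ms a *: tauS x.
Proof. by rewrite tauSZ frS_mono expr1n. Qed.

Lemma iter_tauSD n x y : iter n tauS (x + y) = iter n tauS x + iter n tauS y.
Proof. by elim: n => //= n ->; rewrite tauSD. Qed.
Lemma iter_tauSB n x y : iter n tauS (x - y) = iter n tauS x - iter n tauS y.
Proof. by elim: n => //= n ->; rewrite tauSB. Qed.
Lemma iter_tauS0 n : iter n tauS 0 = 0.
Proof. by elim: n => //= n ->; rewrite tauS0. Qed.
Lemma iter_tauSZ n c x : iter n tauS (c *: x) = iter n frS c *: iter n tauS x.
Proof. by elim: n => //= n ->; rewrite tauSZ. Qed.
Lemma iter_tauS_ms n a x : iter n tauS (ms a *: x) = ms a *: iter n tauS x.
Proof. by elim: n => //= n ->; rewrite tauS_ms. Qed.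
Lemma iter_tauS_sum n I (s : seq I) (F : I -> 'rV[S]_r) :
  iter n tauS (\sum_(i <- s) F i) = \sum_(i <- s) iter n tauS (F i).
Proof. exact: (big_morph (iter n tauS) (iter_tauSD n) (iter_tauS0 n)). Qed.
Lemma iter_frS_vge n (c : S) A : vge c A -> vge (iter n frS c) A.
Proof. by move=> h; elim: n => //= n; apply: vge_frS. Qed.
Lemma iter_frS_root n c : exists c', c = iter n frS c' /\ forall A, vge c A -> vge c' A.
Proof.
elim: n c => [|n IH] c; first by exists c.
have [b [eb hb]] := frS_root c; have [a [ea ha]] := IH b.
exists a; split=> [|A hA]; first by rewrite iterS -ea.
by apply: ha; apply: hb.
Qed.

End FrobeniusOnSeries.

(** * Coordinates with respect to a K[t]-basis of the motive *)

Section Coordinates.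
Variables (K : fieldType) (p e q : nat) (qroot : K -> K) (phi : twist K).
Hypotheses (pp : prime p) (pK : p \in [pchar K]) (qE : q = (p ^ e)%N).
Hypothesis phiE : forall a x, phi a x = frob_int q qroot (- a) x.
Local Notation L := (lser phi).
Local Notation S := (lser (idtwist K)).
Local Notation ms a := (mono (idtwist K) 1 a).
Local Notation sg a := (mono phi 1 a).
Variables (d : nat) (T : 'M[L]_d) (r : nat) (E : 'I_r -> 'rV[L]_d).
Variable C : 'I_r -> 'I_r -> {poly K}.
Hypothesis tauE : forall j, sg (- 1) *: E j = lin T (C j) E.
Local Notation tauS := (tauS pp qE C).

Definition pv (fs : 'I_r -> {poly K}) : 'rV[S]_r := \row_j pS (fs j).

Lemma pvD fs gs : pv (fun l => fs l + gs l) = pv fs + pv gs.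
Proof. by apply/rowP => j; rewrite !mxE pSD. Qed.
Lemma pvB fs gs : pv (fun l => fs l - gs l) = pv fs - pv gs.
Proof.
by apply/eqP; rewrite eq_sym subr_eq -pvD; apply/eqP; congr pv; apply/funext => l; rewrite subrK.
Qed.
Lemma pvZ c fs : pv (fun l => c *: fs l) = cst _ c *: pv fs.
Proof. by apply/rowP => j; rewrite !mxE pSZ. Qed.
Lemma pvXn n fs : pv (fun l => 'X^n * fs l) = ms (- n%:Z) *: pv fs.
Proof. by apply/rowP => j; rewrite !mxE pSM pSXn. Qed.
Lemma pv0 : pv (fun _ => 0) = 0.
Proof. by apply/rowP => j; rewrite !mxE /pS tau_ls0. Qed.
Lemma pv_split (x : 'rV[S]_r) : exists fs, forall j, vge ((x - pv fs) 0 j) 1.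
Proof.
have [m [hm hx]] := inM_split x.
have /choice [fs hfs] : forall j, exists f, m 0 j = pS f.
  by move=> j; apply: tau_ls_onto; apply: hm.
exists fs => j; suff -> : pv fs = m by apply: hx.
by apply/rowP => l; rewrite mxE hfs.
Qed.

Lemma linB fs gs : lin T (fun l => fs l - gs l) E = lin T fs E - lin T gs E.
Proof.
apply/eqP; rewrite eq_sym subr_eq -linD; apply/eqP.
by congr lin; apply/funext => l; rewrite subrK.
Qed.
Lemma lin0 : lin T (fun _ => 0) E = 0.
Proof. by rewrite /lin big1 // => l _; rewrite /polyL rmorph0 act0. Qed.
Lemma lin_sum I (s : seq I) (F : I -> 'I_r -> {poly K}) :
  lin T (fun l => \sum_(i <- s) F i l) E = \sum_(i <- s) lin T (F i) E.
Proof.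
elim: s => [|i s IH].
  rewrite big_nil -[RHS]lin0; congr lin; apply/funext => l; by rewrite big_nil.
rewrite big_cons -IH -linD; congr lin; apply/funext => l; by rewrite big_cons.
Qed.
Lemma linM f gs : lin T (fun l => f * gs l) E = act T (polyL phi f) (lin T gs E).
Proof.
rewrite /lin (big_morph (act T _) (actDr T _) (id1 := 0)); last first.
  by rewrite /act big1 // => i _; rewrite mul0mx scaler0.
by apply: eq_bigr => l _; rewrite /polyL rmorphM actM.
Qed.

Definition tq (fs : 'I_r -> {poly K}) k :=
  \sum_j map_poly (fun x => x ^+ q) (fs j) * C j k.

Lemma pv_tq fs : pv (tq fs) = tauS (pv fs).
Proof.
apply/rowP => k; rewrite !mxE pS_sum; apply: eq_bigr => j _.
by rewrite !mxE pSM frS_pS.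
Qed.

Lemma sg_cst c : sg (- 1) * cst phi c = cst phi (c ^+ q) * sg (- 1).
Proof.
rewrite !monoM tw1 mulr1 mul1r addr0 add0r; congr mono.
by rewrite phiE opprK /= expn1.
Qed.
Lemma sg_act f x : sg (- 1) *: act T (polyL phi f) x =
  act T (polyL phi (map_poly (fun x => x ^+ q) f)) (sg (- 1) *: x).
Proof.
have hs : (size (polyL phi (map_poly (fun x => x ^+ q) f)) <= size f)%N.
  by rewrite size_polyL size_poly.
rewrite (actE _ _ hs) /act size_polyL scaler_sumr; apply: eq_bigr => i _.
have -> : (polyL phi (map_poly (fun x => x ^+ q) f))`_i = cst phi (f`_i ^+ q).
  by rewrite coef_polyL coef_map_id0 // (expq0 K pp qE).
by rewrite coef_polyL scalerA sg_cst -scalerA scalemxAl.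
Qed.

Lemma lin_tq fs : lin T (tq fs) E = sg (- 1) *: lin T fs E.
Proof.
rewrite lin_sum [in RHS]/lin scaler_sumr; apply: eq_bigr => j _.
by rewrite linM sg_act tauE.
Qed.
(** A coordinate vector in K[t]^r has an image in K((1/t))^r, where tau acts as [tauS], and one in
    V, where tau is multiplication by sigma^(-1). Both maps intertwine with [tq], which links the
    two completions. *)
Lemma iter_tq n fs : pv (iter n tq fs) = iter n tauS (pv fs) /\
  lin T (iter n tq fs) E = sg (- n%:Z) *: lin T fs E.
Proof.
elim: n => [|n [IH1 IH2]]; first by rewrite /= oppr0 mono11 scale1r.
rewrite /= pv_tq IH1 lin_tq IH2 scalerA mono1M; split=> //.
by congr (mono _ _ _ *: _); lia.
Qed.

End Coordinates.

(** With [spanS_absorbing]: a lattice lies between t^(-b) K[[1/t]]^r and t^a K[[1/t]]^r. *)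
Lemma spanS_bounded (K : fieldType) r m (G : 'I_m -> 'rV[lser (idtwist K)]_r) :
  exists a : nat, forall x, spanS G x -> forall j, vge (x 0 j) (- a%:Z).
Proof.
have [A hA] := vqge_ex_fin (u := 1) isT G.
exists (absz A) => x [c [hc ->]] j; rewrite summxE; apply: vge_sum => l _.
rewrite mxE -[- _]add0r; apply: vgeM => //; apply/(@vge_qge K 1 isT).
by apply: qgeW (hA l j); lia.
Qed.
Lemma spanS_absorbing (K : fieldType) r m (G : 'I_m -> 'rV[lser (idtwist K)]_r) :
  (exists B : 'I_r -> 'rV[lser (idtwist K)]_r, (forall j, spanS G (B j)) /\
     forall x, exists c : 'I_r -> lser (idtwist K), x = \sum_j c j *: B j) ->
  exists b : nat, forall x : 'rV[lser (idtwist K)]_r, (forall j, vge (x 0 j) b%:Z) -> spanS G x.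
Proof.
move=> [B [hB sB]].
have /choice [c hc] : forall i : 'I_r, exists c : 'I_r -> lser (idtwist K),
  delta_mx 0 i = \sum_j c j *: B j by move=> i; apply: sB.
have [A hA] := vqge_ex_fin (u := 1) isT (fun i => \row_j c i j).
exists (absz A) => x hx; rewrite (row_sum_delta x); apply: spanS_sum => i _.
rewrite hc scaler_sumr; apply: spanS_sum => j _; rewrite scalerA; apply: spanSZ => //.
have : vge (c i j) A by apply/(@vge_qge K 1 isT); have := hA i j; rewrite mxE mul1r.
by move/(vgeM (hx i)); apply: vgeW; lia.
Qed.

(** * Purity bounds the growth of the powers of [phi_t] *)

Section PureGrowth.
Variables (K : fieldType) (phi : twist K).
Local Notation L := (lser phi).
Local Notation S := (lser (idtwist K)).
Local Notation ms a := (mono (idtwist K) 1 a).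
Local Notation sg a := (mono phi 1 a).
Variables (d : nat) (T : 'M[L]_d) (r : nat) (E : 'I_r -> 'rV[L]_d).
Hypothesis inMT : forall x : 'rV[L]_d, inM x -> inM (x *m T).
Hypothesis gE : genV T E.
Hypothesis injE : forall fs gs, lin T fs E = lin T gs E -> fs = gs.
Variables (m : nat) (G : 'I_m -> 'rV[S]_r).
Hypothesis latG : exists B : 'I_r -> 'rV[S]_r, (forall j, spanS G (B j)) /\
     forall x, exists c : 'I_r -> S, x = \sum_j c j *: B j.
Local Notation Lam := (spanS G).

(* [Hfil k] is the intersection of the motive with [t^k Lam]. *)
Definition Hfil (k : int) (x : 'rV[L]_d) :=
  exists fs, x = lin T fs E /\ Lam (ms k *: pv fs).

Lemma Lam_ms a x : 0 <= a -> Lam x -> Lam (ms a *: x).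
Proof. by move=> ha; apply: spanSZ; apply: vgeW (@vge_mono _ _ _ _). Qed.
Lemma HfilW k k' x : k <= k' -> Hfil k x -> Hfil k' x.
Proof.
move=> hk [fs [-> hl]]; exists fs; split=> //.
have -> : ms k' = ms (k' - k) * ms k by rewrite mono1M subrK.
by rewrite -scalerA; apply: Lam_ms => //; lia.
Qed.
Lemma HfilD k x y : Hfil k x -> Hfil k y -> Hfil k (x + y).
Proof.
move=> [fs [-> h1]] [gs [-> h2]]; exists (fun l => fs l + gs l); rewrite linD pvD.
by split=> //; rewrite scalerDr; apply: spanSD.
Qed.
Lemma Hfil0 k : Hfil k 0.
Proof. by exists (fun _ => 0); rewrite lin0 pv0 scaler0; split=> //; apply: spanS0. Qed.
Lemma Hfil_sum k I (s : seq I) (P : pred I) (F : I -> 'rV[L]_d) :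
  (forall i, P i -> Hfil k (F i)) -> Hfil k (\sum_(i <- s | P i) F i).
Proof. by move=> H; apply: big_ind => //; [exact: Hfil0|apply: HfilD]. Qed.
Lemma Hfil_cst k c x : Hfil k x -> Hfil k (cst phi c *: x).
Proof.
move=> [fs [-> h]]; exists (fun l => c *: fs l); rewrite linZ pvZ; split=> //.
by rewrite scalerA ms_comm -scalerA; apply: spanSZ => //; apply: vge_cst.
Qed.
Lemma Hfil_ex x : inM x -> exists k : nat, Hfil k%:Z x.
Proof.
case: gE => _ sE /sE [fs ->]; have [b hb] := spanS_absorbing latG.
have [A hA] := vqge_ex (u := 1) isT (pv fs).
exists (absz (b%:Z - A)%R); exists fs; split=> //; apply: hb => j; rewrite mxE.
have : vge (pv fs 0 j) A by apply/(@vge_qge K 1 isT); rewrite mul1r; apply: hA.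
move/(vgeM (@vge_mono K (idtwist K) 1 (absz (b%:Z - A)%R)%:Z)).
by apply: vgeW; lia.
Qed.

Lemma Hfil_T j k x : Hfil k x -> Hfil (k + j%:Z) (x *m T ^+ j).
Proof.
move=> [fs [-> h]]; exists (fun l => 'X^j * fs l); rewrite linXn pvXn; split=> //.
by rewrite scalerA mono1M addrK.
Qed.
(** There is no error term here, because coordinates in K[t]^r are unique. *)
Lemma Hfil_TV j k x : inM x -> Hfil k (x *m T ^+ j) -> Hfil (k - j%:Z) x.
Proof.
case: gE => _ sE /sE [fs ->] [gs []]; rewrite -linXn => /injE <-.
by rewrite pvXn scalerA mono1M => h; exists fs.
Qed.

Variables (p e q : nat) (qroot : K -> K).
Hypotheses (pp : prime p) (pK : p \in [pchar K]) (qE : q = (p ^ e)%N).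
Hypothesis phiE : forall a x, phi a x = frob_int q qroot (- a) x.
Variable C : 'I_r -> 'I_r -> {poly K}.
Hypothesis tauE : forall j, sg (- 1) *: E j = lin T (C j) E.
Local Notation tauS := (tauS pp qE C).
Variables (u v : nat).
Hypotheses (u0 : (0 < u)%N) (v0 : (0 < v)%N).
Hypothesis pureG : forall x, (exists2 y, Lam y & x = ms (- u%:Z) *: y) <->
  (exists2 y, Lam y & x = iter v tauS y).

Lemma Hfil_tau k x : Hfil k x -> Hfil (k + u%:Z) (sg (- v%:Z) *: x).
Proof.
move=> [fs [-> h]]; exists (iter v (tq q C) fs).
have [e1 e2] := iter_tq pp pK qE phiE tauE v fs; rewrite e2 e1; split=> //.
have /pureG [y hy ey] : exists2 y, Lam y & iter v tauS (ms k *: pv fs) = iter v tauS y.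
  by exists (ms k *: pv fs).
have -> : ms (k + u%:Z) *: iter v tauS (pv fs) = ms u%:Z *: iter v tauS (ms k *: pv fs).
  by rewrite (iter_tauS_ms pp pK qE) scalerA mono1M addrC.
by rewrite ey scalerA mono1M subrr mono11 scale1r.
Qed.
Lemma Hfil_taun (i : nat) k x : Hfil k x ->
  Hfil (k + u%:Z * i%:Z) (sg (- (v * i)%N%:Z) *: x).
Proof.
move=> h; elim: i => [|i IH]; first by rewrite muln0 mulr0 addr0 mono11 scale1r.
have := Hfil_tau IH; rewrite scalerA mono1M mulzS addrA.
by have -> : - v%:Z + - (v * i)%N%:Z = - (v * i.+1)%N%:Z by rewrite mulnS; lia.
Qed.

(* Truncating the coordinates gives [Hfil (k + u) = tau^v (Hfil k) + Hfil K0] for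
   large [k], hence a bound on the degree in [tau], by induction on [k]. *)
Lemma Hfil_upper : exists c : int, forall k x, Hfil k x -> vqge u x (- (v%:Z * k + c)).
Proof.
have [a ha] := spanS_bounded G; have [b hb] := spanS_absorbing latG.
have coefv k fs j : Lam (ms k *: pv fs) -> vge (pS (fs j)) (- (a%:Z + k)).
  move=> /ha /(_ j); rewrite !mxE => h i hi.
  have := h (i + k); rewrite mono_mul mul1r addrK; apply; lia.
(* [b] absorbs the truncation remainder [zz] below, and [u] is the shift caused by tau^v. *)
pose K0 := (b + u)%N.
have [A hA] := vqge_ex_fin u0
   (fun p : 'I_r * 'I_(a + K0).+1 => E p.1 *m T ^+ p.2).
have base x : Hfil K0%:Z x -> vqge u x A.
  move=> [fs [-> h]]; apply: vqge_sum => l _.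
  have hs : (size (fs l) <= (a + K0).+1)%N by apply/size_pS; apply: coefv h.
  rewrite (@actE _ _ _ (a + K0).+1) ?size_polyL //; apply: vqge_sum => i _.
  rewrite coef_polyL -[A]add0r; apply: vqgeZ => //; first exact: qge_cst.
  exact: (hA (l, i)).
(* The term v a handles negative indices down to - a; below - a the piece [Hfil k] is zero. *)
pose c := `|A| + v%:Z * a%:Z; exists c.
have main (N : nat) k x : k <= K0%:Z + N%:Z -> Hfil k x -> vqge u x (- (v%:Z * k + c)).
  elim: N k x => [|N IH] k x hk hx.
    rewrite addr0 in hk.
    case: (ltP k (- a%:Z)) => hka; last first.
      by apply: vqgeW (base x (HfilW hk hx)); rewrite /c; nia.
    suff -> : x = 0 by apply: vqge0.
    case: hx => fs [-> h]; rewrite -[RHS](lin0 T E); congr lin; apply/funext => j.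
    apply/polyP => i; rewrite coef0 -(coef_tau_lsN (idtwist K)).
    by apply: (coefv k fs j h); lia.
  case: (leP k (K0%:Z + N%:Z)) => hkN; first exact: IH.
  have kE : k = K0%:Z + N%:Z + 1 by lia.
  pose k' := k - u%:Z.
  case: (hx) => fs [xE h].
  have /pureG [y' hy' ey'] : exists2 y, Lam y & ms k' *: pv fs = ms (- u%:Z) *: y.
    by exists (ms k *: pv fs) => //; rewrite scalerA mono1M addrC.
  pose y := ms (- k') *: y'.
  have Xy : pv fs = iter v tauS y.
    by rewrite (iter_tauS_ms pp pK qE) -ey' scalerA mono1M addNr mono11 scale1r.
  (* In coordinates [x] is exactly tau^v y; the polynomial part [gs] of [y] gives an element of M in
     [Hfil k']. *)
  have [gs hz] := pv_split y; pose zz := y - pv gs.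
  have Lz : Lam (ms b%:Z *: zz).
    apply: hb => j; rewrite mxE; have := vgeM (@vge_mono K (idtwist K) 1 b%:Z) (hz j).
    by apply: vgeW; lia.
  have Lg : Lam (ms k' *: pv gs).
    have -> : ms k' *: pv gs = y' - ms (k' - b%:Z) *: (ms b%:Z *: zz).
      rewrite scalerA mono1M subrK /zz scalerBr /y scalerA mono1M subrr mono11 scale1r.
      by rewrite subKr.
    apply: spanSB => //; apply: Lam_ms => //; rewrite /k' kE /K0; lia.
  have [e1 e2] := iter_tq pp pK qE phiE tauE v gs.
  have Hw : Hfil K0%:Z (x - sg (- v%:Z) *: lin T gs E).
    exists (fun l => fs l - iter v (tq q C) gs l); rewrite linB -xE e2; split=> //.
    rewrite pvB Xy e1 -(iter_tauSB pp pK qE) -/zz.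
    have -> : ms K0%:Z *: iter v tauS zz = ms u%:Z *: iter v tauS (ms b%:Z *: zz).
      by rewrite (iter_tauS_ms pp pK qE) scalerA mono1M addrC.
    have /pureG [y2 hy2 ->] : exists2 y, Lam y &
        iter v tauS (ms b%:Z *: zz) = iter v tauS y by exists (ms b%:Z *: zz).
    by rewrite scalerA mono1M subrr mono11 scale1r.
  rewrite -[x](subrK (sg (- v%:Z) *: lin T gs E)); apply: vqgeD.
    by apply: vqgeW (base _ Hw); rewrite /c; nia.
  have hlin : vqge u (lin T gs E) (- (v%:Z * k' + c)).
    by apply: (IH k'); [rewrite /k' kE; lia|exists gs].
  have hsg : qge u (sg (- v%:Z)) (u%:Z * - v%:Z).
    by apply/(@vge_qge K u u0); apply: vge_mono.
  by have := vqgeZ u0 hsg hlin; apply: vqgeW; rewrite /k'; nia.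
move=> k x; apply: (main (absz (k - K0%:Z)%R)); lia.
Qed.

(** Only tau^i e_j with u i <= - A occur in x. In i = v (i / v) + (i mod v), each block tau^v costs
    u steps, and the finitely many residues cost at most [k1]. *)
Lemma Hfil_lower : exists c : int, forall x A k, inM x -> vqge u x A ->
  - A + c <= v%:Z * k -> Hfil k x.
Proof.
have /choice [kk hkk] : forall pr : 'I_d * 'I_v, exists k : nat,
    Hfil k%:Z (sg (- pr.2%:Z) *: delta_mx 0 pr.1).
  by move=> pr; apply: Hfil_ex; apply: inM_tau; apply: inM_delta.
pose k1 := (\max_pr kk pr)%N; exists (v%:Z * k1%:Z) => x A k hx hA hk.
have [B hB] : exists B : nat, forall j, vge (x 0 j) (- B%:Z + 1).
  have [A1 hA1] := vqge_ex (u := 1) isT x; exists (absz A1).+1 => j.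
  by apply/(@vge_qge K 1 isT); apply: qgeW (hA1 j); lia.
rewrite (inM_expand hx hB); apply: Hfil_sum => j _; apply: Hfil_sum => i _.
case: (ltP (u%:Z * - i%:Z) A) => hi.
  by rewrite (hA j _ hi) rmorph0 scale0r; apply: Hfil0.
apply: Hfil_cst.
have hmod : (i %% v < v)%N by rewrite ltn_mod.
have := Hfil_taun (i %/ v) (hkk (j, Ordinal hmod)).
rewrite /= scalerA mono1M.
have -> : - (v * (i %/ v))%N%:Z + - (i %% v)%N%:Z = - i%:Z.
  by rewrite {3}(divn_eq i v); lia.
apply: HfilW.
have h1 : (kk (j, Ordinal hmod) <= k1)%N by apply: leq_bigmax.
have h2 : (v * (i %/ v) <= i)%N by rewrite mulnC leq_trunc_div.
have h3 : v%:Z * (kk (j, Ordinal hmod))%:Z <= v%:Z * k1%:Z by nia.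
have h4 : v%:Z * (u%:Z * (i %/ v)%N%:Z) <= u%:Z * i%:Z by nia.
have h5 : v%:Z * ((kk (j, Ordinal hmod))%:Z + u%:Z * (i %/ v)%N%:Z) <= v%:Z * k by lia.
by move: h5; rewrite ler_pM2l.
Qed.

(** t shifts [Hfil] exactly, so the bound holds on the standard basis with a constant free of j; it
    extends to V because right multiplication by T is L-linear. *)
Lemma growth_upper : exists c, forall x j A,
  vqge u x A -> vqge u (x *m T ^+ j) (A - v%:Z * j%:Z - c).
Proof.
have [c hc] := Hfil_upper.
have /choice [kk hkk] : forall i : 'I_d, exists k : nat, Hfil k%:Z (delta_mx 0 i).
  by move=> i; apply: Hfil_ex; apply: inM_delta.
pose k1 := (\max_i kk i)%N; exists (v%:Z * k1%:Z + c) => x j A hx.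
rewrite (row_sum_delta x) mulmx_suml; apply: vqge_sum => i _.
rewrite -scalemxAl; have := vqgeZ u0 (hx i) (hc _ _ (Hfil_T j (hkk i))).
apply: vqgeW; have : (kk i <= k1)%N by apply: leq_bigmax.
nia.
Qed.

(** On M, a bound on x T^j places it in some [Hfil k], hence x in [Hfil (k - j)]. A general x is
    first multiplied by a high power of tau and truncated to M; [growth_upper] controls T^j on the
    truncation error. *)
Lemma growth_lower : exists c, forall x j A,
  vqge u (x *m T ^+ j) A -> vqge u x (A + v%:Z * j%:Z - c).
Proof.
have [c hc] := Hfil_upper; have [c' hc'] := Hfil_lower.
have [c2 B1] := growth_upper.
pose C0 := c + c' + v%:Z.
have onM x j A : inM x -> vqge u (x *m T ^+ j) A -> vqge u x (A + v%:Z * j%:Z - C0).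
  move=> hx hA.
  have [k [hk1 hk2]] : exists k, - A + c' <= v%:Z * k /\ v%:Z * k <= - A + c' + v%:Z.
    exists (((- A + c') %/ v%:Z)%Z + 1).
    have eqv := divz_eq (- A + c') v%:Z.
    have h1 : ((- A + c') %% v%:Z)%Z < v%:Z by apply: ltz_pmod; lia.
    have h2 : 0 <= ((- A + c') %% v%:Z)%Z by apply: modz_ge0; lia.
    by split; nia.
  have hj : inM (x *m T ^+ j) by apply: inMTn.
  have /(Hfil_TV hx) /hc := hc' _ _ _ hj hA hk1.
  by apply: vqgeW; rewrite /C0; nia.
exists C0 => x j A hA.
(* [i] may depend on [A] and [j], as it cancels at the end; it is large enough for the truncation
   error to meet every bound required. *)
pose i := (absz A + absz (A + v%:Z * j%:Z + c2)%R + absz (A + v%:Z * j%:Z - C0)%R)%N.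
have [m' [hm' hym]] := inM_split (sg (- i%:Z) *: x).
set y := sg (- i%:Z) *: x in hym.
have hy0 : vqge u (y - m') 0.
  by move=> l; have := hym l; rewrite (@vge_qge K u u0) mulr1; exact: qgeW.
have hsg a : qge u (sg a) (u%:Z * a) by apply/(@vge_qge K u u0); apply: vge_mono.
have hmT : vqge u (m' *m T ^+ j) (A - u%:Z * i%:Z).
  have -> : m' *m T ^+ j = sg (- i%:Z) *: (x *m T ^+ j) - (y - m') *m T ^+ j.
    by rewrite mulmxBl -scalemxAl subKr.
  apply: vqgeB.
    by have := vqgeZ u0 (hsg (- i%:Z)) hA; apply: vqgeW; lia.
  by have := B1 _ j _ hy0; apply: vqgeW; rewrite /i; nia.
have hm := onM _ _ _ hm' hmT.
have hy : vqge u y (A - u%:Z * i%:Z + v%:Z * j%:Z - C0).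
  rewrite -[y](subrK m') addrC; apply: vqgeD => //.
  by apply: vqgeW hy0; rewrite /i; nia.
have -> : x = sg i%:Z *: y by rewrite scalerA mono1M subrr mono11 scale1r.
by have := vqgeZ u0 (hsg i%:Z) hy; apply: vqgeW; lia.
Qed.

End PureGrowth.

(** * Construction of a lattice from the filtration *)

Lemma one_minus_left_inverse (K : fieldType) m (beta : 'M[K]_m) n : (0 < n)%N ->
  exists U : 'M[lser (idtwist K)]_m, (forall a b, vge (U a b) 0) /\
    U *m (1%:M - \matrix_(a, b) mono (idtwist K) (beta a b) n%:Z) = 1%:M.
Proof.
move=> n0.
(* The coefficients of the geometric series sum_j beta^j x^(n j). *)
pose uf a b := fun k : int => if (0 <= k) && (n %| absz k)%N
  then (beta ^+ (absz k %/ n)) a b else 0.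
have uv a b : vge (uf a b) 0 by move=> k hk; rewrite /uf leNgt hk.
exists (\matrix_(a, b) mkser (idtwist K) (uv a b)); split.
  by move=> a b; rewrite mxE; apply: uv.
have coefU a b k : mkser (idtwist K) (uv a b) k = uf a b k by [].
apply/matrixP => a c; rewrite mulmxBr mulmx1 !mxE; apply: lserext => k.
rewrite coefzB coefz_sum coefU.
under eq_bigr => b _ do rewrite !mxE mul_mono coefU /=.
have -> : ((a == c)%:R : lser (idtwist K)) k = ((k == 0) && (a == c))%:R.
  by case: (a == c); rewrite ?andbT ?andbF ?coefz1 ?coefz0.
case: (ltP k n%:Z) => hk.
  rewrite big1 ?subr0; last by move=> b _; rewrite /uf ifF ?mul0r //; lia.
  rewrite /uf; case: (eqVneq k 0) => [->|nk] /=.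
    by rewrite dvdn0 div0n expr0 mxE.
  case: ifP => // /andP [h0 hd].
  by have := dvdn_leq (m := absz k) _ hd; lia.
have [j kE] : exists j : nat, k = j%:Z + n%:Z by exists (absz (k - n%:Z)%R); lia.
have -> : (k == 0) = false by lia.
apply/eqP; rewrite subr_eq add0r; apply/eqP; rewrite {}kE in hk *.
have e1 : absz (j%:Z + n%:Z)%R = (j + n)%N by lia.
have e2 : j%:Z + n%:Z - n%:Z = j%:Z by rewrite addrK.
rewrite /uf e1 e2 /= dvdn_addl //; case: (n %| j)%N; last first.
  by rewrite big1 // => b _; rewrite mul0r.
rewrite divnDr // divnn n0 addn1 exprSr -mulmxE mxE.
by apply: eq_bigr => b _.
Qed.

Section EdgePure.
Variables (K : fieldType) (p e q : nat) (qroot : K -> K) (phi : twist K).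
Hypotheses (pp : prime p) (pK : p \in [pchar K]) (qE : q = (p ^ e)%N).
Hypothesis qrootK : forall x, qroot x ^+ q = x.
Hypothesis phiE : forall a x, phi a x = frob_int q qroot (- a) x.
Local Notation L := (lser phi).
Local Notation S := (lser (idtwist K)).
Local Notation ms a := (mono (idtwist K) 1 a).
Local Notation sg a := (mono phi 1 a).
Variables (d : nat) (T : 'M[L]_d) (r : nat) (E : 'I_r -> 'rV[L]_d).
Hypothesis inMT : forall x : 'rV[L]_d, inM x -> inM (x *m T).
Hypothesis gE : genV T E.
Hypothesis injE : forall fs gs, lin T fs E = lin T gs E -> fs = gs.
Variable C : 'I_r -> 'I_r -> {poly K}.
Hypothesis tauE : forall j, sg (- 1) *: E j = lin T (C j) E.
Local Notation tauS := (tauS pp qE C).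

Variables (n H : nat) (m : nat) (g : 'I_m -> 'rV[L]_d).
(** They stand for the steps M_k and M_(k+nh) of the filtration, with k large. *)
Variables N0 N1 : 'rV[L]_d -> Prop.
Hypothesis n0 : (0 < n)%N.
Hypothesis N0M : forall x, N0 x -> inM x.
Hypothesis N0g : forall l, N0 (g l).
Hypothesis N0gen : forall x, N0 x -> exists c : 'I_m -> K, x = \sum_l cst phi (c l) *: g l.
Hypothesis N0E : forall l, N0 (E l).
Hypothesis N1T : forall l, N1 (g l *m T ^+ n).
Hypothesis N1tau : forall l, N1 (sg (- H%:Z) *: g l).
Hypothesis N1s : forall x, N1 x -> (exists2 y, N0 y & N0 (x - y *m T ^+ n)) /\
  (exists2 y, N0 y & N0 (x - sg (- H%:Z) *: y)).

Lemma coord_ex : exists X : 'rV[L]_d -> 'rV[S]_r,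
  forall fs, X (lin T fs E) = pv fs.
Proof.
have /choice [co hco] : forall x, exists fs, inM x -> x = lin T fs E.
  move=> x; case: (pselect (inM x)) => [hx|hx]; last by exists (fun _ => 0).
  by have [fs ->] := proj2 gE x hx; exists fs.
exists (fun x => pv (co x)) => fs; congr pv; apply: injE; rewrite -hco //.
by apply: inM_sum => l _; apply: inM_act => //; case: gE.
Qed.

(* The lattice is spanned by [N0]. On its generators [g] the hypotheses read
   [t^n g = tau^H y + beta g] with [beta] a matrix over K, so that
   [(1 - t^-n beta) g = t^-n tau^H y]; the left factor is invertible over K[[1/t]]. *)
Lemma pure_of_filtration : exists G : 'I_m -> 'rV[S]_r,
  (exists B : 'I_r -> 'rV[S]_r, (forall j, spanS G (B j)) /\
     forall x, exists c : 'I_r -> S, x = \sum_j c j *: B j /\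
       forall c', x = \sum_j c' j *: B j -> c' = c) /\
  forall x, (exists2 y, spanS G y & x = ms (- n%:Z) *: y) <->
            (exists2 y, spanS G y & x = iter H tauS y).
Proof.
have [X hX] := coord_ex.
have repr x : inM x -> exists fs, x = lin T fs E by case: gE => _; apply.
have XD x y : inM x -> inM y -> X (x + y) = X x + X y.
  by move=> /repr [fs ->] /repr [gs ->]; rewrite -linD !hX pvD.
have XZ c x : inM x -> X (cst phi c *: x) = cst _ c *: X x.
  by move=> /repr [fs ->]; rewrite -linZ !hX pvZ.
have XT x i : inM x -> X (x *m T ^+ i) = ms (- i%:Z) *: X x.
  by move=> /repr [fs ->]; rewrite -linXn !hX pvXn.
have Xtau x i : inM x -> X (sg (- i%:Z) *: x) = iter i tauS (X x).
  move=> /repr [fs ->]; have [e1 e2] := iter_tq pp pK qE phiE tauE i fs.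
  by rewrite -e2 !hX e1.
have X0 : X 0 = 0 by rewrite -(lin0 T E) hX pv0.
have Xsum (c : 'I_m -> K) : X (\sum_l cst phi (c l) *: g l) =
    \sum_l cst (idtwist K) (c l) *: X (g l).
  have [] : inM (\sum_l cst phi (c l) *: g l) /\ X (\sum_l cst phi (c l) *: g l) =
    \sum_l cst (idtwist K) (c l) *: X (g l); last by [].
  elim/big_rec2: _ => [|l y x _ [hx e0]]; first by split; [exact: inM0|].
  have hg : inM (cst phi (c l) *: g l) by apply/inM_cst/N0M.
  by split; [apply: inMD|rewrite XD // XZ ?e0 //; apply: N0M].
pose G l := X (g l); exists G.
have N0span x : N0 x -> spanS G (X x).
  move=> /N0gen [c ->]; rewrite Xsum; exists (fun l => cst _ (c l)); split=> // l.
  exact: vge_cst.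
have N1span x : inM x -> N1 x -> spanS G (ms n%:Z *: X x).
  move=> hx /N1s [[y hy hxy] _].
  have -> : X x = ms (- n%:Z) *: X y + X (x - y *m T ^+ n).
    have hyM := N0M hy; rewrite -XT // -XD; last exact: N0M.
      by rewrite addrC subrK.
    exact: inMTn.
  rewrite scalerDr scalerA mono1M subrr mono11 scale1r; apply: spanSD; first exact: N0span.
  by apply: spanSZ (N0span _ hxy); apply: vgeW (@vge_mono _ _ _ _).
split.
  exists (fun j => delta_mx 0 j); split=> [j|x].
    have -> : delta_mx 0 j = X (E j).
      have -> : E j = lin T (fun l => (l == j)%:R) E.
        rewrite /lin (bigD1 j) //= eqxx big1 ?addr0 => [|l /negPf ->].
          by rewrite /polyL rmorph1 act1.
        by rewrite /polyL rmorph0 act0.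
      rewrite hX; apply/rowP => l; rewrite !mxE eqxx /=.
      case: (l == j); last by rewrite /pS tau_ls0.
      by have := pSXn K 0; rewrite expr0 oppr0 => ->.
    exact: N0span.
  exists (fun j => x 0 j); split; first exact: row_sum_delta.
  move=> c' ->; apply/funext => j; rewrite summxE (bigD1 j) //= big1 ?addr0.
    by rewrite !mxE !eqxx mulr1.
  by move=> l nl; rewrite !mxE eqxx eq_sym (negPf nl) mulr0.
(* tau^H maps the generators into [N1], which lies in t^n N0 + N0 and so in t^n times the
   lattice. *)
have sub1 y : spanS G y -> spanS G (ms n%:Z *: iter H tauS y).
  move=> [c [hc ->]].
  rewrite (@iter_tauS_sum K p e q pp pK qE) scaler_sumr; apply: spanS_sum => l _.
  rewrite (@iter_tauSZ K p e q pp pK qE) scalerA ms_comm -scalerA.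
  apply: spanSZ; first exact: iter_frS_vge.
  rewrite /G -Xtau; last exact: N0M.
  by apply: N1span => //; apply: inM_tau; apply: N0M.
have sub2 : exists Y : 'I_m -> 'rV[S]_r, (forall l, spanS G (Y l)) /\
    exists V : 'M[S]_m, (forall a b, vge (V a b) 0) /\
    forall l, ms (- n%:Z) *: G l = \sum_b V l b *: iter H tauS (Y b).
  have /choice [y hy] : forall l, exists y, N0 y /\ N0 (g l *m T ^+ n - sg (- H%:Z) *: y).
    by move=> l; have [_ [y h1 h2]] := N1s (N1T l); exists y.
  have /choice [be hbe] : forall l, exists c : 'I_m -> K,
      g l *m T ^+ n - sg (- H%:Z) *: y l = \sum_b cst phi (c b) *: g b.
    by move=> l; apply: N0gen; case: (hy l).
  exists (fun l => X (y l)); split; first by move=> l; apply: N0span; case: (hy l).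
  have key l : ms (- n%:Z) *: G l = iter H tauS (X (y l)) +
      \sum_b cst (idtwist K) (be l b) *: G b.
    rewrite /G -XT; last exact: N0M.
    have hyl : inM (y l) by apply: N0M; case: (hy l).
    rewrite -Xsum -hbe -Xtau // -XD; first by rewrite addrC subrK.
      exact: inM_tau.
    by apply: N0M; case: (hy l).
  have [U [hU eU]] := one_minus_left_inverse (\matrix_(a, b) be a b) n0.
  exists U; split=> // l.
  pose Gm : 'M[S]_(m, r) := \matrix_(a, j) G a 0 j.
  pose Tm : 'M[S]_(m, r) := \matrix_(a, j) iter H tauS (X (y a)) 0 j.
  have eG : (1%:M - \matrix_(a, b) mono (idtwist K) ((\matrix_(a, b) be a b) a b) n%:Z) *m Gm
      = ms n%:Z *: Tm.
    rewrite mulmxBl mul1mx; apply/eqP; rewrite subr_eq; apply/eqP/matrixP => a j.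
    have : G a = ms n%:Z *: (ms (- n%:Z) *: G a).
      by rewrite scalerA mono1M subrr mono11 scale1r.
    rewrite key scalerDr => /rowP /(_ j); rewrite !mxE => ->; congr (_ + _).
    rewrite summxE mulr_sumr; apply: eq_bigr => b _; rewrite !mxE mulrA; congr (_ * _).
    by rewrite monoM mul1r addr0.
  have := congr1 (mulmx U) eG; rewrite mulmxA eU mul1mx => eGm.
  apply/rowP => j; move/matrixP: eGm => /(_ l j).
  rewrite !mxE => ->; rewrite mulr_sumr summxE; apply: eq_bigr => b _.
  rewrite !mxE !mulrA ms_comm -(mulrA (U l b)) mono1M addNr mono11 mulr1 //.
move=> x; split=> [[y hy ->]|[y hy ->]].
  have [Y [hY [V [hV eV]]]] := sub2.
  case: hy => c [hc ->].
  have -> : ms (- n%:Z) *: (\sum_l c l *: G l) =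
      \sum_b (\sum_l c l * V l b) *: iter H tauS (Y b).
    rewrite scaler_sumr; under eq_bigr => l _.
      rewrite scalerA ms_comm -scalerA eV scaler_sumr.
      under eq_bigr => b _ do rewrite scalerA.
      over.
    by rewrite exchange_big /=; apply: eq_bigr => b _; rewrite scaler_suml.
  (* To pass under tau^H a coefficient must be an H-fold Frobenius image; perfectness of K provides
     the root. *)
  have /choice [w hw] : forall b, exists c', \sum_l c l * V l b = iter H (frS pp qE) c' /\
      forall A, vge (\sum_l c l * V l b) A -> vge c' A.
    by move=> b; apply: (iter_frS_root pp pK qE qrootK).
  exists (\sum_b w b *: Y b).
    apply: spanS_sum => b _; apply: spanSZ => //; have [_] := hw b; apply.
    by apply: vge_sum => l _; rewrite -[0](addr0 0); apply: vgeM.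
  rewrite (@iter_tauS_sum K p e q pp pK qE); apply: eq_bigr => b _.
  by rewrite (@iter_tauSZ K p e q pp pK qE); have [-> _] := hw b.
exists (ms n%:Z *: iter H tauS y); first exact: sub1.
by rewrite scalerA mono1M addNr mono11 scale1r.
Qed.

End EdgePure.

(** * Transfer to the given definitions and conclusion *)

Section Assembly.
Variables (K : fieldType) (p e q : nat) (qroot : K -> K) (phi : twist K).
Hypotheses (pp : prime p) (pK : p \in [pchar K]) (qE : q = (p ^ e)%N).
Hypothesis qrootK : forall x, qroot x ^+ q = x.
Hypothesis phiE : forall a x, phi a x = frob_int q qroot (- a) x.
Local Notation L := (lser phi).
Local Notation S := (lser (idtwist K)).
Local Notation ms a := (mono (idtwist K) 1 a).
Variables (d : nat) (D : 'I_d -> 'I_d -> {poly K}).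
Hypothesis d0 : (0 < d)%N.
Hypothesis fg : mot_fingen q D.
Local Notation T := (skew_mx phi D).

Lemma inMT x : inM x -> inM (x *m T).
Proof. exact: (inM_t phiE). Qed.

Lemma mot_basisE r (b : 'I_r -> Mot K d) : mot_basis q D b ->
  genV T (fun l => toV phi (b l)) /\
  forall fs gs, lin T fs (fun l => toV phi (b l)) = lin T gs (fun l => toV phi (b l)) ->
    fs = gs.
Proof. by move=> /(mot_basis_toV phiE) [h1 h2]; split. Qed.

Lemma growth_of_pure : pure q D -> exists u v : nat, [/\ (0 < u)%N,
  exists C, forall x j A, vqge u x A -> vqge u (x *m T ^+ j) (A - v%:Z * j%:Z - C) &
  exists C, forall x j A, vqge u (x *m T ^+ j) A -> vqge u x (A + v%:Z * j%:Z - C)].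
Proof.
move=> [r [b [C [/mot_basisE [gE injE] [tauE [m [g [u [v [[vg latg] [u0 [v0 pureg]]]]]]]]]]]].
have {}tauE j : mono phi 1 (- 1) *: toV phi (b j) = lin T (C j) (fun l => toV phi (b l)).
  by rewrite -(toV_tau phiE) tauE (toV_lin phiE).
have /choice [G hG] : forall l, exists x : 'rV[S]_r, g l = toLTv x.
  by move=> l; apply: toLTv_onto; apply: vg.
have gG : g = fun l => toLTv (G l) by apply/funext.
have latG : exists B : 'I_r -> 'rV[S]_r, (forall j, spanS G (B j)) /\
     forall x, exists c : 'I_r -> S, x = \sum_j c j *: B j.
  case: latg => B [hB [_ [sB _]]].
  have /choice [B' hB'] : forall j, exists x : 'rV[S]_r, B j = toLTv x /\ spanS G x.
    move=> j; have := hB j; rewrite gG => /in_spanE [x e1 e2].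
    by exists x.
  exists B'; split=> [j|x]; first by case: (hB' j).
  have [c [hc xc]] := sB _ (toLTv_valid x).
  have /choice [c' hc'] := fun l => toLT_onto (hc l).
  exists c'; apply: toLTv_inj; rewrite xc -lin_combE; congr lin_comb.
    by apply/funext.
  by apply/funext => j; case: (hB' j).
have pureG x : (exists2 y, spanS G y & x = ms (- u%:Z) *: y) <->
    (exists2 y, spanS G y & x = iter v (tauS pp qE C) y).
  have := pureg (toLTv x); rewrite gG => -[h1 h2]; split=> [[y hy xy]|[y hy xy]].
    have [] := h1.
      by exists (toLTv y); split; [apply/in_spanE; exists y|rewrite vec_tpowE -xy].
    move=> Y [/in_spanE [w -> hw]]; rewrite (iter_vec_tauE pp qE) => /toLTv_inj ->.
    by exists w.
  have [] := h2.
    exists (toLTv y); split; first by apply/in_spanE; exists y.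
    by rewrite (iter_vec_tauE pp qE) -xy.
  move=> Y [/in_spanE [w -> hw]]; rewrite vec_tpowE => /toLTv_inj ->.
  by exists w.
exists u, v; split=> //.
  exact: (growth_upper gE latG pK phiE tauE u0 v0 pureG).
exact: (growth_lower inMT gE injE latG pK phiE tauE u0 v0 pureG).
Qed.

Section Edge.
Variables (n : nat) (h : int) (lat : int -> 'rV[L]_d -> Prop).
Hypothesis n0 : (0 < n)%N.
Hypothesis latW : forall k k' x, k' <= k -> lat k x -> lat k' x.
Hypothesis lat0 : forall k, lat k 0.
Hypothesis latD : forall k x y, lat k x -> lat k y -> lat k (x + y).
Hypothesis latZ : forall (a : L) B k x, qge n a B -> lat k x -> lat (k + B) (a *: x).
Hypothesis latX : forall k x, lat k x -> lat (k - h) (x *m T).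
Hypothesis latXV : forall k x, lat k x -> exists y, lat (k + h) y /\ x = y *m T.
Hypothesis lat_low : exists c, forall x A, vqge n x A -> lat (A - c) x.
Hypothesis lat_up : exists c, forall k x, lat k x -> vqge n x (k - c).
Hypothesis T_inj : forall x : 'rV[L]_d, x *m T = 0 -> x = 0.

Let fgV : exists r (E : 'I_r -> 'rV[L]_d), genV T E.
Proof. exact: fingen_genV. Qed.

Lemma edge_weight r (b : 'I_r -> Mot K d) : mot_basis q D b -> d%:Z * h = r%:Z * n%:Z.
Proof.
move=> /mot_basisE [gE injE].
apply: (weight_eq inMT n0 latW lat0 latD latZ latX latXV lat_low lat_up fgV d0 gE) => fs e0 l.
suff -> : fs = fun _ => 0 by [].
by apply: injE; rewrite e0 lin0.
Qed.

Lemma edge_pure : pure q D.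
Proof.
have h0 : 0 < h := slope_gt0 n0 latW lat0 latD latZ latX lat_low lat_up fgV d0.
have [r [E [gE indE]]] := basis_ex inMT n0 latW lat0 latD latZ latX latXV lat_low lat_up T_inj fgV d0.
have injE fs gs : lin T fs E = lin T gs E -> fs = gs.
  by move=> e0; apply/funext; apply: (lin_inj indE).
have [k1 [k10 fil]] := filtration_shift_ex inMT n0 latW lat0 latD latZ latX latXV lat_low lat_up fgV d0.
pose MF := @Mfil K phi d lat.
have /choice [kE hkE] : forall l, exists k, MF k (E l).
  by move=> l; apply: (Mfil_ex n0 lat_low); case: gE.
(* Large enough for the shift property and for M_k to contain the basis [E], so that M_k spans a
   full lattice. *)
pose k := k1 + \sum_l `|kE l|.
have hk1 : k1 <= k by rewrite lerDl; apply: sumr_ge0.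
have hkk l : kE l <= k.
  rewrite /k (bigD1 l) //=; have : 0 <= \sum_(j < r | j != l) `|kE j| by apply: sumr_ge0.
  by move: (\sum_(j < r | _) _) => s; lia.
have MW (k2 k3 : int) (x : 'rV[L]_d) : k2 <= k3 -> MF k2 x -> MF k3 x by move=> hk; apply: (MfilW latW hk).
have [m [g [hg gg]]] := Mfil_generators n0 lat_up k.
pose H := absz h; have hH : h = H%:Z by rewrite /H; lia.
have /choice [C hC] : forall j, exists fs, mono phi 1 (- 1) *: E j = lin T fs E.
  by move=> j; have [hE sE] := gE; apply: sE; apply: (inM_tau 1).
have [|||l|l|l|x hx|G [[B [hB sB]] pG]] := @pure_of_filtration K p e q qroot phi pp pK qE qrootK phiE d T
  r E inMT gE injE C hC n H m g (MF k) (MF (k + n%:Z * h)) n0.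
- by move=> x [].
- exact: hg.
- exact: gg.
- exact: MW (hkk l) (hkE l).
- have := Mfil_Tn inMT latX n (hg l); by rewrite mulrC.
- by have := Mfil_tau n0 latZ H (hg l); rewrite -hH.
- have [[y hy hy2] [w hw hw2]] := fil k hk1 x hx; split.
    by exists y => //; apply: MW hy2.
  by exists w => //; rewrite -hH; apply: MW hw2.
have /choice [b hb] : forall l, exists m, E l = toV phi m.
  by move=> l; apply: toV_onto; case: gE.
have Eb : E = fun l => toV phi (b l) by apply/funext.
exists r, b, C; split; first by apply/(mot_basis_toV phiE); rewrite -Eb; split.
split.
  move=> j; apply: (@toV_inj _ phi); rewrite (toV_tau phiE) (toV_lin phiE) -hb -Eb.
  exact: hC.
exists m, (fun l => toLTv (G l)), n, H; split; last first.
  split=> //; split; first by rewrite /H; lia.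
  move=> x; split=> [[y [/in_spanE [w -> hw] ->]]|[y [/in_spanE [w -> hw] ->]]].
    have [w' hw' ew] := proj1 (pG (ms (- n%:Z) *: w)) (ex_intro2 _ _ w hw erefl).
    exists (toLTv w'); split; first by apply/in_spanE; exists w'.
    by rewrite (iter_vec_tauE pp qE) vec_tpowE ew.
  have [w' hw' ew] := proj2 (pG (iter H (tauS pp qE C) w)) (ex_intro2 _ _ w hw erefl).
  exists (toLTv w'); split; first by apply/in_spanE; exists w'.
  by rewrite (iter_vec_tauE pp qE) vec_tpowE ew.
split; first by move=> l; apply: toLTv_valid.
exists (fun j => toLTv (B j)); split; first by move=> j; apply/in_spanE; exists (B j).
split; first by move=> j; apply: toLTv_valid.
split=> [x /toLTv_onto [y ->]|c hc c0 l].
  have [c [-> _]] := sB y; exists (fun l => toLT (c l)).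
  by split=> [l|]; [apply: toLT_ubounded|rewrite lin_combE].
have /choice [c' hc'] := fun l => toLT_onto (hc l).
have cc : c = fun l => toLT (c' l) by apply/funext.
have [a [_ ha]] := sB 0.
have e1 : c' = a.
  apply: ha; apply: toLTv_inj; rewrite -lin_combE -cc c0.
  by apply/funext => j; apply/funext => i; rewrite /toLTv mxE.
have e2 : (fun _ => 0) = a by apply: ha; rewrite big1 // => j _; rewrite scale0r.
by rewrite cc e1 -e2.
Qed.

End Edge.
End Assembly.

Theorem theorem7p2 (K : fieldType) (p e q : nat) (qroot : K -> K) (theta : K)
    (d : nat) (D : 'I_d -> 'I_d -> {poly K}) (lam : nat -> LP K) :
  (* F_q, q = p^e, is contained in K *)
  prime p -> p \in [pchar K] -> (0 < e)%N -> q = (p ^ e)%N ->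
  (exists s : seq K, [/\ uniq s, size s = q & all (fun x => x ^+ q == x) s]) ->
  (* K is perfect; qroot is the inverse of x |-> x^q *)
  (forall x, qroot x ^+ q = x) ->
  (0 < d)%N ->
  (* t-module condition: d(phi_t) - ell(t) is nilpotent on Lie(E), ell(t) = theta *)
  (exists n : nat, ((\matrix_(i, j) (D i j)`_0 - theta%:M) ^+ n = 0 :> 'M[K]_d)) ->
  (* E is abelian *)
  mot_fingen q D ->
  (* lam_0, ..., lam_(d-1) are the invariant factors of D *)
  invariant_factors q qroot D lam ->
  (pure q D <-> exists s : rat, np_one_edge (lam d.-1) s)
  /\ (forall s : rat, np_one_edge (lam d.-1) s ->
        forall (r : nat) (b : 'I_r -> Mot K d), mot_basis q D b ->
          (d%:R / r%:R : rat) = s^-1).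
Proof.
move=> pp pK _ qE _ qrootK d0 _ fg inv.
have [phi phiE] := frob_twist pp pK qE qrootK.
have [l [hl [P [P' [Q [Q' [eqv PP PP' QQ QQ']]]]] ml divl]] := invariant_factors_mx phiE d0 inv.
have hz : (d.-1 < d)%N by rewrite prednK.
pose z := Ordinal hz.
have /choice [c hc] : forall i, exists c, l z = c * l i.
  by move=> i; apply: divl; rewrite /= -ltnS prednK.
have [X XT] := skew_mx_left_inverse phiE fg.
have lz : lam d.-1 = lp_of (l z) := hl z.
have edge s : np_one_edge (lp_of (l z)) s -> pure q D /\
    forall (r : nat) (b : 'I_r -> Mot K d), mot_basis q D b -> (d%:R / r%:R : rat) = s^-1.
  move=> np; have [n [h [[n0 szl] sE l0 v0 lq]]] := edge_data eqv PP' QQ QQ' ml XT np.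
  pose lt := lat (skew_mx phi D) Q' n h.
  have lW : forall k k' x, k' <= k -> lt k x -> lt k' x by apply: latW.
  have l00 : forall k, lt k 0 by apply: lat0.
  have lD : forall k x y, lt k x -> lt k y -> lt k (x + y) by apply: latD.
  have lZ : forall (a : lser phi) B k x, qge n a B -> lt k x -> lt (k + B) (a *: x).
    exact: latZ n0.
  have lX := latX eqv PP' QQ QQ' ml hc n0 szl lq.
  have lXV := latXV eqv PP' QQ QQ' hc n0 szl lq l0 v0.
  have llow := lat_lower eqv PP' QQ QQ' ml hc h n0 szl.
  have lup : exists c, forall k x, lt k x -> vqge n x (k - c).
    exact: lat_upper.
  have Tinj := D_inj eqv PP' QQ QQ' hc XT.
  split.
    exact: (edge_pure pp pK qE qrootK phiE d0 fg n0 lW l00 lD lZ lX lXV llow lup Tinj).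
  move=> r b hb.
  have wt := edge_weight phiE d0 fg n0 lW l00 lD lZ lX lXV llow lup hb.
  have h0 : 0 < h.
    have fgV := fingen_genV phiE fg.
    exact: (slope_gt0 n0 lW l00 lD lZ lX llow lup fgV d0).
  (* r = 0 would give d h = 0, although both factors are positive. *)
  have rn : (r%:R : rat) != 0.
    rewrite pnatr_eq0; apply/negP => /eqP r0; move: wt; rewrite r0; nia.
  have hn : (h%:~R : rat) != 0 by rewrite intr_eq0; lia.
  have nn : (n%:R : rat) != 0 by rewrite pnatr_eq0 -lt0n.
  have wq : (d%:R * h%:~R : rat) = r%:R * n%:R.
    by have := congr1 (fun a : int => a%:~R : rat) wt; rewrite !rmorphM /= -!pmulrn.
  rewrite sE invf_div; apply/eqP; rewrite eqr_div //; apply/eqP.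
  by rewrite wq mulrC.
rewrite lz; split; last by move=> s /edge [].
split; last by move=> [s /edge []].
move=> /(growth_of_pure pp pK qE phiE) [u [v [u0 gu gl]]].
exists (v%:R / u%:R).
exact: (one_edge_of_growth eqv PP' QQ QQ' ml hc XT d0 u0 gu gl).
Qed.
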